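(* For a greedy policy and an alternating policy applied to the same label sequences, with match counts $M_{\mathbf G}(n)$ and $M_{\mathbf A}(n)$, $$\liminf_{n\to\infty}\frac{M_{\mathbf G}(n)-M_{\mathbf A}(n)}{n^{5/4}(\log_2 n)^{1/4}}=-\infty\ \text{a.s.},\qquad \limsup_{n\to\infty}\frac{M_{\mathbf G}(n)-M_{\mathbf A}(n)}{n^{5/4}(\log_2 n)^{1/4}}=\infty\ \text{a.s.},$$ and $$\frac{M_{\mathbf G}(n)-M_{\mathbf A}(n)}{n^{5/4}(\log_2 n)^{1/4}}=O\bigl((\log n)^{1/2}\bigr)\quad\text{a.s.}$$
   Context: Let $(r_i)_{i\ge1}$, $(s_i)_{i\ge1}$ be probability vectors on the positive integers with $\mu:=\sum_i r_is_i>0$. Let $\{L_{\mathbf R}(n)\}_{n\ge1}$, $\{L_{\mathbf S}(n)\}_{n\ge1}$ be independent i.i.d. sequences with $\Pr(L_{\mathbf R}(1)=i)=r_i$, $\Pr(L_{\mathbf S}(1)=i)=s_i$. For $m\ge0$ let $\tilde N_{\mathbf R}(m)$ be the vector with entries $N_{\mathbf R}(m,i)=\sum_{j=1}^m\mathbf 1\{L_{\mathbf R}(j)=i\}$, and $\tilde N_{\mathbf S}(m)$ analogously. Put $X_{\mathbf R}(n)=s_{L_{\mathbf R}(n)}$, $X_{\mathbf S}(n)=r_{L_{\mathbf S}(n)}$ (common mean $\mu$, variances $\sigma_{\mathbf R}^2,\sigma_{\mathbf S}^2$; standing assumption $\sigma_{\mathbf R}+\sigma_{\mathbf S}>0$),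 $\Gamma_{\mathbf R}[m]=\sum_{j=1}^mX_{\mathbf R}(j)$, $\Gamma_{\mathbf S}[m]=\sum_{j=1}^mX_{\mathbf S}(j)$. A reading policy is a $\{0,1\}$-valued process $C(n)$ ($C(n)=1$ iff the $n$-th record is read from $\mathbf R$), $R(n)=\sum_{j\le n}C(j)$, $S(n)=n-R(n)$, with $C(n)$ being $\mathcal F_{n-1}$-measurable where $\mathcal F_n=\mathcal F_0\vee\sigma(L_{\mathbf R}(1),\dots,L_{\mathbf R}(R(n));L_{\mathbf S}(1),\dots,L_{\mathbf S}(S(n)))$ and $\mathcal F_0$ (randomization, for both policies) is independent of the labels. Matches: $M(n)=\tilde N_{\mathbf R}(R(n))\cdot\tilde N_{\mathbf S}(S(n))$. An alternating policy is $\mathcal F_0$-measurable with $R(2n)=n$ for all $n$. A greedy policy satisfies, for $n\ge1$, $C(n+1)=1$ if $\Gamma_{\mathbf S}[S(n)]>\Gamma_{\mathbf R}[R(n)]$ and $C(n+1)=0$ if $\Gamma_{\mathbf S}[S(n)]<\Gamma_{\mathbf R}[R(n)]$ (ties arbitrary). $\log_2 n=\log\log n$. *)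

(* Defs.v *)
From HB Require Import structures.
From mathcomp Require Import all_boot all_order all_algebra.
From mathcomp Require Import all_classical all_reals all_analysis.
Set Implicit Arguments. Unset Strict Implicit. Unset Printing Implicit Defensive.
Import Order.TTheory GRing.Theory Num.Theory.
Import numFieldNormedType.Exports.
Local Open Scope classical_set_scope.
Local Open Scope ring_scope.

(* Conventions: labels are indexed from 0: [LR j] is the paper's L_R(j+1).
   A probability vector on the positive integers is [r : nat -> R] with
   [r 0 = 0], [r i >= 0] and [sum_i r i = 1]. *)

Definition prob_vector {R : realType} (r : nat -> R) : Prop :=
  r 0%N = 0 /\ (forall i, 0 <= r i) /\ (series r @ \oo --> (1 : R)).

Definition rsum {R : realType} (f : nat -> R) : R := lim (series f @ \oo).

Definition mutually_independent {d} {T : measurableType d} {R : realType}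
  (P : probability T R) {I : eqType} (F : I -> set (set T)) : Prop :=
  forall (J : seq I) (A : I -> set T), uniq J ->
    (forall i, i \in J -> F i (A i)) ->
    P (\big[setI/setT]_(i <- J) A i) = (\prod_(i <- J) P (A i))%E.

Definition hist (l : nat -> nat) (m : nat) : seq nat := mkseq l m.

(* A (realized) reading policy: [pol n hR hS] is the decision C(n+1)
   (true = read from R) given the labels observed so far from R and S. *)
Fixpoint counts (pol : nat -> seq nat -> seq nat -> bool) (lr ls : nat -> nat)
  (n : nat) : nat * nat :=
  match n with
  | 0 => (0, 0)%N
  | n'.+1 => let c := counts pol lr ls n' in
             if pol n' (hist lr c.1) (hist ls c.2) then (c.1.+1, c.2)
             else (c.1, c.2.+1)
  end.

Definition Ncount (l : nat -> nat) (m i : nat) : nat := count_mem i (hist l m).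

(* M = N_R(R(n)) . N_S(S(n)) ; the sum is over the (finite) support of N_R *)
Definition matches (lr ls : nat -> nat) (c : nat * nat) : nat :=
  \sum_(i <- undup (hist lr c.1)) Ncount lr c.1 i * Ncount ls c.2 i.

(* Gamma_R[m] = sum_{j<=m} s_{L_R(j)} ; Gamma_S[m] = sum_{j<=m} r_{L_S(j)} *)
Definition Gamma {R : realType} (w : nat -> R) (l : nat -> nat) (m : nat) : R :=
  \sum_(j < m) w (l j).

(* Main.v *)
Require Import Defs.
From HB Require Import structures.
From mathcomp Require Import all_boot all_order all_algebra.
From mathcomp Require Import all_classical all_reals all_analysis.
From mathcomp Require Import measurable_realfun.
From mathcomp Require Import zify ring lra.
Import Order.TTheory GRing.Theory Num.Theory.
Import numFieldNormedType.Exports.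
Local Open Scope classical_set_scope.
Local Open Scope ring_scope.

Set Implicit Arguments. Unset Strict Implicit. Unset Printing Implicit Defensive.

(* Put [W_R(m) = Gamma_R[m] - mu m], [W_S] likewise, and let [h] be the
   degenerate kernel [h(u, v) = 1{u = v} - s_u - r_v + mu].  Expanding the
   indicator with [h] gives
     M = mu R S + S W_R(R) + R W_S(S) + (double sum of h).
   Let the alternating policy have read [(A, B)] records and put [D = R - A].
   The greedy rule keeps [Gamma_R - Gamma_S] in [-1, 1]; this bounds [D] by
   [sqrt(n log log n)] and makes the difference of the match counts equal to
     B (W_R(R) - W_R(A)) + A (W_S(S) - W_S(B)) + O(n sqrt(log n log log n)),
   so that only increments of W over windows of length [|D|] matter, and the
   policies enter through nothing but these deterministic constraints.
   - O-bound: Hoeffding's inequality and the first Borel-Cantelli lemma bound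
     all increments over windows of length l by [sqrt(l log n)], and [D] itself
     by [sqrt(n log log n)] (a coarse grid of about log n points costs only a
     factor log log n; inside its cells the first bound is good enough).
   - Unboundedness: at sparse scales [N], with probability bounded below, [D] is
     at least [c sqrt N] near [N].  There are so many disjoint windows of length
     [N^(1/2 + o(1))] close to [N] that in one of them every block of length
     about [sqrt N / (log N)^(3/5)] has an increment of at least a fixed multiple
     of its standard deviation in the prescribed direction, which adds up to an
     increment exceeding [sqrt D] by a power of [log N].  The second
     Borel-Cantelli lemma makes this happen at infinitely many scales. *)

(* The obstacle is that the counts depend on the labels, so an increment of W at the positions
   reached by the policies cannot be treated as independent of these positions. Hence every
   probabilistic estimate is uniform over all positions up to n ([regular]), and in the lower bound
   all blocks of a run are favorable, so that the increment is large whatever the value of D inside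
   the run. The parameters of a scale are forced as follows. Put u = 2^k and let log N be of order
   K, with log log N of order k. Then |D| is below u sqrt N, which is u^4 blocks of length l = sqrt
   N / u^3. If a block succeeds with probability x, a run of 2 u^4 blocks does so with probability
   x^(2 u^4), while nearly 2^K disjoint runs are available: K must outgrow every multiple of u^4. On
   the other hand the incomplete block at the end may lose sqrt(l K), against a gain of order u^3
   sqrt l: K must be of smaller order than u^6. Hence K = u^5 = 32^k. The final gain, of order at
   least u N^(5/4), beats N^(5/4) (log log N)^(1/4) because u is exponential in k. *)
Tactic Notation "lra" "using" ne_hyp_list(hs) := clear - hs; lra.
Tactic Notation "lia" "using" ne_hyp_list(hs) := clear - hs; lia.

(** * Policies *)

Lemma matchesE (x y : nat -> nat) (c : nat * nat) :
  matches x y c = (\sum_(i < c.1) \sum_(j < c.2) (x i == y j))%N.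
Proof.
have NE l m v : Ncount l m v = (\sum_(j < m) (l j == v))%N.
  rewrite /Ncount /hist -sum1_count big_map /index_iota -(subn0 m) big_mkord.
  by rewrite subn0 big_mkcond; apply: eq_bigr => i _ /=; case: eqP.
have E (s : seq nat) (F : nat -> nat) :
    (\sum_(i <- undup s) count_mem i s * F i = \sum_(i <- s) F i)%N.
  transitivity (\sum_(i <- undup s) \sum_(z <- s) (z == i) * F z)%N.
    apply: eq_bigr => i _; rewrite -sum1_count big_distrl /= big_mkcond /=.
    by apply: eq_bigr => z _; case: eqP => [->|_]; rewrite ?mul1n ?mul0n.
  rewrite exchange_big /= big_seq [RHS]big_seq; apply: eq_bigr => z zs.
  rewrite (bigD1_seq z) ?mem_undup ?undup_uniq //= eqxx mul1n big1 ?addn0 //.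
  by move=> i; rewrite eq_sym => /negbTE ->.
rewrite /matches {1}/Ncount E /hist big_map /index_iota -{1}(subn0 c.1).
rewrite -/(index_iota 0 c.1) big_mkord; apply: eq_bigr => i _; rewrite NE.
by apply: eq_bigr => j _; rewrite eq_sym.
Qed.

Section policies.
Variables (R : realType).
Implicit Types (pol : nat -> seq nat -> seq nat -> bool) (x y : nat -> nat).

Lemma counts_sum pol x y n : ((counts pol x y n).1 + (counts pol x y n).2 = n)%N.
Proof.
elim: n => //= n IH; case: ifP => _ /=; lia.
Qed.

Lemma counts_fst_nonadaptive (b : nat -> bool) x y n :
  (counts (fun k _ _ => b k) x y n).1 = (\sum_(k < n) b k)%N.
Proof.
elim: n => [|n IH]; first by rewrite big_ord0.
rewrite big_ord_recr /= -IH; case: (b n) => /=; lia.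
Qed.

Lemma alternating_balanced (b : nat -> bool) x y n :
  (forall n, (\sum_(k < 2 * n) b k)%N = n) ->
  let c := counts (fun k _ _ => b k) x y n in (c.1 <= c.2.+1 /\ c.2 <= c.1.+1)%N.
Proof.
move=> bE c; have := counts_sum (fun k _ _ => b k) x y n; rewrite -/c => cn.
have c1 : c.1 = (\sum_(k < n) b k)%N by exact: counts_fst_nonadaptive.
have [m [nE|nE]] : exists m, n = (2 * m)%N \/ n = (2 * m).+1.
  by exists n./2; lia.
- by rewrite nE bE in c1 cn *; lia.
- by rewrite nE big_ord_recr /= bE in c1 cn *; case: (b _) c1 => /=; lia.
Qed.

Lemma GammaS (w : nat -> R) x m : Gamma w x m.+1 = Gamma w x m + w (x m).
Proof. by rewrite /Gamma big_ord_recr. Qed.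

(* The greedy rule always increases the smaller sum, by at most one. *)
Lemma greedy_balanced pol x y (r s : nat -> R) :
  (forall i, 0 <= r i <= 1) -> (forall i, 0 <= s i <= 1) ->
  (forall n, (1 <= n)%N ->
     let c := counts pol x y n in
     (Gamma s x c.1 < Gamma r y c.2 ->
        pol n (hist x c.1) (hist y c.2) = true) /\
     (Gamma r y c.2 < Gamma s x c.1 ->
        pol n (hist x c.1) (hist y c.2) = false)) ->
  forall n, let c := counts pol x y n in `|Gamma s x c.1 - Gamma r y c.2| <= 1.
Proof.
move=> r01 s01 gr; elim=> [|n] /=.
  by rewrite /Gamma !big_ord0 subrr normr0.
set c := counts pol x y n; rewrite !ler_norml => /andP[h1 h2].
(* The greedy rule is imposed only from n = 1 on; the first read, from either side, moves the
   difference from 0 by a value in [0, 1]. *)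
have [n0|n0] := posnP n.
  have c0 : c = (0, 0)%N by rewrite /c n0.
  have [/andP[r0 r1] /andP[s0 s1]] := (r01 (y 0%N), s01 (x 0%N)).
  by case: ifP => _; rewrite c0 /= !GammaS /Gamma !big_ord0; lra.
have [g1 g2] := gr n n0; rewrite -/c in g1 g2.
have [/andP[r0 r1] /andP[s0 s1]] := (r01 (y c.2), s01 (x c.1)).
case: ifP => e /=; rewrite GammaS.
- have : ~~ (Gamma r y c.2 < Gamma s x c.1) by apply/negP => /g2; rewrite e.
  by rewrite -leNgt; lra.
- have : ~~ (Gamma s x c.1 < Gamma r y c.2) by apply/negP => /g1; rewrite e.
  by rewrite -leNgt; lra.
Qed.

End policies.

(** * Decomposition of the match count *)

Section decomposition.
Variables (R : realType).
Implicit Types (x y : nat -> nat) (w r s : nat -> R) (mu : R).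

Definition deviation w mu x m : R := \sum_(j < m) (w (x j) - mu).

(** Its mean in either argument vanishes when the other is fixed ([mean_kernelS], [mean_kernelR]).
    Given one label, a row or column of the double sum is therefore a centred sum of independent
    terms, within reach of Hoeffding's inequality. *)
Definition kernel r s mu (u v : nat) : R := (u == v)%:R - s u - r v + mu.

Definition kernel_sum r s mu x y a b : R :=
  \sum_(i < a) \sum_(j < b) kernel r s mu (x i) (y j).

Lemma GammaE w mu x m : Gamma w x m = mu * m%:R + deviation w mu x m.
Proof.
rewrite /Gamma /deviation sumrB sumr_const card_ord -mulr_natr; lra.
Qed.

Lemma matches_decomposition r s mu x y a b :
  (matches x y (a, b))%:R = mu * a%:R * b%:R + b%:R * deviation s mu x a
    + a%:R * deviation r mu y b + kernel_sum r s mu x y a b.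
Proof.
have -> : kernel_sum r s mu x y a b = (matches x y (a, b))%:R
    - b%:R * Gamma s x a - a%:R * Gamma r y b + mu * a%:R * b%:R.
  rewrite matchesE natr_sum /Gamma !mulr_sumr /=.
  have -> : mu * a%:R * b%:R = \sum_(i < a) \sum_(j < b) mu.
    by rewrite !sumr_const !card_ord -mulr_natr -[mu *+ b]mulr_natr; lra.
  have -> : \sum_(i < b) a%:R * r (y i) = \sum_(i < a) \sum_(j < b) r (y j).
    rewrite exchange_big /=; apply: eq_bigr => i _.
    by rewrite sumr_const card_ord mulr_natl.
  rewrite -!sumrB -big_split /= /kernel_sum; apply: eq_bigr => i _.
  have -> : b%:R * s (x i) = \sum_(j < b) s (x i).
    by rewrite sumr_const card_ord mulr_natl.
  by rewrite natr_sum -!sumrB -big_split /=.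
rewrite (GammaE s mu) (GammaE r mu); lra.
Qed.

(* The linear terms in [D * (deviation r - deviation s)] are eliminated with
   the near-equality of the two Gamma sums. *)
Lemma matches_difference r s mu x y a b a' b' : (a + b = a' + b')%N ->
  let D := a%:R - a'%:R in
  (matches x y (a, b))%:R - (matches x y (a', b'))%:R =
    mu * D ^+ 2 - (Gamma s x a - Gamma r y b) * D
    + b'%:R * (deviation s mu x a - deviation s mu x a')
    + a'%:R * (deviation r mu y b - deviation r mu y b')
    + (kernel_sum r s mu x y a b - kernel_sum r s mu x y a' b').
Proof.
move=> E D; have bE : b%:R = b'%:R - D :> R.
  have : (a + b)%:R = (a' + b')%:R :> R by rewrite E.
  by rewrite !natrD /D; lra.
have aE : a%:R = a'%:R + D :> R by rewrite /D; lra.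
rewrite !(matches_decomposition r s mu) !(GammaE _ mu) aE bE; ring.
Qed.

Lemma sum_increment_le (u : nat -> R) (K : R) n a b : (a <= n)%N -> (b <= n)%N ->
  (forall i, (i < n)%N -> `|u i| <= K) ->
  `|\sum_(i < a) u i - \sum_(i < b) u i| <= `|a%:R - b%:R| * K.
Proof.
wlog ba : a b / (b <= a)%N => [H an bn uK|an _ uK].
  have [ba|/ltnW ab] := leqP b a; first exact: H.
  by rewrite distrC [`|a%:R - _|]distrC; exact: H.
rewrite -!(big_mkord xpredT u) (@big_cat_nat _ _ _ b) //= addrAC subrr add0r.
apply: le_trans (ler_norm_sum _ _ _) _.
rewrite -natrB // ger0_norm // mulr_natl -sumr_const_nat.
rewrite big_nat_cond [leRHS]big_nat_cond; apply: ler_sum => i /andP[/andP[_ ia] _].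
by apply: uK; lia.
Qed.

(** The interface between probability and the deterministic upper bounds: increments between
    arbitrary positions, deviations from 0, and rows and columns of the kernel matrix. Everything is
    stated in squares, which keeps square roots out of the arithmetic. *)
Definition regular (C : R) r s mu x y (n : nat) : Prop :=
  [/\ forall a b, (a <= n)%N -> (b <= n)%N ->
        (deviation s mu x a - deviation s mu x b) ^+ 2
          <= C * `|a%:R - b%:R| * ln n%:R /\
        (deviation r mu y a - deviation r mu y b) ^+ 2
          <= C * `|a%:R - b%:R| * ln n%:R,
      forall m, (m <= n)%N ->
        deviation s mu x m ^+ 2 <= C * n%:R * ln (ln n%:R) /\
        deviation r mu y m ^+ 2 <= C * n%:R * ln (ln n%:R)
    & forall i m, (i < n)%N -> (m <= n)%N ->
        (\sum_(j < m) kernel r s mu (x i) (y j)) ^+ 2 <= C * n%:R * ln n%:R /\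
        (\sum_(j < m) kernel r s mu (x j) (y i)) ^+ 2 <= C * n%:R * ln n%:R].

Section bounds.
Variables (C : R) (r s : nat -> R) (mu : R) (x y : nat -> nat) (n : nat).
Hypotheses (reg : regular C r s mu x y n) (mu0 : 0 < mu) (mu1 : mu <= 1)
  (C0 : 0 <= C).
Variables (a b a' b' : nat).
Hypotheses (abn : (a + b = n)%N) (abn' : (a' + b' = n)%N)
  (ba' : (a' <= b'.+1)%N) (ab' : (b' <= a'.+1)%N)
  (gr : `|Gamma s x a - Gamma r y b| <= 1).
Let D : R := a%:R - a'%:R.

(** Passing through (a', b) changes |a - a'| rows and then |b - b'| columns. Both numbers equal |D|
    because the totals agree, and each row or column is at most [K]. *)
Lemma kernel_sum_difference : 0 <= ln n%:R :> R ->
  (kernel_sum r s mu x y a b - kernel_sum r s mu x y a' b') ^+ 2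
    <= 4 * C * D ^+ 2 * (n%:R * ln n%:R).
Proof.
move=> ln0; case: reg => _ _ rc; set K := Num.sqrt (C * n%:R * ln n%:R).
have CnL : 0 <= C * n%:R * ln n%:R by rewrite !mulr_ge0.
have sK (t : R) : t ^+ 2 <= C * n%:R * ln n%:R -> `|t| <= K.
  by move=> h; rewrite -sqrtr_sqr ler_wsqrtr.
have h1 : `|kernel_sum r s mu x y a b - kernel_sum r s mu x y a' b|
    <= `|D| * K.
  apply: (@sum_increment_le
    (fun i => \sum_(j < b) kernel r s mu (x i) (y j)) K n); [lia|lia|move=> i ni].
  by apply: sK; case: (rc i b ni); first lia.
have h2 : `|kernel_sum r s mu x y a' b - kernel_sum r s mu x y a' b'|
    <= `|D| * K.
  have -> : `|D| = `|b%:R - b'%:R|.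
    have : (a + b)%:R = (a' + b')%:R :> R by rewrite abn abn'.
    by rewrite !natrD distrC /D => e; congr `|_|; lra.
  rewrite /kernel_sum exchange_big /= [X in _ - X]exchange_big /=.
  apply: (@sum_increment_le (fun j => \sum_(i < a') kernel r s mu (x i) (y j)) K n);
    [lia|lia|move=> i ni].
  by apply: sK; case: (rc i a' ni); first lia.
have -> : 4 * C * D ^+ 2 * (n%:R * ln n%:R) = (2 * `|D| * K) ^+ 2.
  rewrite !exprMn sqr_sqrtr // -normrX ger0_norm ?sqr_ge0 //; ring.
have := ler_normD (kernel_sum r s mu x y a b - kernel_sum r s mu x y a' b)
  (kernel_sum r s mu x y a' b - kernel_sum r s mu x y a' b').
rewrite addrA subrK -[X in X <= _ -> _]normr_id => h.
rewrite -[leLHS]ger0_norm ?sqr_ge0 // normrX ler_pXn2r ?nnegrE ?mulr_ge0 //.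
  by rewrite -normr_id; lra.
by rewrite sqrtr_ge0.
Qed.

(** With a + b = a' + b', near-equality of the two Gamma sums can be solved for D: up to an error of
    at most 2, 2 mu D is the difference of the deviations of the two sides, and these obey the log
    log bound. *)
Lemma imbalance_sqr_le : 1 <= ln (ln n%:R) :> R ->
  D ^+ 2 <= (4 + 2 * C) / mu ^+ 2 * (n%:R * ln (ln n%:R)).
Proof.
move=> LL1; case: reg => _ rb _.
have [[ha _] [_ hb]] := (rb a ltac:(lia), rb b ltac:(lia)).
have n1 : 1 <= n%:R :> R.
  rewrite ler1n lt0n; apply/eqP => n0; move: LL1; rewrite n0 !ln0 //; lra.
have E : 2 * mu * D = mu * (b'%:R - a'%:R)
    + (Gamma s x a - Gamma r y b) + deviation r mu y b - deviation s mu x a.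
  have : (a + b)%:R = (a' + b')%:R :> R by rewrite abn abn'.
  rewrite !(GammaE _ mu) !natrD /D => e.
  have -> : b%:R = a'%:R + b'%:R - a%:R :> R by lra.
  ring.
have ab1 : `|b'%:R - a'%:R| <= 1 :> R.
  rewrite ler_norml; have : b'%:R <= a'.+1%:R :> R by rewrite ler_nat.
  have : a'%:R <= b'.+1%:R :> R by rewrite ler_nat.
  by rewrite -!natr1; lra.
set u := mu * _ + _ in E.
have u2 : `|u| <= 2.
  rewrite /u (le_trans (ler_normD _ _)) // normrM (gtr0_norm mu0).
  rewrite -[2]/(1 + 1) lerD // -[leRHS]mulr1.
  by rewrite ler_pM ?normr_ge0 // ltW.
have X1 : 1 <= n%:R * ln (ln n%:R) :> R by rewrite (le_trans n1) // ler_peMr.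
rewrite mulrAC ler_pdivlMr ?exprn_gt0 //.
move: ha hb X1; rewrite -!mulrA; set X := n%:R * ln _ => ha hb X1.
have u4 : u ^+ 2 <= 4.
  by move: u2; rewrite ler_norml => /andP[]; nra.
set p := deviation r _ _ _ in E hb; set q := deviation s _ _ _ in E ha.
have : (2 * mu * D) ^+ 2 <= 4 * u ^+ 2 + 2 * p ^+ 2 + 4 * q ^+ 2.
  by rewrite E; have := sqr_ge0 (p - u + q); have := sqr_ge0 (u + q); lra.
rewrite !exprMn => h; have : 0 <= C * X by rewrite mulr_ge0 //; lra.
lra.
Qed.

End bounds.
End decomposition.

(** * Upper bound on the difference of the match counts *)

Section upper_bound.
Variable (R : realType).

(** The target has exponents 5/4 and 1/4, so comparisons are made between fourth powers, which are
    polynomial. The factor 1 + k stands in for the fourth root of k. *)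
Lemma norm_le_of_pow4 (k t u : R) : 0 <= k -> 0 <= u ->
  t ^+ 4 <= k * u ^+ 4 -> `|t| <= (1 + k) * u.
Proof.
move=> k0 u0 h; rewrite -(@ler_pXn2r _ 4) ?nnegrE ?mulr_ge0 ?addr_ge0 //.
have -> : `|t| ^+ 4 = t ^+ 4 by rewrite -normrX ger0_norm // exprn_even_ge0.
rewrite exprMn (le_trans h) // ler_wpM2r ?exprn_ge0 //.
have : 0 <= k ^+ 2 by rewrite sqr_ge0.
have : 0 <= k ^+ 3 by rewrite exprn_ge0.
have : 0 <= k ^+ 4 by rewrite exprn_ge0.
have -> : (1 + k) ^+ 4 = 1 + 4 * k + 6 * k ^+ 2 + 4 * k ^+ 3 + k ^+ 4 by ring.
lra.
Qed.

(** A nonzero integer has modulus at least 1. This absorbs the term (Gamma difference) * D of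
    [matches_difference] into D^2. *)
Lemma norm_natB_le_sqr (a b : nat) : `|a%:R - b%:R| <= (a%:R - b%:R) ^+ 2 :> R.
Proof.
have [->|ab] := eqVneq a b; first by rewrite subrr normr0 expr0n.
rewrite -real_normK ?num_real // expr2 ler_peMr //.
have -> : a%:R - b%:R = (a%:Z - b%:Z)%:~R :> R by rewrite intrB.
rewrite -intr_norm -[1]/(1%:~R) ler_int; lia.
Qed.

Variables (C : R) (r s : nat -> R) (mu : R) (x y : nat -> nat) (n : nat).
Hypotheses (reg : regular C r s mu x y n) (mu0 : 0 < mu) (mu1 : mu <= 1)
  (C0 : 0 <= C).
Variables (a b a' b' : nat).
Hypotheses (abn : (a + b = n)%N) (abn' : (a' + b' = n)%N)
  (ba' : (a' <= b'.+1)%N) (ab' : (b' <= a'.+1)%N)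
  (gr : `|Gamma s x a - Gamma r y b| <= 1).
Hypotheses (LL1 : 1 <= ln (ln n%:R) :> R) (LLL : ln (ln n%:R) <= ln n%:R :> R)
  (Ln : ln n%:R <= n%:R :> R).

(** The summands belong to the two terms of order D^2, the two increments of the deviations, and the
    kernel term. *)
Definition upper_const : R :=
  let K := (4 + 2 * C) / mu ^+ 2 in
  (2 * (1 + K ^+ 4) + 2 * (1 + C ^+ 2 * K) + (1 + 16 * C ^+ 2 * K ^+ 2))%R.

(** Here u is the normalizer times (log n)^(1/2). Only the two increments attain this order: n
    sqrt(|D| log n) with D^2 of order n log log n has exactly the fourth power displayed. The other
    terms fit because log log n <= log n <= n. *)
Lemma matches_difference_le (u : R) : 0 <= u ->
  u ^+ 4 = n%:R ^+ 5 * ln (ln n%:R) * ln n%:R ^+ 2 ->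
  `|(matches x y (a, b))%:R - (matches x y (a', b'))%:R| <= upper_const * u.
Proof.
move=> u0 uE.
have [an an' bn bn'] : [/\ a <= n, a' <= n, b <= n & b' <= n]%N.
  by split; rewrite -?abn ?leq_addr ?leq_addl // abn -abn' ?leq_addr ?leq_addl.
rewrite (@matches_difference _ r s mu) ?abn ?abn' //.
set K := (4 + 2 * C) / mu ^+ 2.
have K0 : 0 <= K by rewrite divr_ge0 ?sqr_ge0 // addr_ge0 // mulr_ge0.
have D2 := imbalance_sqr_le reg mu0 mu1 C0 abn abn' ba' ab' gr LL1.
have DD := norm_natB_le_sqr a a'.
have L0 : 0 <= ln n%:R :> R by rewrite (le_trans ler01) // (le_trans LL1).
have H2 := kernel_sum_difference reg mu0 mu1 C0 abn abn' ba' ab' gr L0.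
case: reg => ra _ _.
have [hR _] := ra a a' an an'.
have [_ hS] := ra b b' bn bn'.
have bb : `|b%:R - b'%:R| = `|a%:R - a'%:R| :> R.
  have : (a + b)%:R = (a' + b')%:R :> R by rewrite abn abn'.
  by rewrite !natrD => e; rewrite distrC; congr `|_|; lra.
rewrite bb in hS.
have a0 : 0 <= (a'%:R : R) <= n%:R by rewrite ler0n ler_nat.
have b0 : 0 <= (b'%:R : R) <= n%:R by rewrite ler0n ler_nat.
rewrite -/K in D2.
set D : R := a%:R - a'%:R in D2 DD H2 hR hS *.
set p := deviation s mu x a - _ in hR *.
set q := deviation r mu y b - _ in hS *.
set h := kernel_sum _ _ _ _ _ _ _ - _ in H2 *.
move: (gr); set G := Gamma s x a - _ => gr'.
move: (mu0) (mu1) (C0) => mu0' mu1' C0'.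
move: LL1 LLL Ln L0 D2 uE H2 hR hS a0 b0; set LL := ln (ln n%:R); set L := ln n%:R.
set N := n%:R; move=> LL1' LLL' Ln' L0 D2 uE H2 hR hS a0 b0.
rewrite /upper_const -/K; clearbody K D p q h G LL L N.
have N0 : 0 <= N by lra.
have LL0 : 0 <= LL by lra.
have D20 : 0 <= D ^+ 2 by rewrite sqr_ge0.
have D4 : D ^+ 4 <= K ^+ 2 * (N * LL) ^+ 2.
  rewrite (exprM D 2 2) -exprMn.
  by rewrite ler_pXn2r ?nnegrE // !mulr_ge0.
have D40 : 0 <= D ^+ 4 by rewrite exprn_even_ge0.
have t1 : `|D ^+ 2| <= (1 + K ^+ 4) * u.
  apply: norm_le_of_pow4 => //; first by rewrite exprn_ge0.
  have -> : (D ^+ 2) ^+ 4 = (D ^+ 4) ^+ 2 by rewrite -!exprM.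
  apply: (@le_trans _ _ ((K ^+ 2 * (N * LL) ^+ 2) ^+ 2)).
    by rewrite ler_pXn2r ?nnegrE // mulr_ge0 ?sqr_ge0.
  have -> : (K ^+ 2 * (N * LL) ^+ 2) ^+ 2 = K ^+ 4 * (N ^+ 4 * LL * LL ^+ 2 * LL).
    by ring.
  rewrite uE; apply: ler_wpM2l; first exact: exprn_ge0.
  have -> : N ^+ 5 * LL * L ^+ 2 = N ^+ 4 * LL * L ^+ 2 * N by ring.
  apply: ler_pM; rewrite ?mulr_ge0 ?exprn_ge0 //; last by lra.
  apply: ler_wpM2l; first by rewrite mulr_ge0 ?exprn_ge0.
  by rewrite ler_pXn2r ?nnegrE //; lra.
have t2 (v z : R) : 0 <= v <= N -> z ^+ 2 <= C * `|D| * L ->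
    `|v * z| <= (1 + C ^+ 2 * K) * u.
  move=> /andP[v0 vN] hz; apply: norm_le_of_pow4 => //.
    by rewrite mulr_ge0 ?sqr_ge0.
  rewrite exprMn uE (exprM z 2 2).
  apply: (@le_trans _ _ (N ^+ 4 * (C * `|D| * L) ^+ 2)).
    apply: ler_pM; [exact: exprn_ge0|exact: sqr_ge0| |].
      by rewrite ler_pXn2r ?nnegrE.
    by rewrite ler_pXn2r ?nnegrE ?sqr_ge0 // !mulr_ge0.
  have -> : N ^+ 4 * (C * `|D| * L) ^+ 2 = C ^+ 2 * N ^+ 4 * L ^+ 2 * `|D| ^+ 2 by ring.
  rewrite real_normK ?num_real //.
  have -> : C ^+ 2 * K * (N ^+ 5 * LL * L ^+ 2)
    = C ^+ 2 * N ^+ 4 * L ^+ 2 * (K * (N * LL)) by ring.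
  by apply: ler_wpM2l; rewrite ?mulr_ge0 ?exprn_ge0 ?sqr_ge0.
have t4 : `|h| <= (1 + 16 * C ^+ 2 * K ^+ 2) * u.
  apply: norm_le_of_pow4 => //; first by rewrite !mulr_ge0 ?sqr_ge0.
  rewrite uE (exprM h 2 2).
  apply: (@le_trans _ _ ((4 * C * D ^+ 2 * (N * L)) ^+ 2)).
    rewrite ler_pXn2r ?nnegrE ?sqr_ge0 //.
    by apply: mulr_ge0; [apply: mulr_ge0 => //; apply: mulr_ge0|exact: mulr_ge0].
  have -> : (4 * C * D ^+ 2 * (N * L)) ^+ 2 = 16 * C ^+ 2 * (N * L) ^+ 2 * D ^+ 4.
    by ring.
  apply: (@le_trans _ _ (16 * C ^+ 2 * (N * L) ^+ 2 * (K ^+ 2 * (N * LL) ^+ 2))).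
    by apply: ler_wpM2l; rewrite ?mulr_ge0 ?sqr_ge0.
  have -> : 16 * C ^+ 2 * (N * L) ^+ 2 * (K ^+ 2 * (N * LL) ^+ 2)
    = 16 * C ^+ 2 * K ^+ 2 * (N ^+ 4 * LL * L ^+ 2) * LL by ring.
  have -> : 16 * C ^+ 2 * K ^+ 2 * (N ^+ 5 * LL * L ^+ 2)
    = 16 * C ^+ 2 * K ^+ 2 * (N ^+ 4 * LL * L ^+ 2) * N by ring.
  by apply: ler_wpM2l; rewrite ?mulr_ge0 ?exprn_ge0 ?sqr_ge0 //; lra.
have t2a := t2 _ _ a0 hS; have t2b := t2 _ _ b0 hR.
have t3 : `|G * D| <= `|D ^+ 2|.
  rewrite normrM (ger0_norm D20) (le_trans _ DD) // -[leRHS]mul1r.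
  by rewrite ler_wpM2r.
have t5 : `|mu * D ^+ 2| <= `|D ^+ 2|.
  rewrite normrM (gtr0_norm mu0) -[leRHS]mul1r.
  by rewrite ler_wpM2r.
have e1 := ler_normD (mu * D ^+ 2 - G * D + b'%:R * p + a'%:R * q) h.
have e2 := ler_normD (mu * D ^+ 2 - G * D + b'%:R * p) (a'%:R * q).
have e3 := ler_normD (mu * D ^+ 2 - G * D) (b'%:R * p).
have e4 := ler_normB (mu * D ^+ 2) (G * D).
lra.
Qed.

End upper_bound.

(** * Lower bound on the difference of the match counts *)

Section lower_bound.
Variable (R : realType).

Lemma sum_of_blocks (f : nat -> R) (c : R) t l j :
  (forall i, (i < j)%N -> c <= f (t + i.+1 * l)%N - f (t + i * l)%N) ->
  j%:R * c <= f (t + j * l)%N - f t.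
Proof.
elim: j => [|j IH] h; first by rewrite mul0n addn0 subrr mul0r.
have := IH (fun i ij => h i (ltnW ij)); have := h j (ltnSn j).
rewrite -natr1; lra.
Qed.

Lemma deviation_le (w : nat -> R) mu x m : 0 <= mu <= 1 ->
  (forall i, 0 <= w i <= 1) -> `|deviation w mu x m| <= m%:R.
Proof.
move=> m01 w01; apply: le_trans (ler_norm_sum _ _ _) _.
rewrite -[leRHS](_ : \sum_(j < m) 1 = _); last by rewrite sumr_const card_ord.
apply: ler_sum => i _; rewrite ler_norml; have := w01 (x i); lra.
Qed.

Lemma norm_le_of_sqr (t u : R) : 0 <= u -> t ^+ 2 <= u ^+ 2 -> `|t| <= u.
Proof. by move=> u0 h; rewrite -(ger0_norm u0) -!sqrtr_sqr ler_wsqrtr. Qed.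

(* [X = 2 ^ K] and [u = 2 ^ k]: [N = X ^ 4] is the scale, [l] the length of a
   block, [2 * q] the number of blocks in a run, [m] the middle of the run. *)
Lemma matches_difference_ge (C : R) (r s : nat -> R) (mu : R)
    (x y : nat -> nat) (eps thR thS X u K k' : R) (M N l q a m c d : nat) :
  eps ^+ 2 = 1 -> 0 < mu <= 1 -> 0 <= C -> 0 <= thR -> 0 <= thS ->
  0 < thR + thS ->
  (forall i, 0 <= r i <= 1) -> (forall i, 0 <= s i <= 1) ->
  1 <= X -> 1 <= u -> 0 <= K -> 1 <= k' ->
  N%:R = X ^+ 4 -> l%:R * u ^+ 3 = X ^+ 2 -> q%:R = u ^+ 4 ->
  m = (N + (2 * a * q + q) * l)%N -> ((2 * a * q + 2 * q) * l)%:R <= X ^+ 3 ->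
  regular C r s mu x y (2 * m) ->
  1 <= ln (ln (2 * m)%:R) :> R -> ln (2 * m)%:R <= 5 * K ->
  ln (ln (2 * m)%:R) <= 5 * k' ->
  (c + d = 2 * m)%N -> `|Gamma s x c - Gamma r y d| <= 1 ->
  let dR := deviation s mu x in let dS := deviation r mu y in
  thS * Num.sqrt (N%:R - M%:R) <= dS N - dS M ->
  thR * Num.sqrt (N%:R - M%:R) <= - (dR N - dR M) ->
  (forall i, (i < 2 * q)%N ->
    let t := (N + (2 * a * q + i) * l)%N in
    thR * Num.sqrt l%:R <= eps * (dR (t + l)%N - dR t) /\
    thS * Num.sqrt l%:R <= - eps * (dS (t + l)%N - dS t)) ->
  let th := thR + thS in
  20 * ((4 + 2 * C) / mu ^+ 2) * k' <= u ^+ 2 ->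
  10 * C * K <= (th / 32) ^+ 2 * X ->
  M%:R <= 3 / 4 * X ^+ 4 ->
  2 * M%:R + 1 <= th / 8 * X ^+ 2 ->
  u <= X ->
  1 <= th / 16 * u ^+ 3 ->
  5 * C * K <= (th ^+ 2 * u ^+ 3 / 64) ^+ 2 ->
  80 * C * K <= (th ^+ 2 / 128) ^+ 2 * X ^+ 2 ->
  2 * u <= th ^+ 2 / 128 * X ->
  th ^+ 2 / 64 * u * X ^+ 5 <=
    eps * ((matches x y (c, d))%:R - (matches x y (m, m))%:R).
Proof.
move=> eps2 /andP[mu0 mu1] C0 thR0 thS0 th0 r01 s01 X1 u1 K0 k1 NX lX qX mE run
  reg LL1 LK LLk cdm gr dR dS bS bR blocks th G1 G2 G3 G4 G5 G6 G7 G8 G9.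
have X0 : 0 < X := lt_le_trans ltr01 X1.
have u0 : 0 < u := lt_le_trans ltr01 u1.
have mm : (m + m = 2 * m)%N by clear; lia.
have D2 := imbalance_sqr_le reg mu0 mu1 C0 cdm mm (leqnSn _) (leqnSn _) gr LL1.
have L0 : 0 <= ln (2 * m)%:R :> R.
  rewrite leNgt; apply/negP => Lneg; move: LL1; by rewrite (ln0 (ltW Lneg)) ler10.
have H2 := kernel_sum_difference reg mu0 mu1 C0 cdm mm (leqnSn _) (leqnSn _) gr L0.
have DE := @matches_difference _ r s mu x y c d m m.
rewrite cdm mm in DE; have {}DE := DE erefl; rewrite /= in DE.
have l0 : 0 < l%:R :> R.
  by rewrite -(pmulr_lgt0 _ (exprn_gt0 3 u0)) lX exprn_gt0.
have mN : m%:R <= X ^+ 4 + X ^+ 3.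
  rewrite mE natrD NX lerD2l (le_trans _ run) // ler_nat leq_mul2r.
  by clear; lia.
have X34 : X ^+ 3 <= X ^+ 4 by rewrite ler_weXn2l.
have Nm : X ^+ 4 <= m%:R by rewrite -NX ler_nat mE leq_addr.
have n4 : (2 * m)%:R <= 4 * X ^+ 4 :> R.
  by rewrite natrM; lra using mN X34.
have nLL : (2 * m)%:R * ln (ln (2 * m)%:R) <= 4 * X ^+ 4 * (5 * k').
  by apply: ler_pM => //; apply: le_trans LL1.
set K1 := (4 + 2 * C) / mu ^+ 2 in D2 G1.
have K10 : 0 <= K1.
  by rewrite divr_ge0 ?sqr_ge0 // addr_ge0 // mulr_ge0.
have cub : c%:R = m%:R + (c%:R - m%:R) :> R by rewrite addrC subrK.
have dub : d%:R = m%:R - (c%:R - m%:R) :> R.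
  have : (c + d)%:R = (2 * m)%:R :> R by rewrite cdm.
  by clear; rewrite natrD natrM; lra.
move: D2 H2 DE cub dub; set D : R := c%:R - m%:R => D2 H2 DE cub dub.
(* The bound equals q * l, half the length of the run, so the displacement from m stays inside the
   run. *)
have Dub : `|D| <= X ^+ 2 * u.
  apply: norm_le_of_sqr; first by rewrite mulr_ge0 ?sqr_ge0 // ltW.
  apply: (le_trans D2); apply: (le_trans (ler_wpM2l K10 nLL)).
  rewrite exprMn -exprM; have := ler_wpM2l (exprn_ge0 4 (ltW X0)) G1.
  by clear; clearbody K1; lra.
have X2u : X ^+ 2 * u <= X ^+ 3 by rewrite [leRHS]exprSr ler_wpM2l ?sqr_ge0.
case: (reg) => ra _ _.
have step1 : (N <= 2 * m)%N by lia using mE.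
have cn : (c <= 2 * m)%N by lia using cdm.
have dn : (d <= 2 * m)%N by lia using cdm.
have th0' : 0 <= th by exact: ltW.
(* Positions within 2 X^3 = 2 N^(3/4) of N have deviations that differ from those at N by much less
   than sqrt N = X^2, so the run may be searched for in that range without disturbing D. *)
have dist_le (z e : R) : `|z| <= 2 * X ^+ 3 -> e ^+ 2 <= C * `|z| * ln (2 * m)%:R ->
    `|e| <= th / 32 * X ^+ 2.
  move=> hz he; apply: norm_le_of_sqr; first by rewrite mulr_ge0 ?sqr_ge0 ?divr_ge0.
  apply: (le_trans he); apply: (@le_trans _ _ (C * (2 * X ^+ 3) * (5 * K))).
    by apply: ler_pM; rewrite ?mulr_ge0 // ler_wpM2l.
  rewrite exprMn -exprM; have := ler_wpM2r (exprn_ge0 3 (ltW X0)) G2.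
  by clearbody th; clear; lra.
have [/dist_le eR _] := ra c N cn step1.
have [_ /dist_le eS] := ra d N dn step1.
have {}eR : `|dR c - dR N| <= th / 32 * X ^+ 2.
  apply: eR; rewrite cub NX; move: Dub; rewrite !ler_norml.
  by lra using mN Nm X2u.
have {}eS : `|dS d - dS N| <= th / 32 * X ^+ 2.
  apply: eS; rewrite dub NX; move: Dub; rewrite !ler_norml.
  by lra using mN Nm X2u.
have sq : X ^+ 2 / 2 <= Num.sqrt (N%:R - M%:R).
  rewrite -[leLHS]ger0_norm ?divr_ge0 ?sqr_ge0 // -sqrtr_sqr ler_wsqrtr //.
  by rewrite NX expr_div_n -exprM; lra using G3.
have mu01 : 0 <= mu <= 1 by rewrite ltW.
have dM1 := @deviation_le r mu y M mu01 r01.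
have dM2 := @deviation_le s mu x M mu01 s01.
(* Between M and N the R-sum has fallen behind and the S-sum has run ahead, so the greedy policy
   must have read more from R. What happened before M costs at most 2 M, absorbed by [G4]. *)
have Dlb : th / 8 * X ^+ 2 <= D.
  have E : 2 * mu * D = (Gamma s x c - Gamma r y d) + dS d - dR c.
    by rewrite !(GammaE _ mu) -/dS -/dR cub dub; ring.
  have hS := ler_wpM2l thS0 sq; have hR := ler_wpM2l thR0 sq.
  have lower : th / 4 * X ^+ 2 <= 2 * mu * D.
    rewrite E; move: eR eS gr dM1 dM2; rewrite -/dS -/dR !ler_norml.
    rewrite /th in G4 *; clearbody dR dS.
    by lra using G4 bS bR hS hR.
  have D0 : 0 <= D.
    rewrite -(@pmulr_rge0 _ (2 * mu)) ?mulr_gt0 //; apply: le_trans lower.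
    by rewrite mulr_ge0 ?sqr_ge0 // divr_ge0.
  have : mu * D <= 1 * D by rewrite ler_wpM2r.
  by clearbody D th; lra using lower.
have D0 : 0 <= D by apply: le_trans Dlb; rewrite mulr_ge0 ?sqr_ge0 ?divr_ge0.
have cm : (m <= c)%N by rewrite -(ler_nat R) -subr_ge0.
have [dn0 cE] : exists e, c = (m + e)%N by exists (c - m)%N; rewrite subnKC.
have dE : d = (m - dn0)%N by lia using cdm cE.
have dnm : (dn0 <= m)%N by lia using cdm cE.
have DdE : D = dn0%:R by rewrite /D cE natrD addrC addKr.
have l1 : (0 < l)%N by rewrite -(ltr_nat R).
(* The displacement splits into j full blocks and an incomplete one. Below, j <= q keeps the blocks
   inside the run, and j is at least of order u^3. *)
have [j [rr [jE rl]]] : exists j rr, dn0 = (j * l + rr)%N /\ (rr < l)%N.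
  by exists (dn0 %/ l)%N, (dn0 %% l)%N; rewrite ltn_mod -divn_eq.
have u30 : 0 < u ^+ 3 by rewrite exprn_gt0.
have jq : (j <= q)%N.
  rewrite -(leq_pmul2r l1) -(ler_nat R) !natrM qX.
  have -> : u ^+ 4 * l%:R = X ^+ 2 * u by rewrite -lX; ring.
  apply: le_trans Dub; rewrite ger0_norm // DdE jE natrD natrM.
  by rewrite lerDl.
have jlb : th / 16 * u ^+ 3 <= j%:R.
  have : th / 8 * X ^+ 2 <= (j%:R + 1) * l%:R.
    apply: (le_trans Dlb); rewrite DdE jE natrD natrM mulrDl mul1r lerD2l.
    by rewrite ler_nat ltnW.
  rewrite -lX [l%:R * _]mulrC mulrA ler_pM2r //.
  by clearbody th; lra using G6.
(* The true order is X / u^(3/2); the weaker exponent 2 avoids a fractional power and still yields a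
   total gain of order u X. *)
have slx : X / u ^+ 2 <= Num.sqrt l%:R.
  have xu0 : 0 <= X / u ^+ 2 by rewrite divr_ge0 ?sqr_ge0 // ltW.
  rewrite -(ger0_norm xu0) -sqrtr_sqr ler_wsqrtr //.
  rewrite expr_div_n -exprM ler_pdivrMr ?exprn_gt0 // -lX.
  by rewrite ler_wpM2l ?(ltW l0) // ler_weXn2l.
have sl0 : 0 <= Num.sqrt l%:R :> R by rewrite sqrtr_ge0.
(* The greedy policy has read R beyond m, so the first j blocks after the middle of the run are
   collected. *)
have fullR : j%:R * (thR * Num.sqrt l%:R) <= eps * dR (m + j * l)%N - eps * dR m.
  apply: (@sum_of_blocks (fun i => eps * dR i) _ m l j) => i ij.
  have iq : (q + i < 2 * q)%N by lia using ij jq.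
  have [h _] := blocks _ iq; rewrite -mulrBr; move: h => /=.
  have -> : (N + (2 * a * q + (q + i)) * l = m + i * l)%N by rewrite mE; ring.
  by have -> : (m + i * l + l = m + i.+1 * l)%N by ring.
have [t tE] : exists t, m = (t + j * l)%N.
  exists (m - j * l)%N; rewrite subnK //.
  by rewrite (leq_trans _ dnm) // jE leq_addr.
(* It has stopped short of m in S: the last j blocks before the middle are missing, and their
   increment enters with a minus sign. Hence the factor - eps in the hypothesis on S. *)
have fullS : j%:R * (thS * Num.sqrt l%:R) <= - eps * dS m - - eps * dS t.
  rewrite {1}tE.
  apply: (@sum_of_blocks (fun i => - eps * dS i) _ t l j) => i ij.
  have iq : (q - j + i < 2 * q)%N by lia using ij jq.
  have [_ h] := blocks _ iq; rewrite -mulrBr; move: h => /=.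
  have -> : (N + (2 * a * q + (q - j + i)) * l = t + i * l)%N.
    apply: (@addIn (j * l)); rewrite [RHS]addnAC -tE mE.
    have [w ->] : exists w, q = (j + w)%N by exists (q - j)%N; rewrite subnKC.
    by rewrite addKn; ring.
  by have -> : (t + i * l + l = t + i.+1 * l)%N by ring.
(* The incomplete block is controlled by regularity only; [G7] makes its loss a small fraction of
   the gain from the full blocks. *)
have partial (z e : R) : `|z| <= l%:R -> e ^+ 2 <= C * `|z| * ln (2 * m)%:R ->
    `|e| <= th ^+ 2 * u ^+ 3 / 64 * Num.sqrt l%:R.
  move=> hz he; apply: norm_le_of_sqr.
    by rewrite mulr_ge0 // divr_ge0 // mulr_ge0 ?sqr_ge0 // ltW.
  apply: (le_trans he); apply: (@le_trans _ _ (C * l%:R * (5 * K))).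
    by apply: ler_pM; rewrite ?mulr_ge0 // ler_wpM2l.
  rewrite [leRHS]exprMn sqr_sqrtr ?ler0n //.
  have := ler_wpM2r (ltW l0) G7; clearbody th; clear.
  by lra.
have rr0 : `|rr%:R| <= l%:R :> R by rewrite ger0_norm ?ler0n // ler_nat ltnW.
have jlm : (m + j * l <= 2 * m)%N by lia using tE.
have [pR _] := ra c (m + j * l)%N cn jlm.
have tm : (t <= 2 * m)%N by lia using tE.
have [_ pS] := ra d t dn tm.
have {}pR : `|dR c - dR (m + j * l)%N| <= th ^+ 2 * u ^+ 3 / 64 * Num.sqrt l%:R.
  apply: (partial _ _ rr0); apply: (le_trans pR); rewrite cE jE.
  rewrite ler_wpM2r // ler_wpM2l //.
  by rewrite addnA !natrD addrC addKr.
have {}pS : `|dS d - dS t| <= th ^+ 2 * u ^+ 3 / 64 * Num.sqrt l%:R.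
  apply: (partial _ _ rr0); apply: (le_trans pS).
  have -> : t = (d + rr)%N by lia using dE tE jE dnm.
  rewrite ler_wpM2r // ler_wpM2l //.
  by rewrite natrD opprD addrA subrr add0r normrN.
have abs_eps (z : R) : `|eps * z| = `|z|.
  rewrite normrM (_ : `|eps| = 1) ?mul1r //.
  by apply/eqP; rewrite -(@eqrXn2 _ 2) // ?normr_ge0 // real_normK ?num_real // eps2 expr1n.
have Y : th ^+ 2 / 32 * u * X
    <= eps * ((dR c - dR m) + (dS d - dS m)).
  have pR' : `|eps * (dR c - dR (m + j * l)%N)|
      <= th ^+ 2 * u ^+ 3 / 64 * Num.sqrt l%:R by rewrite abs_eps.
  have pS' : `|eps * (dS d - dS t)| <= th ^+ 2 * u ^+ 3 / 64 * Num.sqrt l%:R.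
    by rewrite abs_eps.
  apply: (@le_trans _ _ (th ^+ 2 * u ^+ 3 / 32 * Num.sqrt l%:R)).
    have e : th ^+ 2 / 32 * u * X = th ^+ 2 * u ^+ 3 / 32 * (X / u ^+ 2).
      by field; rewrite gt_eqF.
    by rewrite e ler_wpM2l // divr_ge0 // mulr_ge0 ?sqr_ge0 // ltW.
  have main : th * (th / 16 * u ^+ 3) * Num.sqrt l%:R <= th * j%:R * Num.sqrt l%:R.
    by rewrite ler_wpM2r // ler_wpM2l.
  move: pR' pS' main; rewrite !ler_norml [in th * j%:R]/th; clearbody dR dS th.
  by lra using fullR fullS.
have n2 : `|(Gamma s x c - Gamma r y d) * D| <= D ^+ 2.
  rewrite normrM (le_trans _ (norm_natB_le_sqr _ c m)) // -[leRHS]mul1r.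
  by rewrite ler_wpM2r.
have n1 : `|mu * D ^+ 2| <= D ^+ 2.
  by rewrite normrM (gtr0_norm mu0) ger0_norm ?sqr_ge0 // ler_piMl ?sqr_ge0.
have Dsq : D ^+ 2 <= th ^+ 2 / 256 * u * X ^+ 5.
  apply: (@le_trans _ _ ((X ^+ 2 * u) ^+ 2)).
    by rewrite -[leLHS]real_normK ?num_real // ler_pXn2r ?nnegrE // mulr_ge0 ?sqr_ge0 // ltW.
  have := ler_wpM2l (mulr_ge0 (exprn_ge0 4 (ltW X0)) (ltW u0)) G9.
  by clearbody th; clear; lra.
rewrite {}DE; move: H2; set H := kernel_sum _ _ _ _ _ _ _ - _ => H2.
have hH : `|H| <= th ^+ 2 / 128 * u * X ^+ 5.
  apply: norm_le_of_sqr; first by rewrite !mulr_ge0 ?divr_ge0 ?sqr_ge0 ?exprn_ge0 ?(ltW u0) ?(ltW X0).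
  apply: (le_trans H2).
  apply: (@le_trans _ _ (4 * C * (X ^+ 2 * u) ^+ 2 * (4 * X ^+ 4 * (5 * K)))).
    apply: ler_pM; rewrite ?mulr_ge0 ?sqr_ge0 //.
      rewrite ler_wpM2l ?mulr_ge0 //.
      by rewrite -[leLHS]real_normK ?num_real // ler_pXn2r ?nnegrE // mulr_ge0 ?sqr_ge0 // ltW.
    by apply: ler_pM.
  have := ler_wpM2l (mulr_ge0 (exprn_ge0 8 (ltW X0)) (sqr_ge0 u)) G8.
  by clearbody th; clear; lra.
have mY : X ^+ 4 * (th ^+ 2 / 32 * u * X)
    <= m%:R * (eps * ((dR c - dR m) + (dS d - dS m))).
  by apply: ler_pM; rewrite ?mulr_ge0 ?divr_ge0 ?sqr_ge0 ?exprn_ge0 ?(ltW u0) ?(ltW X0).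
have aH := abs_eps H; have a1 := abs_eps (mu * D ^+ 2).
have a2 := abs_eps ((Gamma s x c - Gamma r y d) * D).
move: n1 n2 hH; rewrite -aH -a1 -a2 !ler_norml -/dR -/dS; clearbody dR dS H th D.
set G := Gamma s x c - _; clearbody G.
by lra using Dsq mY.
Qed.

End lower_bound.

(** * Asymptotics *)

(** Makes the truncated subtraction in the exponent of [block_length] exact. *)
Lemma three_mul_le k : (3 * k <= 2 * 32 ^ k)%N.
Proof. by elim: k => // k; rewrite expnS; lia. Qed.

Section asymptotics.
Variable (R : realType).

Lemma limn_esup_pinfty (u : nat -> R) :
  (forall B n0, exists2 n, (n0 <= n)%N & B <= u n) ->
  limn_esup (fun n => (u n)%:E) = +oo%E.
Proof.
move=> h; rewrite /limn_esup limf_esupE; apply/ereal_inf_pinfty => z /= [V [N _ NV] <-].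
apply/eqyP => B B0; have [n Nn Bn] := h B N.
by apply: le_ereal_sup_tmp; exists (u n)%:E; [exists n => //; exact: NV|rewrite lee_fin].
Qed.

(** The one source of the largeness conditions on a scale; it is applied to the scale index and to
    powers of 32. *)
Lemma exp_dominates (c d : R) : 0 <= c -> 0 < d ->
  exists k0, forall k, (k0 <= k)%N -> c * k.+1%:R <= d * 2 ^+ k.
Proof.
move=> c0 d0.
have sq k : (k.+1 ^ 2 <= 4 * 2 ^ k)%N.
  elim: k => // [[|[|k]]] // IH; rewrite [(2 ^ _.+3)%N]expnS.
  by rewrite (leq_trans _ (_ : 2 * (k.+3 ^ 2) <= _)%N) //; nia.
have [k0 ck0] : exists k0 : nat, 4 * (c / d) <= k0%:R.
  have [N _ h] := nbhs_infty_ger (4 * (c / d)); exists N; exact: (h N (leqnn N)).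
exists k0 => k kk; have := sq k; rewrite -(ler_nat R) natrM !natrX => h.
have : 4 * (c / d) * k.+1%:R <= k.+1%:R ^+ 2.
  by rewrite expr2 ler_wpM2r // (le_trans ck0) // ler_nat leqW.
move=> h1; have : c / d * k.+1%:R <= 2 ^+ k by lra using h h1.
by rewrite mulrAC ler_pdivrMr // [2 ^+ k * d]mulrC.
Qed.

Definition normalizer (n : nat) : R :=
  n%:R `^ (5%:R / 4%:R) * (ln (ln n%:R)) `^ (1 / 4%:R).

Lemma normalizer_pow4 n : 0 <= ln (ln n%:R) :> R ->
  normalizer n ^+ 4 = n%:R ^+ 5 * ln (ln n%:R).
Proof.
move=> LL0; rewrite exprMn -!powR_mulrn ?powR_ge0 // -!powRrM.
have -> : 5%:R / 4%:R * 4%:R = 5%:R :> R by field.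
have -> : 1 / 4%:R * 4%:R = 1%:R :> R by field.
by rewrite !powR_mulrn // expr1.
Qed.

Lemma near_log : \forall n \near \oo,
  [/\ 1 <= ln (ln n%:R) :> R, ln (ln n%:R) <= ln n%:R :> R & ln n%:R <= n%:R :> R].
Proof.
near=> n; have n1 : expR (expR 1) <= n%:R :> R by near: n; exact: nbhs_infty_ger.
have n0 : 0 < n%:R :> R by apply: lt_le_trans n1; exact: expR_gt0.
have L1 : expR 1 <= ln n%:R :> R.
  by rewrite -[leLHS](@expRK R) ler_ln ?posrE ?expR_gt0.
have L0 : 0 < ln n%:R :> R by apply: lt_le_trans L1; exact: expR_gt0.
split; last exact: ltW (ln_sublinear _); last exact: ltW (ln_sublinear _).
by rewrite -[leLHS](@expRK R) ler_ln ?posrE ?expR_gt0.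
Unshelve. all: by end_near. Qed.

Definition match_ratio (x y : nat -> nat) (c a : nat -> nat * nat) n : R :=
  ((matches x y (c n))%:R - (matches x y (a n))%:R) / normalizer n.

Lemma match_ratio_bigO (C : R) (r s : nat -> R) (mu : R) (x y : nat -> nat)
    (c a : nat -> nat * nat) :
  0 <= C -> 0 < mu -> mu <= 1 ->
  (forall n, ((c n).1 + (c n).2 = n)%N) -> (forall n, ((a n).1 + (a n).2 = n)%N) ->
  (forall n, `|Gamma s x (c n).1 - Gamma r y (c n).2| <= 1) ->
  (forall n, ((a n).1 <= (a n).2.+1)%N /\ ((a n).2 <= (a n).1.+1)%N) ->
  (\forall n \near \oo, regular C r s mu x y n) ->
  exists B : R,
  \forall n \near \oo, `|match_ratio x y c a n| <= B * (ln n%:R) `^ (1 / 2%:R).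
Proof.
move=> C0 mu0 mu1 c_sum a_sum c_greedy a_bal reg.
exists (upper_const C mu); near=> n.
have [LL1 LLL Ln] : [/\ 1 <= ln (ln n%:R) :> R, ln (ln n%:R) <= ln n%:R :> R
    & ln n%:R <= n%:R :> R] by near: n; exact: near_log.
have reg_n : regular C r s mu x y n by near: n.
have LL0 : 0 <= ln (ln n%:R) :> R by exact: le_trans LL1.
have n0 : 0 < normalizer n.
  apply: mulr_gt0; apply: powR_gt0; last exact: lt_le_trans LL1.
  exact: lt_le_trans (lt_le_trans ltr01 (le_trans LL1 LLL)) Ln.
rewrite normrM normfV (gtr0_norm n0) ler_pdivrMr //.
rewrite -mulrA [_ `^ _ * normalizer n]mulrC; case: (a_bal n) => b1 b2.
have := matches_difference_le reg_n mu0 mu1 C0 (c_sum n) (a_sum n) b1 b2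
  (c_greedy n) LL1 LLL Ln.
rewrite -!surjective_pairing; apply; first by rewrite mulr_ge0 ?powR_ge0 // ltW.
rewrite exprMn normalizer_pow4 // -[_ `^ _ ^+ 4]powR_mulrn ?powR_ge0 // -powRrM.
have -> : 1 / 2%:R * 4%:R = 2%:R :> R by field.
by rewrite powR_mulrn // (le_trans LL0).
Unshelve. all: by end_near. Qed.

(* With [K = 32 ^ k], scale number [k] is [N = scale k ^ 4 = 16 ^ K] and its
   blocks have length [4 ^ K / 8 ^ k].  Since [N] grows so fast, what happens
   before [2 * scale k ^ 4] is negligible at scale [k.+1]. *)
Definition scale k := (2 ^ (32 ^ k))%N.
Definition block_length k := (2 ^ (2 * 32 ^ k - 3 * k))%N.
Definition block_start k b := (scale k ^ 4 + b * block_length k)%N.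

(** The first two conditions force D to be positive and of order sqrt N. In the third, i numbers
    consecutive runs of 2 q blocks starting at N, and the bound keeps the chosen run within N^(3/4)
    of N. *)
Definition favorable (r s : nat -> R) (mu : R) (x y : nat -> nat) (eps thR thS : R) k :=
  let dR := deviation s mu x in let dS := deviation r mu y in
  let M := (2 * scale k ^ 4)%N in let N := (scale k.+1 ^ 4)%N in
  let l := block_length k.+1 in let q := (16 ^ k.+1)%N in
  [/\ thR * Num.sqrt (N%:R - M%:R) <= - (dR N - dR M),
      thS * Num.sqrt (N%:R - M%:R) <= dS N - dS M
    & exists2 i, ((2 * i * q + 2 * q) * l <= scale k.+1 ^ 3)%N &
        forall b, (b < 2 * q)%N ->
        let t := block_start k.+1 (2 * i * q + b) in
        thR * Num.sqrt l%:R <= eps * (dR (t + l)%N - dR t) /\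
        thS * Num.sqrt l%:R <= - eps * (dS (t + l)%N - dS t)].

Lemma match_ratio_unbounded (C : R) (r s : nat -> R) (mu : R) (x y : nat -> nat)
    (c a : nat -> nat * nat) (eps thR thS : R) :
  (forall i, 0 <= r i <= 1) -> (forall i, 0 <= s i <= 1) ->
  0 <= C -> 0 < mu -> mu <= 1 ->
  (forall n, ((c n).1 + (c n).2 = n)%N) -> (forall n, ((a n).1 + (a n).2 = n)%N) ->
  (forall n, `|Gamma s x (c n).1 - Gamma r y (c n).2| <= 1) ->
  (forall n, ((a n).1 <= (a n).2.+1)%N /\ ((a n).2 <= (a n).1.+1)%N) ->
  (\forall n \near \oo, regular C r s mu x y n) ->
  eps ^+ 2 = 1 ->
  0 <= thR -> 0 <= thS -> 0 < thR + thS ->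
  (forall k0, exists2 k, (k0 <= k)%N & favorable r s mu x y eps thR thS k) ->
  forall B n0, exists2 n, (n0 <= n)%N & B <= eps * match_ratio x y c a n.
Proof.
move=> r01 s01 C0 mu0 mu1 c_sum a_sum c_greedy a_bal reg.
move=> eps2 thR0 thS0 th0 fav B n0; set th := thR + thS in th0.
(* Positivity lets the final inequality be compared in fourth powers. *)
wlog B0 : B / 0 < B => [H|].
  have [n nn Bn] := H (Num.max B 1) ltac:(by rewrite lt_max ltr01 orbT).
  by exists n => //; apply: le_trans Bn; rewrite le_max lexx.
have [n1 _ regn] : \forall n \near \oo, regular C r s mu x y n
    /\ 1 <= ln (ln n%:R) :> R.
  by near=> n; split; [near: n|have [] : [/\ 1 <= ln (ln n%:R) :> R,
    ln (ln n%:R) <= ln n%:R :> R & ln n%:R <= n%:R :> R]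
    by near: n; exact: near_log].
set K1 := (4 + 2 * C) / mu ^+ 2.
have K10 : 0 <= K1 by rewrite divr_ge0 ?sqr_ge0 // addr_ge0 // mulr_ge0.
have thp n e : 0 < (th ^+ n / e.+1%:R) by rewrite divr_gt0 ?exprn_gt0.
(* The first seven thresholds serve the numerical hypotheses of [matches_difference_ge], the eighth
   the comparison with the normalizer. *)
have [k1 h1] := @exp_dominates (20 * K1) 1 ltac:(by rewrite mulr_ge0) ltr01.
have [k2 h2] := @exp_dominates (10 * C) ((th / 32) ^+ 2)
  ltac:(by rewrite mulr_ge0) ltac:(by rewrite exprn_gt0 // divr_gt0).
have [k3 h3] := @exp_dominates 5 (th / 8) ltac:(by []) ltac:(by rewrite divr_gt0).
have [k4 h4] := @exp_dominates 1 (th / 16) ltac:(by []) ltac:(by rewrite divr_gt0).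
have [k5 h5] := @exp_dominates (5 * C) ((th ^+ 2 / 64) ^+ 2)
  ltac:(by rewrite mulr_ge0) ltac:(by rewrite exprn_gt0).
have [k6 h6] := @exp_dominates (80 * C) ((th ^+ 2 / 128) ^+ 2)
  ltac:(by rewrite mulr_ge0) ltac:(by rewrite exprn_gt0).
have [k7 h7] := @exp_dominates 2 (th ^+ 2 / 128) ltac:(by []) ltac:(by []).
have [k8 h8] := @exp_dominates (B ^+ 4 * 4 ^+ 5 * 5) ((th ^+ 2 / 64) ^+ 4)
  ltac:(by rewrite !mulr_ge0 ?exprn_ge0 // ltW) ltac:(by rewrite exprn_gt0).
pose S := (n0 + n1 + k1 + k2 + k3 + k4 + k5 + k6 + k7 + k8)%N.
have S_n0 : (n0 <= S)%N by clear; lia.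
have S_n1 : (n1 <= S)%N by clear; lia.
have S_k1 : (k1 <= S)%N by clear; lia.
have S_k2 : (k2 <= S)%N by clear; lia.
have S_k3 : (k3 <= S)%N by clear; lia.
have S_k4 : (k4 <= S)%N by clear; lia.
have S_k5 : (k5 <= S)%N by clear; lia.
have S_k6 : (k6 <= S)%N by clear; lia.
have S_k7 : (k7 <= S)%N by clear; lia.
have S_k8 : (k8 <= S)%N by clear; lia.
have [k kk] := fav S.
move=> [bR bS [i run blocks]]; move: bR bS run blocks.
have Klt j : (j < 32 ^ j)%N by rewrite ltn_expl.
set ka := k.+1; set K := (32 ^ ka)%N.
have [kal Kl] : (k < ka)%N /\ (ka < K)%N by rewrite /K Klt.
have K2 : (32 <= K)%N by rewrite /K expnS leq_pmulr // expn_gt0.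
set u : R := 2 ^+ ka; set X : R := 2 ^+ K.
have XE : (scale ka)%:R = X by rewrite natrX.
have u1 : 1 <= u by rewrite exprn_ege1 // ler1n.
have X1 : 1 <= X by rewrite exprn_ege1 // ler1n.
have uX : u <= X by rewrite ler_weXn2l ?ler1n // ltnW.
have uK : u <= K%:R by rewrite /K natrX lerXn2r ?nnegrE // ler_nat.
have Ku5 : K%:R = u ^+ 5.
  by rewrite /u -exprM mulnC exprM /K natrX; congr (_ ^+ _); rewrite -natrX.
(* The preceding scale. Since X = Z^32, the past M = 2 Z^4 is negligible even against X^2 = sqrt
   N. *)
pose Z : R := (scale k)%:R.
have XZ : X = Z ^+ 32 by rewrite /X /Z /scale natrX -exprM /K /ka expnSr.
have Z2 : 2 <= Z.
  by rewrite /Z ler_nat -{1}(expn1 2) leq_pexp2l // expn_gt0.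
have Z1 : 1 <= Z by apply: le_trans Z2; rewrite ler1n.
have MZ : (2 * scale k ^ 4)%:R = 2 * Z ^+ 4 by rewrite natrM natrX.
have NX : (scale ka ^ 4)%:R = X ^+ 4 by rewrite natrX XE.
have qX : (16 ^ ka)%:R = u ^+ 4.
  by rewrite /u -exprM mulnC exprM natrX; congr (_ ^+ _); rewrite -natrX.
have K3 : (3 * ka <= 2 * K)%N.
  exact: three_mul_le.
have lX : (block_length ka)%:R * u ^+ 3 = X ^+ 2.
  by rewrite /block_length -/K natrX /u /X -!exprM -exprD [(ka * 3)%N]mulnC subnK
    ?[(K * 2)%N]mulnC.
move=> bR bS run blocks.
set l := block_length ka in lX run blocks.
set q := (16 ^ ka)%N in qX run blocks.
set N := (scale ka ^ 4)%N in NX bR bS.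
set M := (2 * scale k ^ 4)%N in MZ bR bS.
pose m := (N + (2 * i * q + q) * l)%N.
have Nm : (N <= m)%N by rewrite /m leq_addr.
have km : (k <= 2 * m)%N.
  rewrite (@leq_trans N) //; last by lia using Nm.
  rewrite /N /scale -expnM -/K (@leq_trans K) //; first exact: leq_trans (ltnW kal) (ltnW Kl).
  by rewrite ltnW // (leq_trans (ltn_expl _ (isT : 1 < 2)%N)) // leq_pexp2l // leq_pmulr.
have kj j : (j <= S)%N -> (j <= k)%N.
  by move=> jj; exact: leq_trans kk.
have nm j : (j <= S)%N -> (j <= 2 * m)%N.
  by move=> /kj jk; exact: leq_trans km.
have [rm LL1] := regn (2 * m)%N (nm _ S_n1).
have runX : ((2 * i * q + 2 * q) * l)%:R <= X ^+ 3.
  by rewrite -XE -natrX ler_nat.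
have ml : m%:R <= X ^+ 4 + X ^+ 3.
  rewrite natrD NX lerD2l (le_trans _ runX) // ler_nat leq_mul2r.
  by clear; lia.
have X34 : X ^+ 3 <= X ^+ 4 by rewrite ler_weXn2l.
have n4 : (2 * m)%:R <= 4 * X ^+ 4 by rewrite natrM; lra using ml X34.
have n0' : 0 < (2 * m)%:R :> R.
  rewrite natrM mulr_gt0 // (lt_le_trans (_ : 0 < N%:R)) ?ler_nat //.
  by rewrite NX exprn_gt0 // (lt_le_trans ltr01).
have ln2n j : ln (2 ^+ j) <= j%:R :> R.
  rewrite lnXn // -[leRHS]mulr1 mulr_natl lerMn2r; apply/orP; right.
  by have := @le_ln1Dx R 1 (lt_trans (ltrN10 _) ltr01); rewrite (_ : 1 + 1 = 2 :> R).
have LK : ln (2 * m)%:R <= 5 * K%:R :> R.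
  apply: (@le_trans _ _ (ln (2 ^+ (4 * K + 2) : R))).
    rewrite ler_ln ?posrE ?exprn_gt0 // (le_trans n4) // exprD mulnC exprM -/X.
    by clear; lra.
  apply: (le_trans (ln2n _)); rewrite -natrM ler_nat.
  by lia using K2.
have LLk : ln (ln (2 * m)%:R) <= 5 * ka.+1%:R :> R.
  have L0 : 0 < ln (2 * m)%:R :> R.
    rewrite ltNge; apply/negP => /ln0 e; move: LL1; rewrite e ler10 //.
  apply: (@le_trans _ _ (ln (2 ^+ (5 * ka + 3) : R))).
    rewrite ler_ln ?posrE ?exprn_gt0 // (le_trans LK) // exprD mulnC exprM -/u -Ku5.
    have : 0 <= K%:R :> R by []. 
    by clear; lra.
  apply: (le_trans (ln2n _)); rewrite -natrM ler_nat.
  by clear; lia.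
have c2m := c_sum (2 * m)%N; have g2m := c_greedy (2 * m)%N.
have ammE : a (2 * m)%N = (m, m).
  have := a_sum (2 * m)%N; have := a_bal (2 * m)%N; case: (a _) => a1 a2 /= h e.
  by congr pair; lia using h e.
have pos3 : 0 <= K%:R :> R by [].
have ka1 : 1 <= ka.+1%:R :> R by rewrite ler1n.
have e01 : 0 < mu <= 1 by rewrite mu0.
have Kn : K%:R <= K.+1%:R :> R by rewrite ler_nat.
have X0 : 0 <= X by exact: le_trans X1.
have X12 : X <= X ^+ 2 by rewrite expr2 ler_peMr.
have u0 : 0 <= u by exact: le_trans u1.
have uu j : u <= u ^+ j.+1 by rewrite exprS ler_peMr // exprn_ege1.
have kaL j : (j <= S)%N -> (j <= ka)%N.
  by move=> /kj jk; exact: leq_trans (ltnW kal).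
have KL j : (j <= S)%N -> (j <= K)%N.
  by move=> /kaL jk; exact: leq_trans (ltnW Kl).
have {}h1 := h1 ka (kaL _ S_k1).
have {}h2 := h2 K (KL _ S_k2).
have {}h3 := h3 (32 ^ k)%N (leq_trans (kj _ S_k3) (ltnW (Klt k))).
have {}h4 := h4 ka (kaL _ S_k4).
have {}h5 := h5 ka (kaL _ S_k5).
have {}h6 := h6 K (KL _ S_k6).
have {}h7 := h7 K (KL _ S_k7).
have {}h8 := h8 ka (kaL _ S_k8).
rewrite -/u in h1 h4 h5 h8; rewrite -/X in h2 h6 h7.
have G1 : 20 * K1 * ka.+1%:R <= u ^+ 2.
  by rewrite (le_trans h1) // mul1r.
have G2 : 10 * C * K%:R <= (th / 32) ^+ 2 * X.
  by apply: le_trans h2; rewrite ler_wpM2l // mulr_ge0.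
have Z4 : Z ^+ 4 * 16 <= Z ^+ 128.
  have -> : Z ^+ 128 = Z ^+ 4 * (Z ^+ 4 * Z ^+ 120) by rewrite -!exprD.
  rewrite ler_wpM2l ?exprn_ge0 ?(le_trans _ Z1) //.
  rewrite -[leLHS]mulr1; apply: ler_pM; [by []|by []| |exact: exprn_ege1].
  have -> : 16 = 2 ^+ 4 :> R by clear; ring.
  by rewrite lerXn2r ?nnegrE // (le_trans _ Z1).
have XZ4 : X ^+ 4 = Z ^+ 128 by rewrite XZ -exprM.
have Z40 : 0 <= Z ^+ 4 by rewrite exprn_ge0 // (le_trans _ Z1).
have G3 : M%:R <= 3 / 4 * X ^+ 4.
  by rewrite MZ XZ4; lra using Z4 Z40.
have Z41 : 1 <= Z ^+ 4 by rewrite exprn_ege1.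
have G4 : 2 * M%:R + 1 <= th / 8 * X ^+ 2.
  apply: (@le_trans _ _ (5 * Z ^+ 4)); first by rewrite MZ; lra using Z41.
  have h3' : 5 <= th / 8 * Z.
    apply: (@le_trans _ _ (5 * (32 ^ k).+1%:R)); first by rewrite ler_peMr // ler1n.
    by rewrite /Z /scale natrX.
  rewrite XZ -exprM; apply: (@le_trans _ _ (th / 8 * Z * Z ^+ 4)).
    by rewrite ler_wpM2r.
  rewrite -mulrA -exprS ler_wpM2l ?ler_weXn2l ?divr_ge0 //.
  exact: ltW.
have G6 : 1 <= th / 16 * u ^+ 3.
  apply: (@le_trans _ _ (th / 16 * u)).
    by apply: le_trans h4; rewrite mul1r ler1n.
  by rewrite ler_wpM2l // divr_ge0 // ltW.
have th2 e : 0 <= th ^+ 2 / e.+1%:R by rewrite divr_ge0 ?sqr_ge0.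
have G7 : 5 * C * K%:R <= (th ^+ 2 * u ^+ 3 / 64) ^+ 2.
  rewrite (_ : _ ^+ 2 = (th ^+ 2 / 64) ^+ 2 * u * u ^+ 5); last by clear; field.
  rewrite Ku5 ler_wpM2r ?exprn_ge0 //; apply: le_trans h5.
  by rewrite ler_peMr ?ler1n // mulr_ge0.
have G8 : 80 * C * K%:R <= (th ^+ 2 / 128) ^+ 2 * X ^+ 2.
  apply: (@le_trans _ _ ((th ^+ 2 / 128) ^+ 2 * X)).
    by apply: le_trans h6; rewrite ler_wpM2l // mulr_ge0.
  by rewrite ler_wpM2l ?sqr_ge0.
have G9 : 2 * u <= th ^+ 2 / 128 * X.
  by apply: le_trans h7; rewrite ler_wpM2l // (le_trans uK).
exists (2 * m)%N; first exact: nm.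
have := @matches_difference_ge R C r s mu x y eps thR thS X u K%:R ka.+1%:R
  M N l q i m _ _ eps2 e01 C0 thR0 thS0 th0 r01 s01 X1 u1 pos3 ka1 NX lX qX
  erefl runX rm LL1 LK LLk c2m g2m bS bR blocks G1 G2 G3 G4 uX G6 G7 G8 G9.
rewrite -surjective_pairing -ammE -/th => lower.
have LL0 : 0 <= ln (ln (2 * m)%:R) :> R by exact: le_trans LL1.
have LN0 : 0 < ln (2 * m)%:R :> R.
  by rewrite ltNge; apply/negP => /ln0 e; move: LL1; rewrite e ler10.
have nz0 : 0 < normalizer (2 * m)%N.
  by apply: mulr_gt0; apply: powR_gt0 => //; apply: lt_le_trans LL1.
rewrite /match_ratio mulrA ler_pdivlMr //; apply: le_trans lower.
set rhs := th ^+ 2 / 64 * u * X ^+ 5.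
have rhs0 : 0 <= rhs.
  by apply: mulr_ge0; [apply: mulr_ge0 => //; exact: (th2 63)|exact: exprn_ge0].
rewrite -(@ler_pXn2r _ 4) ?nnegrE ?mulr_ge0 ?(ltW nz0) ?(ltW B0) //.
rewrite exprMn normalizer_pow4 //.
(* Once X^20 is cancelled, the comparison is between a multiple of k and u^4, a power of 2^k. *)
apply: (@le_trans _ _ (B ^+ 4 * ((4 * X ^+ 4) ^+ 5 * (5 * ka.+1%:R)))).
  rewrite ler_wpM2l ?exprn_ge0 ?(ltW B0) //; apply: ler_pM => //.
  by rewrite lerXn2r ?nnegrE ?mulr_ge0 ?exprn_ge0.
rewrite (_ : B ^+ 4 * _ = B ^+ 4 * 4 ^+ 5 * 5 * ka.+1%:R * X ^+ 20);
  last by clear; ring.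
rewrite (_ : rhs ^+ 4 = (th ^+ 2 / 64) ^+ 4 * u ^+ 4 * X ^+ 20);
  last by rewrite /rhs; clear; ring.
rewrite ler_wpM2r ?exprn_ge0 //; apply: (le_trans h8).
by apply: ler_wpM2l; [exact: exprn_ge0 (th2 63)|exact: (uu 3)].
Unshelve. all: by [end_near|exact: powR_ge0|exact: ltW]. Qed.

End asymptotics.

(** * Discrete random variables and independence *)

Section discrete.
Context d (T : measurableType d) (R : realType) (P : probability T R).
Local Open Scope ereal_scope.

Definition discrete_rv (X : T -> nat) := forall B : set nat, measurable (X @^-1` B).

Lemma trivIset_fibers (X : T -> nat) (E : set T) :
  trivIset setT (fun n => E `&` X @^-1` [set n]).
Proof. by move=> i j _ _ [w [[_ /= <-] [_ /= <-]]]. Qed.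

Lemma bigcup_fibers (X : T -> nat) (E : set T) :
  \bigcup_n (E `&` X @^-1` [set n]) = E.
Proof. by apply/seteqP; split=> [w [n _ []]//|w Ew]; exists (X w). Qed.

Lemma measurable_comp_discrete d' (T' : sigmaRingType d') (X : T -> nat)
  (g : nat -> T') D : discrete_rv X -> measurable_fun D (fun w => g (X w)).
Proof.
move=> mX mD B mB; by apply: measurableI => //; exact: (mX (g @^-1` B)).
Qed.

Lemma total_probability (X : T -> nat) (E : set T) : discrete_rv X -> measurable E ->
  P E = \sum_(n <oo) P (E `&` X @^-1` [set n]).
Proof.
move=> mX mE; rewrite -[in LHS](bigcup_fibers X E) measure_semi_bigcup //.
- by move=> i; apply: measurableI => //; exact: mX.
- exact: trivIset_fibers.
- by rewrite bigcup_fibers.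
Qed.

Lemma indep_fibers (X : T -> nat) (E : set T) (B : set nat) :
  discrete_rv X -> measurable E ->
  (forall n, P (E `&` X @^-1` [set n]) = P E * P (X @^-1` [set n])) ->
  P (E `&` X @^-1` B) = P E * P (X @^-1` B).
Proof.
move=> mX mE h.
rewrite (total_probability mX (measurableI _ _ mE (mX B))).
rewrite [P (X @^-1` B)](total_probability mX) //.
rewrite -[P E]fineK ?fin_num_measure // -nneseriesZl //.
apply: eq_eseriesr => n _; rewrite fineK ?fin_num_measure //.
have [nB|nB] := pselect (B n).
- have -> : X @^-1` B `&` X @^-1` [set n] = X @^-1` [set n].
    by rewrite -preimage_setI setIidr // => _ ->.
  rewrite -h; congr (P _); rewrite -setIA; congr (_ `&` _).
  by rewrite -preimage_setI setIidr // => _ ->.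
- have e : B `&` [set n] = set0.
    by apply/seteqP; split => // x [] Bx xn; apply: nB; rewrite -xn.
  by rewrite -setIA -preimage_setI e preimage_set0 setI0 measure0 mule0.
Qed.

Lemma ge0_integral_discrete (X : T -> nat) (D : set T) (g : nat -> \bar R) :
  discrete_rv X -> measurable D -> (forall n, 0 <= g n) ->
  \int[P]_(w in D) g (X w) = \sum_(n <oo) g n * P (D `&` X @^-1` [set n]).
Proof.
move=> mX mD g0; rewrite -[in LHS](bigcup_fibers X D) ge0_integral_bigcup //.
- apply: eq_eseriesr => n _.
  rewrite -integral_cst; last by apply: measurableI => //; exact: mX.
  by apply: eq_integral => w; rewrite inE => -[_ /= ->].
- by move=> n; apply: measurableI => //; exact: mX.
- by rewrite bigcup_fibers; exact: measurable_comp_discrete.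
- exact: trivIset_fibers.
Qed.

Lemma expectation_indep (X Y : T -> nat) (g h : nat -> R) :
  discrete_rv X -> discrete_rv Y ->
  (forall n, 0 <= g n)%R -> (forall n, 0 <= h n)%R ->
  (forall m n, P (Y @^-1` [set m] `&` X @^-1` [set n])
     = P (Y @^-1` [set m]) * P (X @^-1` [set n])) ->
  \int[P]_w (g (X w) * h (Y w))%:E = \int[P]_w (g (X w))%:E * \int[P]_w (h (Y w))%:E.
Proof.
move=> mX mY g0 h0 ind.
set c := \int[P]_w (g (X w))%:E.
have c0 : 0 <= c by apply: integral_ge0 => w _; rewrite lee_fin.
rewrite -ge0_integralZl //; last 2 first.
- by apply/measurable_EFinP; exact: measurable_comp_discrete.
- by move=> w _; rewrite lee_fin.
rewrite (@ge0_integral_discrete Y setT (fun n => c * (h n)%:E)) //; last first.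
  by move=> n; rewrite mule_ge0 // lee_fin.
rewrite -[in LHS](bigcup_fibers Y setT) ge0_integral_bigcup //;
  last exact: trivIset_fibers.
- apply: eq_eseriesr => m _; rewrite setTI.
  transitivity (\int[P]_(w in Y @^-1` [set m]) ((h m)%:E * (g (X w))%:E)).
    by apply: eq_integral => w; rewrite inE /= => ->; rewrite EFinM muleC.
  rewrite ge0_integralZl ?lee_fin //; last 2 first.
  - by apply/measurable_EFinP; exact: measurable_comp_discrete.
  - by move=> w _; rewrite lee_fin.
  have gE n : 0 <= (g n)%:E by rewrite lee_fin.
  rewrite [c * _]muleC -muleA; congr (_ * _).
  rewrite (@ge0_integral_discrete X (Y @^-1` [set m]) (EFin \o g) mX (mY _) gE).
  rewrite /c (@ge0_integral_discrete X setT (EFin \o g) mX measurableT gE) muleC.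
  have fY : P (Y @^-1` [set m]) \is a fin_num by rewrite fin_num_measure //; exact: mY.
  rewrite -[P (Y @^-1` _)]fineK //.
  rewrite -nneseriesZl; last by move=> n _; apply: mule_ge0; [exact: gE|exact: measure_ge0].
  apply: eq_eseriesr => n _; rewrite ind setTI fineK //.
  by rewrite muleCA.
- by move=> n; rewrite setTI; exact: mY.
- rewrite bigcup_fibers; apply/measurable_EFinP; apply: measurable_funM.
    exact: measurable_comp_discrete.
  exact: measurable_comp_discrete.
- by move=> w _; rewrite lee_fin mulr_ge0.
Qed.

End discrete.

Section independence.
Context d (T : measurableType d) (R : realType) (P : probability T R).
Context (I : eqType) (Z : I -> T -> nat).
Hypothesis mZ : forall i, discrete_rv (Z i).
Hypothesis indZ : mutually_independent P
  (fun i => [set A | exists B : set nat, A = Z i @^-1` B]).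
Local Open Scope ereal_scope.

Definition labels (J : seq I) (w : T) : seq nat := [seq Z i w | i <- J].
(** Packing finitely many labels into one natural number turns a block of labels into a single
    discrete variable, so that statements about two variables suffice. *)
Definition code (J : seq I) (w : T) : nat := pickle (labels J w).
Definition box (J : seq I) (A : I -> set nat) : set T :=
  \big[setI/setT]_(i <- J) (Z i @^-1` A i).

Lemma boxP J A w : box J A w <-> forall i, i \in J -> A i (Z i w).
Proof.
rewrite /box; elim: J => [|j J IH]; first by rewrite big_nil.
rewrite big_cons; split => [[jw /IH Jw] i|h].
  by rewrite in_cons => /predU1P[->//|/Jw].
split; first by apply: h; exact: mem_head.
by apply/IH => i iJ; apply: h; rewrite in_cons iJ orbT.
Qed.

(** Fixing the code fixes each label of J, so a nonempty fibre is a product event, the form in which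
    mutual independence is stated. *)
Lemma code_fiber (J : seq I) n : uniq J ->
  code J @^-1` [set n] = set0 \/ exists A, code J @^-1` [set n] = box J A.
Proof.
move=> uJ; have [[w wn]|no] := pselect (exists w, code J w = n); last first.
  by left; apply/seteqP; split => // w /= wn; apply: no; exists w.
right; exists (fun i => [set nth 0%N (labels J w) (index i J)]).
apply/seteqP; split => [v /= vn|v /boxP h /=].
  apply/boxP => i iJ /=.
  have -> : labels J w = labels J v.
    by apply: (pcan_inj pickleK); rewrite -!/(code _ _) wn vn.
  by rewrite (nth_map i) ?index_mem // nth_index.
rewrite -wn; congr pickle; apply/eq_in_map => i iJ.
by rewrite (h i iJ) /= (nth_map i) ?index_mem // nth_index.
Qed.

Lemma unpickle_code J w : unpickle (code J w) = Some (labels J w).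
Proof. exact: pickleK. Qed.

Lemma discrete_code (J : seq I) : discrete_rv (code J).
Proof.
move=> B.
have -> : code J @^-1` B = \bigcup_(n in B) code J @^-1` [set n].
  by apply/seteqP; split=> [w Bw|w [n Bn /= wn]]; [exists (code J w)|rewrite /= wn].
apply: bigcup_measurable => n _.
(* The second set is empty or everything: it discards those n that are not the code of the list they
   decode to, including those that do not decode at all. *)
have -> : code J @^-1` [set n] = [set w | labels J w = odflt [::] (unpickle n)] `&`
    [set w | pickle (odflt [::] (unpickle n) : seq nat) = n].
  apply/seteqP; split => [w e|w [wz zn]].
    by have <- : code J w = n := e; split; rewrite /mkset unpickle_code.
  by rewrite /preimage /mkset /code wz.
apply: measurableI; last first.
  have [e|e] := pselect (pickle (odflt [::] (unpickle n) : seq nat) = n).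
    by rewrite (_ : [set _ | _] = setT) //; apply/seteqP; split.
  by rewrite (_ : [set _ | _] = set0) //; apply/seteqP; split.
elim: J (odflt _ _) => [|i J IH] [|v z].
- by rewrite (_ : [set _ | _] = setT) //; apply/seteqP; split.
- by rewrite (_ : [set _ | _] = set0) //; apply/seteqP; split.
- by rewrite (_ : [set _ | _] = set0) //; apply/seteqP; split.
- rewrite (_ : [set _ | _] = Z i @^-1` [set v] `&` [set w | labels J w = z]).
    by apply: measurableI; [exact: mZ|exact: IH].
  by apply/seteqP; split => w /= => [[-> ->]|[-> ->]].
Qed.

Lemma box_indep J1 J2 A1 A2 : uniq (J1 ++ J2) ->
  P (box J1 A1 `&` box J2 A2) = P (box J1 A1) * P (box J2 A2).
Proof.
rewrite cat_uniq => /and3P[u1 /hasPn d12 u2].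
pose A i := if i \in J1 then A1 i else A2 i.
have E1 : box J1 A1 = box J1 A.
  by apply: eq_big_seq => i iJ; rewrite /A iJ.
have E2 : box J2 A2 = box J2 A.
  by apply: eq_big_seq => i /d12 /= /negbTE iJ; rewrite /A iJ.
rewrite E1 E2 /box -big_cat.
have ind J : uniq J -> P (\big[setI/setT]_(i <- J) (Z i @^-1` A i))
   = \prod_(i <- J) P (Z i @^-1` A i).
  by move=> uJ; apply: indZ => // i _; exists (A i).
rewrite !ind // ?big_cat //.
by rewrite cat_uniq u1 u2 andbT; apply/hasPn.
Qed.

Lemma code_indep J1 J2 m n : uniq (J1 ++ J2) ->
  P (code J1 @^-1` [set m] `&` code J2 @^-1` [set n]) =
  P (code J1 @^-1` [set m]) * P (code J2 @^-1` [set n]).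
Proof.
move=> u; have [u1 _ u2] : [/\ uniq J1, true & uniq J2].
  by move: u; rewrite cat_uniq => /and3P[].
have [-> |[A1 ->]] := code_fiber m u1; first by rewrite set0I measure0 mul0e.
have [-> |[A2 ->]] := code_fiber n u2; first by rewrite setI0 measure0 mule0.
exact: box_indep.
Qed.

Lemma code_indep_set J1 J2 B1 B2 : uniq (J1 ++ J2) ->
  P (code J1 @^-1` B1 `&` code J2 @^-1` B2) =
  P (code J1 @^-1` B1) * P (code J2 @^-1` B2).
Proof.
move=> u; apply: indep_fibers; [exact: discrete_code|exact: discrete_code|move=> n].
rewrite setIC muleC; apply: indep_fibers; [exact: discrete_code|exact: discrete_code|].
by move=> m; rewrite setIC muleC; exact: code_indep.
Qed.

Lemma expectation_prod (g : I -> nat -> R) (J : seq I) : uniq J ->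
  (forall i n, 0 <= g i n)%R ->
  \int[P]_w (\prod_(i <- J) g i (Z i w))%R%:E = \prod_(i <- J) \int[P]_w (g i (Z i w))%:E.
Proof.
move=> + g0; elim: J => [_|i J IH /= /andP[iJ uJ]].
  rewrite big_nil; under eq_integral do rewrite big_nil.
  by rewrite integral_cst // mul1e; exact: probability_setT.
rewrite big_cons -IH //; under eq_integral do rewrite big_cons.
(* The product over the tail is rewritten as a function of the code of the tail, which reduces the
   induction to the case of two variables. *)
pose h n : R := if unpickle n is Some z then
  (\prod_(j <- J) g j (nth 0%N z (index j J)))%R else 0%R.
have hE w : (\prod_(j <- J) g j (Z j w))%R = h (code J w).
  rewrite /h unpickle_code; apply: eq_big_seq => j jJ.
  by rewrite (nth_map j) ?index_mem // nth_index.
under eq_integral do rewrite hE.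
rewrite (@expectation_indep _ _ _ P (Z i) (code J)) //.
- by congr (_ * _); apply: eq_integral => w _; rewrite hE.
- exact: discrete_code.
- move=> n; rewrite /h; case: unpickle => // z; exact: prodr_ge0.
- move=> m n; have -> : Z i @^-1` [set n] = code [:: i] @^-1` [set pickle [:: n]].
    apply/seteqP; split => w /=; first by move=> <-.
    by move/(pcan_inj pickleK) => [].
  by apply: code_indep; rewrite uniq_catC /= iJ.
Qed.

(** Replaces membership in the sigma-algebra generated by the labels in D. For finite D such events
    are automatically measurable, being preimages under a code. *)
Definition determined (D : I -> Prop) (E : set T) :=
  forall w w', (forall i, D i -> Z i w = Z i w') -> E w -> E w'.

Lemma determined_code D E (J : seq I) : determined D E -> (forall i, D i -> i \in J) ->
  exists B, E = code J @^-1` B.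
Proof.
move=> dE DJ; exists [set n | exists2 w, E w & code J w = n].
apply/seteqP; split => [w Ew|w' [w Ew]]; first by exists w.
move=> /(pcan_inj pickleK) /eq_in_map ww'; apply: dE Ew => i /DJ; exact: ww'.
Qed.

Lemma determined_measurable D E (J : seq I) : determined D E ->
  (forall i, D i -> i \in J) -> measurable E.
Proof. by move=> dE /(determined_code dE) [B ->]; exact: discrete_code. Qed.

Lemma determined_indep D1 D2 E1 E2 (J : seq I) :
  determined D1 E1 -> determined D2 E2 ->
  (forall i, D1 i -> i \in J) -> (forall i, D2 i -> i \in J) ->
  (forall i, D1 i -> ~ D2 i) -> P (E1 `&` E2) = P E1 * P E2.
Proof.
move=> d1 d2 D1J D2J D12; pose J1 := [seq i <- undup J | `[< D1 i >]].
pose J2 := [seq i <- undup J | `[< D2 i >]].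
have [B1 ->] : exists B, E1 = code J1 @^-1` B.
  apply: determined_code d1 _ => i Di; rewrite mem_filter mem_undup D1J //.
  by rewrite andbT; apply/asboolP.
have [B2 ->] : exists B, E2 = code J2 @^-1` B.
  apply: determined_code d2 _ => i Di; rewrite mem_filter mem_undup D2J //.
  by rewrite andbT; apply/asboolP.
apply: code_indep_set; rewrite cat_uniq !filter_uniq ?undup_uniq // andbT /=.
apply/hasPn => i; rewrite !mem_filter => /andP[/asboolP D2i _].
by apply/negP => /andP[/asboolP /D12].
Qed.

Lemma determinedI D E1 E2 : determined D E1 -> determined D E2 ->
  determined D (E1 `&` E2).
Proof. by move=> d1 d2 w w' ww' [/(d1 _ _ ww') ? /(d2 _ _ ww')]. Qed.

Lemma determinedC D E : determined D E -> determined D (~` E).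
Proof.
move=> dE w w' ww' nE Ew'; apply: nE; apply: dE Ew' => i Di.
by rewrite ww'.
Qed.

Lemma determined_sub (D D' : I -> Prop) E : (forall i, D i -> D' i) ->
  determined D E -> determined D' E.
Proof. by move=> DD' dE w w' ww'; apply: dE => i /DD'; exact: ww'. Qed.

End independence.

(** * Exponential moments *)

Section exponential.
Variable R : realType.

(** From exp(-x) >= 1 - x one gets exp(x) <= 1 / (1 - x), and the quadratic dominates this for x <=
    1/2. *)
Lemma expR_le_quadratic (x : R) : x <= 1 / 2 -> expR x <= 1 + x + 2 * x ^+ 2.
Proof.
move=> x2; have x1 : 0 < 1 - x by lra.
have : expR x <= (1 - x)^-1.
  rewrite -[expR x]opprK -[x in expR x]opprK expRN opprK lef_pV2 ?posrE ?expR_gt0 //.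
  exact: expR_ge1Dx.
move/le_trans; apply; rewrite -[leLHS]mul1r ler_pdivrMr //.
have -> : (1 + x + 2 * x ^+ 2) * (1 - x) = 1 + x ^+ 2 * (1 - 2 * x) by ring.
by rewrite lerDl mulr_ge0 ?sqr_ge0 //; lra.
Qed.

(** The linear term disappears on taking means of a centred function, which leaves a Gaussian bound
    for every value of the parameter. For x > 1/2 already x <= 2 x^2. *)
Lemma expR_le_gauss (x : R) : expR x <= x + expR (2 * x ^+ 2).
Proof.
have [x2|x2] := leP x (1 / 2).
  apply: (le_trans (expR_le_quadratic x2)).
  by have := expR_ge1Dx (2 * x ^+ 2); lra.
have : expR x <= expR (2 * x ^+ 2) by rewrite ler_expR expr2 mulrA ler_peMl //; lra.
lra.
Qed.

Lemma expR_ge_quadratic (x : R) : -1 <= x -> 1 + x + x ^+ 2 / 4 <= expR x.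
Proof.
move=> x1; have h := expR_ge1Dx (x / 2).
have -> : 1 + x + x ^+ 2 / 4 = (1 + x / 2) ^+ 2 by field.
have -> : expR x = expR (x / 2) ^+ 2 by rewrite expr2 -expRD; congr expR; field.
by rewrite ler_pXn2r ?nnegrE ?expR_ge0 //; lra.
Qed.

Lemma expR_half_le (y : R) : 0 <= y <= 1 -> expR (y / 2) <= 1 + y.
Proof.
move=> /andP[y0 y1]; apply: le_trans (@expR_le_quadratic (y / 2) _) _; first lra.
have : y ^+ 2 <= y by rewrite expr2 ler_piMl.
lra.
Qed.

End exponential.

(** * Means and moment generating functions under a probability vector *)

Section mean.
Variables (R : realType) (p : nat -> R).
Hypothesis pp : prob_vector p.
Implicit Types f g : nat -> R.

Definition mean f : R := rsum (fun i => p i * f i).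

Definition unif_bounded f := exists K : R, forall i, `|f i| <= K.

Lemma mean_cvg f : unif_bounded f -> cvgn (series (fun i => p i * f i)).
Proof.
case: pp => _ [p0 p1] [K fK]; apply: normed_cvg.
have K0 : 0 <= K by apply: le_trans (fK 0%N).
apply: (@series_le_cvg _ _ (fun i => K * p i)).
- by move=> n; exact: normr_ge0.
- by move=> n; rewrite mulr_ge0.
- by move=> n; rewrite /= normrM (ger0_norm (p0 n)) mulrC ler_wpM2r.
- by apply: is_cvg_seriesZ; apply/cvg_ex; exists 1.
Qed.

Lemma meanD f g : unif_bounded f -> unif_bounded g ->
  mean (fun i => f i + g i) = mean f + mean g.
Proof.
move=> bf bg; rewrite /mean /rsum.
have -> : series (fun i => p i * (f i + g i)) =
    series (fun i => p i * f i) \+ series (fun i => p i * g i).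
  apply/funext => n; rewrite /series /= -big_split /=.
  by apply: eq_bigr => i _; rewrite mulrDr.
exact: limD (mean_cvg bf) (mean_cvg bg).
Qed.

Lemma meanZ c f : unif_bounded f -> mean (fun i => c * f i) = c * mean f.
Proof.
move=> bf; rewrite /mean /rsum.
have -> : series (fun i => p i * (c * f i)) = c *: series (fun i => p i * f i).
  apply/funext => n; rewrite -[RHS]/(c * series (fun i => p i * f i) n).
  rewrite /series /= mulr_sumr.
  by apply: eq_bigr => i _; rewrite mulrCA.
exact: limZr (mean_cvg bf).
Qed.

Lemma mean_cst c : mean (fun=> c) = c.
Proof.
case: pp => _ [_ p1].
rewrite /mean /rsum; apply: cvg_lim => //.
rewrite [X in X @ _ --> _](_ : _ = fun n => series p n * c).
  by rewrite -[X in _ --> X](mul1r c); apply: cvgMl.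
by apply/funext => n; rewrite /series /= mulr_suml.
Qed.

Lemma mean_le f g : unif_bounded f -> unif_bounded g -> (forall i, f i <= g i) ->
  mean f <= mean g.
Proof.
case: pp => _ [p0 _] bf bg fg; rewrite /mean /rsum; apply: ler_lim; [exact: mean_cvg|exact: mean_cvg|].
by apply: nearW => n; apply: ler_sum => i _; rewrite ler_wpM2l.
Qed.

Lemma unif_bounded_cst c : unif_bounded (fun=> c).
Proof. by exists `|c|. Qed.

Lemma unif_boundedD f g : unif_bounded f -> unif_bounded g -> unif_bounded (fun i => f i + g i).
Proof.
move=> [K fK] [L gL]; exists (K + L) => i.
by rewrite (le_trans (ler_normD _ _)) // lerD.
Qed.

Lemma unif_boundedZ c f : unif_bounded f -> unif_bounded (fun i => c * f i).
Proof. by move=> [K fK]; exists (`|c| * K) => i; rewrite normrM ler_wpM2l. Qed.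

Lemma unif_bounded_expR f : unif_bounded f -> unif_bounded (fun i => expR (f i)).
Proof.
move=> [K fK]; exists (expR K) => i; rewrite ger0_norm ?expR_ge0 // ler_expR.
by rewrite (le_trans (ler_norm _)).
Qed.

Lemma unif_bounded_sqr f : unif_bounded f -> unif_bounded (fun i => f i ^+ 2).
Proof.
move=> [K fK]; exists (K ^+ 2) => i; rewrite normrX.
by rewrite lerXn2r ?nnegrE // (le_trans (normr_ge0 _) (fK i)).
Qed.

Lemma mean_ge0 f : unif_bounded f -> (forall i, 0 <= f i) -> 0 <= mean f.
Proof.
by move=> bf f0; rewrite -(mean_cst 0); apply: mean_le => //; exact: unif_bounded_cst.
Qed.

Section mgf.
Variables (f : nat -> R).
Hypotheses (f2 : forall i, `|f i| <= 2) (mf : mean f = 0).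

Let bf : unif_bounded f. Proof. by exists 2. Qed.

Lemma mgf_le (lam : R) : mean (fun i => expR (lam * f i)) <= expR (8 * lam ^+ 2).
Proof.
have -> : expR (8 * lam ^+ 2) = mean (fun i => lam * f i + expR (8 * lam ^+ 2)).
  by rewrite meanD ?meanZ ?mean_cst ?mf ?mulr0 ?add0r //; [exact: unif_boundedZ|exact: unif_bounded_cst].
apply: mean_le => [||i].
- exact/unif_bounded_expR/unif_boundedZ.
- by apply: unif_boundedD; [exact: unif_boundedZ|exact: unif_bounded_cst].
apply: (le_trans (expR_le_gauss _)); rewrite lerD2l ler_expR exprMn.
have : f i ^+ 2 <= 2 ^+ 2 by rewrite -[leLHS]real_normK ?num_real // lerXn2r ?nnegrE.
have : 0 <= lam ^+ 2 by exact: sqr_ge0.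
by set a := lam ^+ 2; set b := f i ^+ 2; nra.
Qed.

(** The pointwise quadratic minorant of exp has mean 1 + lam^2 v / 4, and lam^2 v / 4 <= 1 lets
    [expR_half_le] turn this back into an exponential. *)
Lemma mgf_ge (lam : R) : `|lam| <= 1 / 2 ->
  expR (lam ^+ 2 * mean (fun i => f i ^+ 2) / 8) <= mean (fun i => expR (lam * f i)).
Proof.
move=> l2; set v := mean _.
have lf i : `|lam * f i| <= 1.
  by rewrite normrM (_ : 1 = 1 / 2 * 2 :> R); [exact: ler_pM|field].
have v4 : 0 <= v <= 4.
  apply/andP; split.
    by apply: mean_ge0 => [|i]; [exact: unif_bounded_sqr|exact: sqr_ge0].
  rewrite -(mean_cst 4); apply: mean_le => [||i].
  - exact: unif_bounded_sqr.
  - exact: unif_bounded_cst.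
  rewrite -[leLHS]real_normK ?num_real // (_ : 4 = 2 ^+ 2 :> R); last by ring.
  by rewrite lerXn2r ?nnegrE.
have l4 : lam ^+ 2 <= 1 / 4.
  rewrite -[leLHS]real_normK ?num_real // (_ : 1 / 4 = (1 / 2) ^+ 2 :> R).
    by rewrite lerXn2r ?nnegrE // divr_ge0.
  by field.
have l0 : 0 <= lam ^+ 2 by exact: sqr_ge0.
apply: (@le_trans _ _ (1 + lam ^+ 2 * v / 4)).
  rewrite (_ : lam ^+ 2 * v / 8 = (lam ^+ 2 * v / 4) / 2); last by field.
  apply: expR_half_le; move: v4 l4 l0; set a := lam ^+ 2; nra.
have -> : 1 + lam ^+ 2 * v / 4
    = mean (fun i => (1 + lam * f i) + lam ^+ 2 / 4 * f i ^+ 2).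
  rewrite !meanD ?meanZ ?mean_cst ?mf -/v //; first (by field);
    rewrite ?mulr0; try exact: unif_bounded_cst; try exact: unif_bounded_sqr.
  - exact: unif_boundedZ.
  - by apply: unif_boundedD; [exact: unif_bounded_cst|exact: unif_boundedZ].
  - by apply: unif_boundedZ; exact: unif_bounded_sqr.
apply: mean_le => [||i].
- apply: unif_boundedD; last by apply: unif_boundedZ; exact: unif_bounded_sqr.
  by apply: unif_boundedD; [exact: unif_bounded_cst|exact: unif_boundedZ].
- exact/unif_bounded_expR/unif_boundedZ.
have := @expR_ge_quadratic _ (lam * f i); have := lf i.
by rewrite ler_norml exprMn => /andP[+ _] => h1 /(_ h1); lra.
Qed.

End mgf.
End mean.

(** * Hoeffding and Paley-Zygmund bounds for sums over windows *)

Section moment_inequalities.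
Context d (T : measurableType d) (R : realType) (P : probability T R).
Variable V : T -> R.
Hypotheses (mV : measurable_fun setT V) (V0 : forall w, 0 <= V w).
Local Open Scope ereal_scope.

Lemma measurable_superlevel (a : R) : measurable [set w | (a <= V w)%R].
Proof.
rewrite (_ : [set _ | _] = V @^-1` `[a, +oo[%classic).
  by rewrite -[X in measurable X]setTI; exact: mV.
by apply/seteqP; split => w /=; rewrite in_itv /= andbT.
Qed.

Lemma markov_superlevel (a : R) : (0 <= a)%R ->
  a%:E * P [set w | (a <= V w)%R] <= \int[P]_w (V w)%:E.
Proof.
move=> a0; have mA := measurable_superlevel a.
rewrite -integral_cst //.
apply: (@le_trans _ _ (\int[P]_(w in [set w | (a <= V w)%R]) (V w)%:E)).
  apply: ge0_le_integral => //.
  by apply: measurable_funTS; exact/measurable_EFinP.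
apply: ge0_subset_integral => //; first exact/measurable_EFinP.
by move=> w _; rewrite lee_fin.
Qed.

(** Instead of the Cauchy-Schwarz inequality, the pointwise bound V <= m/2 + V^2 / (2 k) + (k/2) 1_A
    is integrated: off A the first term suffices, on A it is the inequality of arithmetic and
    geometric means. *)
Lemma paley_zygmund (m m2 : R) : (0 < m)%R -> (0 < m2)%R ->
  \int[P]_w (V w)%:E = m%:E -> \int[P]_w (V w ^+ 2)%:E = m2%:E ->
  (m ^+ 2 / (4 * m2))%:E <= P [set w | (m / 2 <= V w)%R].
Proof.
move=> m0 m20 Em Em2; set A := [set w | _].
have mA : measurable A := measurable_superlevel (m / 2).
have mV2 : measurable_fun setT (fun w => V w ^+ 2)%R by exact: measurable_funX.
(* This choice makes the mean of V^2 / (2 k) equal to m / 4, leaving m / 4 for the event. *)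
pose k := (2 * m2 / m)%R; have k0 : (0 < k)%R by rewrite divr_gt0 ?mulr_gt0.
have bound : m%:E <= \int[P]_w ((m / 2 + (2 * k)^-1 * V w ^+ 2 + k / 2 * \1_A w)%R)%:E.
  rewrite -Em; apply: ge0_le_integral => //.
  - by move=> w _; rewrite lee_fin.
  - exact/measurable_EFinP.
  - apply/measurable_EFinP; apply: measurable_funD; last first.
      by apply: measurable_funM => //; exact: measurable_indic.
    by apply: measurable_funD => //; apply: measurable_funM.
  - move=> w _; rewrite lee_fin indicE; have := V0 w => v0.
    have [wA|wA] := pselect (A w).
      rewrite mem_set //= mulr1.
      have h := sqr_ge0 (V w - k).
      have -> : ((2 * k)^-1 * V w ^+ 2 = (V w - k) ^+ 2 / (2 * k) + V w - k / 2)%R.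
        by field; rewrite gt_eqF.
      have : (0 <= (V w - k) ^+ 2 / (2 * k))%R by rewrite divr_ge0 ?sqr_ge0 // mulr_ge0 // ltW.
      by lra.
    rewrite memNset //= mulr0 addr0.
    have : (0 <= (2 * k)^-1 * V w ^+ 2)%R by rewrite mulr_ge0 ?sqr_ge0 // invr_ge0 mulr_ge0 // ltW.
    have : (V w < m / 2)%R by rewrite ltNge; apply/negP.
    by lra.
have e : \int[P]_w ((m / 2 + (2 * k)^-1 * V w ^+ 2 + k / 2 * \1_A w)%R)%:E
    = ((m / 2 + (2 * k)^-1 * m2)%R)%:E + (k / 2)%:E * P A.
  have m20' : (0 <= m / 2)%R by rewrite divr_ge0 // ltW.
  have k2 : (0 <= (2 * k)^-1)%R by rewrite invr_ge0 mulr_ge0 // ltW.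
  have kh : (0 <= k / 2)%R by rewrite divr_ge0 // ltW.
  transitivity (\int[P]_w ((m / 2)%:E + (2 * k)^-1%:E * (V w ^+ 2)%:E
      + (k / 2)%:E * (\1_A w)%:E)); first exact: eq_integral.
  have mf1 : measurable_fun setT (fun w => (2 * k)^-1%:E * (V w ^+ 2)%:E).
    by apply: measurable_funeM; exact/measurable_EFinP.
  have mf2 : measurable_fun setT (fun w => (k / 2)%:E * (\1_A w)%:E).
    by apply: measurable_funeM; apply/measurable_EFinP; exact: measurable_indic.
  have f10 w : 0 <= (2 * k)^-1%:E * (V w ^+ 2)%:E by rewrite mule_ge0 ?lee_fin ?sqr_ge0.
  have f20 w : 0 <= (k / 2)%:E * (\1_A w)%:E by rewrite mule_ge0 ?lee_fin.
  rewrite ge0_integralD //.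
  - rewrite ge0_integralD // integral_cst // EFinD -addeA.
    have -> : (m / 2)%:E * P setT = (m / 2)%:E.
      by rewrite [X in _ * X](@probability_setT _ _ _ P) mule1.
    rewrite addeA; congr (_ + _ + _).
      rewrite ge0_integralZl ?lee_fin //.
      + by rewrite Em2.
      + exact/measurable_EFinP.
      + by move=> w _; rewrite lee_fin sqr_ge0.
    rewrite ge0_integralZl ?lee_fin //.
    + by rewrite integral_indic // setIT.
    + by apply/measurable_EFinP; exact: measurable_indic.
  - by move=> w _; apply: adde_ge0; [rewrite lee_fin|exact: f10].
  - by apply: emeasurable_funD.
move: bound; rewrite {}e -[P A]fineK ?fin_num_measure //; set pA := fine _.
rewrite -EFinM -EFinD !lee_fin.
have -> : ((2 * k)^-1 * m2 = m / 4)%R by rewrite /k; field; rewrite !gt_eqF.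
have -> : (k / 2 = m2 / m)%R by rewrite /k; field; rewrite !gt_eqF.
move=> h; have h1 : (m / 4 <= m2 / m * pA)%R by lra.
rewrite ler_pdivrMr ?mulr_gt0 //.
have := ler_wpM2l (ltW m0) h1.
have -> : (m * (m2 / m * pA) = m2 * pA)%R by field; rewrite gt_eqF.
by lra.
Qed.

End moment_inequalities.

(** * Tail bounds for sums over windows of one label sequence, embedded in the family by [h] *)

Section windows.
Context d (T : measurableType d) (R : realType) (P : probability T R).
Context (I : eqType) (Z : I -> T -> nat).
Hypothesis mZ : forall i, discrete_rv (Z i).
Hypothesis indZ : mutually_independent P
  (fun i => [set A | exists B : set nat, A = Z i @^-1` B]).
Variables (h : nat -> I) (p : nat -> R).
Hypotheses (hI : injective h) (pp : prob_vector p).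
Hypothesis law : forall j n, P (Z (h j) @^-1` [set n]) = (p n)%:E.

Lemma expectation_label (g : nat -> R) j : (forall n, 0 <= g n) -> unif_bounded g ->
  (\int[P]_w (g (Z (h j) w))%:E)%E = (mean p g)%:E.
Proof.
move=> g0 bg.
rewrite (@ge0_integral_discrete _ _ _ P (Z (h j)) setT (EFin \o g)) //.
rewrite -[RHS](EFin_lim (mean_cvg pp bg)).
congr (limn _); apply/funext => n /=; rewrite /series /= -sumEFin.
by apply: eq_bigr => i _; rewrite setTI law /= -EFinM mulrC.
Qed.

Definition window_sum (f : nat -> R) a l (w : T) : R :=
  \sum_(j <- iota a l) f (Z (h j) w).

Lemma measurable_determined (V : T -> R) (J : seq I) :
  (forall w w', (forall i, i \in J -> Z i w = Z i w') -> V w = V w') ->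
  measurable_fun setT V.
Proof.
move=> dV _ B mB; rewrite setTI.
apply: (@determined_measurable _ _ _ Z mZ (fun i => i \in J) _ J) => //.
by move=> w w' /dV /= ->.
Qed.

Lemma window_sum_determined f a l w w' :
  (forall i, i \in map h (iota a l) -> Z i w = Z i w') ->
  window_sum f a l w = window_sum f a l w'.
Proof. by move=> e; apply: eq_big_seq => j jJ; rewrite e // map_f. Qed.

Lemma mgf_window (f : nat -> R) a l lam : unif_bounded f ->
  (\int[P]_w (expR (lam * window_sum f a l w))%:E)%E
    = (mean p (fun i => expR (lam * f i)) ^+ l)%:E.
Proof.
move=> bf; under eq_integral do rewrite mulr_sumr expR_sum.
transitivity (\int[P]_w (\prod_(i <- map h (iota a l)) expR (lam * f (Z i w)))%:E)%E.
  by apply: eq_integral => w _; rewrite big_map.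
have uJ : uniq (map h (iota a l)) by rewrite map_inj_uniq // iota_uniq.
rewrite (@expectation_prod _ _ _ P I Z mZ indZ (fun i n => expR (lam * f n)) _ uJ
  (fun i n => expR_ge0 _)).
rewrite big_map (eq_bigr (fun=> (mean p (fun i => expR (lam * f i)))%:E)); last first.
  move=> j _; apply: (@expectation_label (fun n => expR (lam * f n))).
    by move=> n; exact: expR_ge0.
  by apply: unif_bounded_expR; exact: unif_boundedZ.
rewrite prodEFin big_const_seq count_predT size_iota; congr EFin.
by rewrite iter_mulr_1.
Qed.

Lemma window_sumN f a l w : window_sum (fun i => - f i) a l w = - window_sum f a l w.
Proof. by rewrite /window_sum sumrN. Qed.

Lemma measurable_window_fun (phi : R -> R) f a l :
  measurable_fun setT (fun w => phi (window_sum f a l w)).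
Proof.
apply: (@measurable_determined _ (map h (iota a l))) => w w' ww'.
by rewrite (window_sum_determined f ww').
Qed.

Section centered.
Variable f : nat -> R.
Hypotheses (f2 : forall i, `|f i| <= 2) (mf : mean p f = 0).

Let bf : unif_bounded f. Proof. by exists 2. Qed.

Lemma mgf_window_le a l lam :
  (\int[P]_w (expR (lam * window_sum f a l w))%:E <= (expR (8 * lam ^+ 2 * l%:R))%:E)%E.
Proof.
rewrite mgf_window // lee_fin expRM_natr.
rewrite lerXn2r ?nnegrE ?expR_ge0 ?mgf_le //.
by apply: mean_ge0 => //; apply: unif_bounded_expR; exact: unif_boundedZ.
Qed.

Lemma hoeffding_upper a l (t D : R) : 0 <= t -> 0 < D -> l%:R <= D ->
  (P [set w | (t <= window_sum f a l w)%R] <= (expR (- (t ^+ 2 / (32 * D))))%:E)%E.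
Proof.
move=> t0 D0 lD; have [->|tn0] := eqVneq t 0.
  rewrite expr0n /= mul0r oppr0 expR0; apply: probability_le1.
  have := measurable_superlevel (measurable_window_fun id f a l) 0.
  exact.
have tp : 0 < t by rewrite lt_neqAle eq_sym tn0.
(* The minimizer of 8 lam^2 D - lam t. *)
pose lam := t / (16 * D); have lam0 : 0 < lam by rewrite divr_gt0 ?mulr_gt0.
pose V w := expR (lam * window_sum f a l w).
have mV : measurable_fun setT V by exact: (measurable_window_fun (fun u => expR (lam * u))).
have -> : [set w | t <= window_sum f a l w] = [set w | expR (lam * t) <= V w].
  by apply/seteqP; split => w /=; rewrite ler_expR ler_pM2l.
have := markov_superlevel P mV (fun w => expR_ge0 _) (expR_ge0 (lam * t)).
move/le_trans => /(_ _ (mgf_window_le a l lam)).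
have mA := measurable_superlevel mV (expR (lam * t)).
rewrite -[P _]fineK ?fin_num_measure // -EFinM !lee_fin => le1.
rewrite -(@ler_pM2l _ (expR (lam * t))) ?expR_gt0 //; apply: (le_trans le1).
rewrite -expRD ler_expR.
apply: (@le_trans _ _ (8 * lam ^+ 2 * D)).
  by rewrite ler_wpM2l // mulr_ge0 ?sqr_ge0.
suff -> : 8 * lam ^+ 2 * D = lam * t - t ^+ 2 / (32 * D) by [].
rewrite /lam; field.
by rewrite gt_eqF.
Qed.

End centered.

Lemma hoeffding f a l (t D : R) : (forall i, `|f i| <= 2) -> mean p f = 0 ->
  0 <= t -> 0 < D -> l%:R <= D ->
  (P [set w | (t < window_sum f a l w ^+ 2)%R] <= (2 * expR (- (t / (32 * D))))%:E)%E.
Proof.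
move=> f2 mf t0 D0 lD; set u := Num.sqrt t.
have u0 : 0 <= u by rewrite sqrtr_ge0.
have u2 : u ^+ 2 = t by rewrite sqr_sqrtr.
have f2' i : `|- f i| <= 2 by rewrite normrN.
have mf' : mean p (fun i => - f i) = 0.
  have := meanZ pp (-1) (ex_intro _ 2 f2 : unif_bounded f); rewrite mf mulr0 => <-.
  by congr mean; apply/funext => i; rewrite mulN1r.
pose A1 := [set w | u <= window_sum f a l w].
pose A2 := [set w | u <= window_sum (fun i => - f i) a l w].
have mA1 : measurable A1 := measurable_superlevel (measurable_window_fun id f a l) u.
have mA2 : measurable A2.
  exact: measurable_superlevel (measurable_window_fun id (fun i => - f i) a l) u.
apply: (@le_trans _ _ (P (A1 `|` A2))).
  apply: le_measure; rewrite ?inE.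
  - rewrite (_ : [set _ | _] = ~` [set w | - t <= - window_sum f a l w ^+ 2]).
      apply: measurableC.
      exact: (measurable_superlevel (measurable_window_fun (fun s => - s ^+ 2) f a l)).
    by apply/seteqP; split => w /=; rewrite lerN2 ltNge => /negP.
  - exact: measurableU.
  - move=> w /= tw; rewrite /A1 /A2 /= window_sumN.
    have : u <= `|window_sum f a l w|.
      rewrite leNgt; apply/negP => wu; move: tw; apply/negP; rewrite -leNgt -u2.
      by rewrite -real_normK ?num_real // lerXn2r ?nnegrE // ltW.
    by rewrite ler_normr => /orP[]; [left|right].
rewrite mulr2n mulrDl mul1r EFinD.
apply: (le_trans (measureU2 _ mA1 mA2)).
by rewrite -u2; apply: leeD; exact: hoeffding_upper.
Qed.

(** Substitute for the central limit theorem: Paley-Zygmund is applied to exp(lam S) with lam = 4 /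
    sqrt(v l), whose mean is at least e^2 and whose second moment is bounded independently of l. On
    the resulting event exp(lam S) >= e, so S >= sqrt(v l) / 4. The exponential, unlike S^2, retains
    the sign of S. *)
Lemma window_lower f : (forall i, `|f i| <= 2) -> mean p f = 0 ->
  0 < mean p (fun i => f i ^+ 2) ->
  exists th q : R, [/\ 0 < th, 0 < q & exists l0, forall a l, (l0 <= l)%N ->
    (q%:E <= P [set w | (th * Num.sqrt l%:R <= window_sum f a l w)%R])%E].
Proof.
move=> f2 mf v0; set v := mean _ _ in v0.
have bf : unif_bounded f by exists 2.
have sv0 : 0 < Num.sqrt v by rewrite sqrtr_gt0.
exists (Num.sqrt v / 4), (expR (- (32 * 16 / v)) / 4); split.
- by rewrite divr_gt0.
- by rewrite divr_gt0 // expR_gt0.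
have [l0 _ hl0] := nbhs_infty_ger (64 / v + 1).
exists l0 => a l /hl0 /= lb.
have v64 : 0 < 64 / v by rewrite divr_gt0.
have l1 : 0 < l%:R :> R by lra.
have sl0 : 0 < Num.sqrt l%:R :> R by rewrite sqrtr_gt0.
pose lam : R := 4 / (Num.sqrt v * Num.sqrt l%:R).
have lam0 : 0 < lam by rewrite divr_gt0 ?mulr_gt0.
have lam2 : lam ^+ 2 = 16 / (v * l%:R).
  rewrite expr_div_n exprMn !sqr_sqrtr ?ltW //; congr (_ / _); ring.
have lamh : `|lam| <= 1 / 2.
  rewrite gtr0_norm // -(@ler_pXn2r _ 2) ?nnegrE ?divr_ge0 ?(ltW lam0) // lam2.
  rewrite ler_pdivrMr ?mulr_gt0 //.
  have : 64 / v * v <= l%:R * v by rewrite ler_wpM2r ?ltW //; lra.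
  by rewrite divfK ?gt_eqF //; lra.
pose V w := expR (lam * window_sum f a l w).
have mV : measurable_fun setT V by exact: (measurable_window_fun (fun u => expR (lam * u))).
set M := mean p (fun i => expR (lam * f i)) ^+ l.
set M2 := mean p (fun i => expR ((2 * lam) * f i)) ^+ l.
have EV : (\int[P]_w (V w)%:E = M%:E)%E by exact: mgf_window.
have EV2 : (\int[P]_w (V w ^+ 2)%:E = M2%:E)%E.
  rewrite -(mgf_window a l (2 * lam) bf); apply: eq_integral => w _; congr EFin.
  by rewrite /V expr2 -expRD; congr expR; ring.
have Mlb : expR 2 <= M.
  have -> : 2 = l%:R * (lam ^+ 2 * v / 8) :> R.
    by rewrite lam2; field; rewrite !gt_eqF.
  rewrite expRM_natl lerXn2r ?nnegrE ?expR_ge0 ?mgf_ge //.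
  by apply: le_trans (mgf_ge _ _ _ _) => //; exact: expR_ge0.
have M2ub : M2 <= expR (32 * 16 / v).
  have := mgf_window_le f2 mf a l (2 * lam); rewrite mgf_window // lee_fin -/M2.
  move/le_trans; apply; rewrite ler_expR.
  suff -> : 8 * (2 * lam) ^+ 2 * l%:R = 32 * 16 / v by [].
  by rewrite exprMn lam2; field; rewrite !gt_eqF.
have e2 : 3 <= expR 2 :> R by have := @expR_ge1Dx R 2; lra.
have M0 : 0 < M by lra.
have M20 : 0 < M2.
  apply: exprn_gt0; apply: (@lt_le_trans _ _ (mean p (fun i => expR (-4 * lam)))).
    by rewrite mean_cst // expR_gt0.
  apply: (mean_le pp) => [||i].
  - exact: unif_bounded_cst.
  - by apply: unif_bounded_expR; exact: unif_boundedZ.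
  - rewrite ler_expR mulrAC -subr_ge0.
    have := f2 i; rewrite ler_norml => /andP[h1 h2].
    have -> : 2 * f i * lam - -4 * lam = 2 * lam * (f i + 2) by ring.
    by rewrite mulr_ge0 ?mulr_ge0 ?(ltW lam0) //; lra.
have := @paley_zygmund _ _ _ P V mV (fun w => expR_ge0 _) M M2 M0 M20 EV EV2.
move=> pz; apply: (@le_trans _ _ (M ^+ 2 / (4 * M2))%:E).
  rewrite lee_fin expRN ler_pdivlMr ?mulr_gt0 //.
  have -> : (expR (32 * 16 / v))^-1 / 4 * (4 * M2) = M2 / expR (32 * 16 / v).
    by field; rewrite gt_eqF // expR_gt0.
  apply: (@le_trans _ _ 1); first by rewrite ler_pdivrMr ?expR_gt0 // mul1r.
  by rewrite exprn_ege1 //; lra.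
apply: (le_trans pz); apply: le_measure; rewrite ?inE.
- exact: measurable_superlevel.
- exact: (measurable_superlevel (measurable_window_fun id f a l)).
move=> w /=; rewrite /V => hV.
have e1 : expR 1 <= M / 2.
  have eE : expR 2 = expR 1 * expR 1 :> R by rewrite -expRD.
  have : 2 <= expR 1 :> R by have := @expR_ge1Dx R 1; lra.
  have := expR_gt0 (1 : R); nra.
have : 1 <= lam * window_sum f a l w by rewrite -ler_expR (le_trans e1).
rewrite /lam mulrAC ler_pdivlMr ?mulr_gt0 // mul1r.
lra.
Qed.

End windows.

(** * Almost sure regularity *)

Section borel_cantelli.
Context d (T : measurableType d) (R : realType) (P : probability T R).
Local Open Scope ereal_scope.

Lemma ae_eventually_not (E : nat -> set T) (K : R) : (forall n, measurable (E n)) ->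
  (forall n, P (E n) <= (K / n.+1%:R ^+ 2)%:E) ->
  {ae P, forall w, \forall n \near \oo, ~ E n w}.
Proof.
move=> mE PE; exists (lim_sup_set E); split.
- by apply: bigcap_measurable => // k _; apply: bigcup_measurable.
- apply: lim_sup_set_cvg0 => //.
  apply: (@le_lt_trans _ _ (2 * K)%:E); last exact: ltry.
  apply: lime_le; first by apply: is_cvg_nneseries.
  apply: nearW => n.
  have K0 : (0 <= K)%R.
    have := le_trans (measure_ge0 P (E 0%N)) (PE 0%N); rewrite lee_fin expr1n divr1.
    by [].
  (* A telescoping majorant of the sum of 1 / (i + 1)^2. *)
  suff : \sum_(0 <= i < n) P (E i) <= (2 * K * (1 - n.+1%:R^-1))%:E.
    move/le_trans; apply; rewrite lee_fin.
    by apply: ler_piMr; [exact: mulr_ge0|rewrite gerBl invr_ge0].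
  elim: n => [|n IH]; first by rewrite big_nil invr1 subrr mulr0.
  rewrite big_nat_recr //=; apply: (le_trans (leeD IH (PE n))).
  rewrite -EFinD lee_fin -natr1 -[n.+2%:R]natr1.
  set a : R := n.+1%:R; have a1 : (1 <= a)%R by rewrite ler1n.
  have -> : (2 * K * (1 - a^-1) + K / a ^+ 2 =
    2 * K * (1 - (a + 1)^-1) - K * (a - 1) / (a ^+ 2 * (a + 1)))%R.
    by field; rewrite !gt_eqF //; lra.
  rewrite gerBl divr_ge0 ?mulr_ge0 ?sqr_ge0 //; lra.
- move=> w /= nE k _ /=; apply: contrapT => nk; apply: nE; exists k => // n kn En.
  by apply: nk; exists n.
Qed.

Lemma measurable_exists_lt (F : nat -> set T) N : (forall i, measurable (F i)) ->
  measurable [set w | exists2 i, (i < N)%N & F i w].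
Proof.
move=> mF; rewrite (_ : [set _ | _] = \bigcup_(i in [set i | (i < N)%N]) F i).
  exact: bigcup_measurable.
by apply/seteqP; split => w [i iN Fi]; exists i.
Qed.

Lemma union_bound (F : nat -> set T) (u : R) N : (forall i, measurable (F i)) ->
  (forall i, (i < N)%N -> P (F i) <= u%:E) ->
  P [set w | exists2 i, (i < N)%N & F i w] <= (N%:R * u)%:E.
Proof.
move=> mF; elim: N => [|N IH] hF.
  rewrite (_ : [set _ | _] = set0) ?measure0 ?mul0r //.
  by apply/seteqP; split => // w [].
have -> : [set w | exists2 i, (i < N.+1)%N & F i w] =
    [set w | exists2 i, (i < N)%N & F i w] `|` F N.
  apply/seteqP; split => [w [i]|w [[i iN Fi]|FN]].
  - by rewrite ltnS leq_eqVlt => /predU1P[->|iN] Fi; [right|left; exists i].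
  - by exists i => //; exact: leqW.
  - by exists N.
have mU := measurable_exists_lt N mF.
apply: (le_trans (measureU2 P mU (mF N))).
rewrite -natr1 mulrDl mul1r EFinD; apply: leeD; last exact: hF.
by apply: IH => i iN; apply: hF; exact: leqW.
Qed.

(** Conditioning on X without conditional probabilities: on each fibre E coincides with an event F v
    independent of that fibre, and the fibres add up to the whole space. *)
Lemma conditional_bound (X : T -> nat) (E : set T) (F : nat -> set T) (u : R) :
  discrete_rv X -> measurable E -> (0 <= u)%R ->
  (forall v, E `&` X @^-1` [set v] = F v `&` X @^-1` [set v]) ->
  (forall v, P (F v `&` X @^-1` [set v]) = P (F v) * P (X @^-1` [set v])) ->
  (forall v, P (F v) <= u%:E) -> P E <= u%:E.
Proof.
move=> mX mE u0 EF ind Fu; rewrite (total_probability P mX mE).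
apply: (@le_trans _ _ (\sum_(n <oo) u%:E * P (X @^-1` [set n]))).
  apply: lee_nneseries => // n _.
  rewrite EF ind; apply: lee_wpmul2r => //.
rewrite nneseriesZl // -[leRHS]mule1; apply: lee_wpmul2l; first by rewrite lee_fin.
have := total_probability P mX measurableT; rewrite (@probability_setT _ _ _ P) => ->.
by apply: lee_nneseries => // n _; rewrite setTI.
Qed.

End borel_cantelli.

Section regularity.
Context d (T : measurableType d) (R : realType) (P : probability T R).
Variable Z : nat + nat -> T -> nat.
Hypothesis mZ : forall i, discrete_rv (Z i).
Hypothesis indZ : mutually_independent P
  (fun i => [set A | exists B : set nat, A = Z i @^-1` B]).

(** The union over two indices costs (n + 1)^2 and summability another square, so exponent 5 leaves
    one power to spare. With the 32 of [hoeffding] it produces the constant 160 = 5 * 32. *)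
Lemma union_ln_bound (n : nat) : (1 <= n)%N ->
  n.+1%:R * (n.+1%:R * (2 * expR (- (5 * ln n%:R)))) <= 32 / n.+1%:R ^+ 2 :> R.
Proof.
move=> n1; have n0 : 0 < n%:R :> R by rewrite ltr0n.
have -> : expR (- (5 * ln n%:R)) = (n%:R ^+ 5)^-1 :> R.
  by rewrite expRN expRM_natl lnK.
rewrite ler_pdivlMr ?exprn_gt0 //.
have -> : n.+1%:R * (n.+1%:R * (2 * (n%:R ^+ 5)^-1)) * n.+1%:R ^+ 2
  = 2 * n.+1%:R ^+ 4 / n%:R ^+ 5 :> R by ring.
rewrite ler_pdivrMr ?exprn_gt0 //.
have h : n.+1%:R <= 2 * n%:R :> R by rewrite -natrM ler_nat; lia.
have h4 : n.+1%:R ^+ 4 <= (2 * n%:R) ^+ 4 :> R by rewrite lerXn2r ?nnegrE ?mulr_ge0.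
have h5 : n%:R ^+ 4 <= n%:R ^+ 5 :> R by rewrite ler_weXn2l // ler1n.
by rewrite exprMn in h4; lra.
Qed.

Section side.
Variables (h : nat -> nat + nat) (p : nat -> R).
Hypotheses (hI : injective h) (pp : prob_vector p).
Hypothesis law : forall j n, P (Z (h j) @^-1` [set n]) = (p n)%:E.
Variable f : nat -> R.
Hypotheses (f2 : forall i, `|f i| <= 2) (mf : mean p f = 0).

Lemma measurable_window_sqr_gt t a l :
  measurable [set w | t < window_sum Z h f a l w ^+ 2].
Proof.
rewrite (_ : [set _ | _] = ~` [set w | - t <= - window_sum Z h f a l w ^+ 2]).
  apply: measurableC.
  exact: (measurable_superlevel (measurable_window_fun mZ h (fun s => - s ^+ 2) f a l)).
by apply/seteqP; split => w /=; rewrite lerN2 ltNge => /negP.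
Qed.

Lemma ae_window_sqr_le : {ae P, forall w, \forall n \near \oo,
  forall a l, (a <= n)%N -> (l <= n)%N ->
    window_sum Z h f a l w ^+ 2 <= 160 * l%:R * ln n%:R}.
Proof.
pose E n := [set w | exists2 a, (a < n.+1)%N & exists2 l, (l < n.+1)%N &
  160 * l%:R * ln n%:R < window_sum Z h f a l w ^+ 2].
have mF n a : measurable [set w | exists2 l, (l < n.+1)%N &
    160 * l%:R * ln n%:R < window_sum Z h f a l w ^+ 2].
  by apply: measurable_exists_lt => l; exact: measurable_window_sqr_gt.
have : {ae P, forall w, \forall n \near \oo, ~ E n w}.
  apply: (@ae_eventually_not _ _ _ _ E 32) => [n|n]; first by apply: measurable_exists_lt => a; exact: mF.
  have [->|n1] := posnP n.
    rewrite expr1n divr1 (_ : E 0%N = set0) ?measure0 ?lee_fin //.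
    apply/seteqP; split => // w [a _ [[|//] _]].
    by rewrite /window_sum big_nil expr0n /= mulr0 mul0r ltxx.
  have L0 : 0 <= ln n%:R :> R by rewrite ln_ge0 // ler1n.
  apply: (le_trans _ (_ : (n.+1%:R * (n.+1%:R * (2 * expR (- (5 * ln n%:R)))))%:E
     <= _)%E); last by rewrite lee_fin union_ln_bound.
  apply: union_bound => [a|a _]; first exact: mF.
  apply: union_bound => [l|l _].
    exact: measurable_window_sqr_gt.
  have [->|l0] := posnP l.
    rewrite [X in P X](_ : _ = set0) ?measure0 ?lee_fin ?mulr_ge0 ?expR_ge0 //.
    by apply/seteqP; split => // w; rewrite /= /window_sum big_nil expr0n /= mulr0 mul0r ltxx.
  have l0' : 0 < l%:R :> R by rewrite ltr0n.
  apply: (le_trans (hoeffding mZ indZ hI pp law a f2 mf _ l0' (lexx _))).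
    by apply: mulr_ge0; [apply: mulr_ge0; exact: ler0n|].
  rewrite lee_fin (_ : 160 * l%:R * ln n%:R / (32 * l%:R) = 5 * ln n%:R) //.
  by field; rewrite gt_eqF.
apply: filterS => w; apply: filterS => n nE a l an ln'.
by rewrite leNgt; apply/negP => lt; apply: nE; exists a => //; exists l.
Qed.

Lemma ae_window_sqr_le_loglog : {ae P, forall w, \forall n \near \oo,
  forall m, (m <= n)%N ->
    window_sum Z h f 0 m w ^+ 2 <= 4000 * n%:R * ln (ln n%:R)}.
Proof.
(* The grid spacing on the dyadic range of n: k + 1 cells cover [0, 2^(k+1)], and each has length of
   order n / log n. *)
pose e k := (2 ^ k.+1 %/ k.+1).+1.
(* Grid points lie below 4 * 2^k, and 384 = 3 * 32 * 4 gives each of them probability at most 2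
   (k+1)^(-3), summable even after the union over k + 2 points. *)
pose F k := [set w | exists2 j, (j < k.+2)%N &
  384 * 2 ^+ k * ln k.+1%:R < window_sum Z h f 0 (j * e k) w ^+ 2].
have ek k : (k.+1 * e k <= 2 ^ k.+1 + k.+1)%N.
  by rewrite /e mulnS addnC leq_add2r mulnC leq_trunc_div.
have kl k : (k < 2 ^ k)%N by rewrite ltn_expl.
have nF : {ae P, forall w, \forall n \near \oo, ~ F n w}.
  apply: (@ae_eventually_not _ _ _ _ F 4) => [k|k].
    by apply: measurable_exists_lt => j; exact: measurable_window_sqr_gt.
  have L0 : 0 <= ln k.+1%:R :> R by rewrite ln_ge0 // ler1n.
  apply: (le_trans _ (_ : (k.+2%:R * (2 * expR (- (3 * ln k.+1%:R))))%:E <= _)%E).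
    apply: union_bound => [j|j jk]; first exact: measurable_window_sqr_gt.
    have D0 : 0 < 4 * 2 ^+ k :> R by rewrite mulr_gt0 ?exprn_gt0.
    have jD : (j * e k)%:R <= 4 * 2 ^+ k :> R.
      rewrite -natrX -natrM ler_nat (leq_trans _ (_ : 2 ^ k.+1 + k.+1 <= _)%N) //.
        by rewrite (leq_trans _ (ek k)) // leq_mul2r -ltnS jk orbT.
      by have := kl k; rewrite expnS; lia.
    apply: (le_trans (hoeffding mZ indZ hI pp law 0 f2 mf _ D0 jD)).
      by apply: mulr_ge0; [apply: mulr_ge0; [exact: ler0n|exact: exprn_ge0]|].
    rewrite lee_fin (_ : 384 * 2 ^+ k * ln k.+1%:R / (32 * (4 * 2 ^+ k)) = 3 * ln k.+1%:R) //.
    by field; rewrite gt_eqF // exprn_gt0.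
  have -> : expR (- (3 * ln k.+1%:R)) = (k.+1%:R ^+ 3)^-1 :> R.
    by rewrite expRN expRM_natl lnK // posrE ltr0n.
  rewrite lee_fin ler_pdivlMr ?exprn_gt0 //.
  have -> : k.+2%:R * (2 * (k.+1%:R ^+ 3)^-1) * k.+1%:R ^+ 2 = 2 * k.+2%:R / k.+1%:R :> R.
    by field; rewrite nat1r pnatr_eq0.
  by rewrite ler_pdivrMr // -!natrM ler_nat; lia.
have := ae_window_sqr_le; move: nF; apply: filterS2 => w [k0 _ nF] nA.
near=> n => m mn.
have A : forall a l, (a <= n)%N -> (l <= n)%N ->
    window_sum Z h f a l w ^+ 2 <= 160 * l%:R * ln n%:R by near: n; exact: nA.
have nk : (2 ^ k0 <= n)%N by near: n; exact: nbhs_infty_ge.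
have [LL1 _ _] : [/\ 1 <= ln (ln n%:R) :> R, ln (ln n%:R) <= ln n%:R :> R
    & ln n%:R <= n%:R :> R] by near: n; exact: near_log.
have n3 : expR 3 <= n%:R :> R by near: n; exact: nbhs_infty_ger.
have n0 : 0 < n%:R :> R by apply: lt_le_trans n3; exact: expR_gt0.
have n0' : (0 < n)%N by rewrite -(ltr_nat R).
have L3 : 3 <= ln n%:R :> R by rewrite -[leLHS](@expRK R) ler_ln ?posrE ?expR_gt0.
set k := trunc_log 2 n.
have [k1 k2] : (2 ^ k <= n)%N /\ (n < 2 ^ k.+1)%N.
  by have /andP[] := trunc_log_bounds (isT : 1 < 2)%N n0'.
have kk0 : (k0 <= k)%N by rewrite trunc_log_max.
have k1R : 2 ^+ k <= n%:R :> R by rewrite -natrX ler_nat.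
have k2R : n%:R <= 2 * 2 ^+ k :> R by rewrite -exprS -natrX ler_nat ltnW.
have ln2 : 1 / 2 <= ln 2 :> R.
  rewrite -[leLHS](@expRK R) ler_ln ?posrE ?expR_gt0 //.
  by apply: (le_trans (expR_le_quadratic _)) => //; lra.
have ln2' : ln 2 <= 1 :> R.
  rewrite -ler_expR lnK ?posrE //.
  by have := @expR_ge1Dx R 1; lra.
have klnn : k%:R <= 2 * ln n%:R :> R.
  have : ln (2 ^+ k) <= ln n%:R :> R by rewrite ler_ln ?posrE ?exprn_gt0.
  rewrite lnXn // -[_ *+ k]mulr_natl => h1.
  have : k%:R * (1 / 2) <= k%:R * ln 2 :> R by rewrite ler_wpM2l.
  lra.
have lnk : ln k.+1%:R <= 2 * ln (ln n%:R) :> R.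
  have -> : 2 * ln (ln n%:R) = ln (ln n%:R ^+ 2) :> R.
    by rewrite lnXn ?mulr_natl //; lra.
  rewrite ler_ln ?posrE ?exprn_gt0 //; last by lra.
  rewrite -natr1; move: klnn L3; set L := ln n%:R; nra.
have lnn : ln n%:R <= k.+1%:R :> R.
  apply: (@le_trans _ _ (ln (2 ^+ k.+1))).
    by rewrite ler_ln ?posrE ?exprn_gt0 // exprS.
  by rewrite lnXn // -[_ *+ k.+1]mulr_natl ler_piMr.
pose j := (m %/ e k)%N; pose l := (m %% e k)%N.
have mE : m = (j * e k + l)%N by rewrite -divn_eq.
have le_ : (l < e k)%N by rewrite ltn_mod.
have jk : (j < k.+2)%N.
  rewrite ltnS ltnW // ltn_divLR // (leq_ltn_trans mn) // (leq_trans k2) //.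
  by rewrite /e mulnC; have := ltn_ceil (2 ^ k.+1) (ltn0Sn k); rewrite mulnC => /ltnW.
have S1 : window_sum Z h f 0 (j * e k) w ^+ 2 <= 384 * 2 ^+ k * ln k.+1%:R.
  by rewrite leNgt; apply/negP => lt; apply: (nF k kk0); exists j.
have jn : (j * e k <= n)%N by rewrite (leq_trans _ mn) // mE leq_addr.
have lnn' : (l <= n)%N by rewrite (leq_trans _ mn) // mE leq_addl.
have S2 := A _ _ jn lnn'.
have -> : window_sum Z h f 0 m w
    = window_sum Z h f 0 (j * e k) w + window_sum Z h f (j * e k) l w.
  by rewrite /window_sum mE iotaD big_cat.
set s1 := window_sum Z h f 0 _ w in S1 *; set s2 := window_sum Z h f _ l w in S2 *.
have S1' : s1 ^+ 2 <= 768 * n%:R * ln (ln n%:R).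
  have h1 : 2 ^+ k * ln k.+1%:R <= n%:R * (2 * ln (ln n%:R)) :> R.
    by apply: ler_pM => //; rewrite ln_ge0 // ler1n.
  lra.
(* The cell length is of order n / log n, so the log n from the bound on increments cancels. *)
have S2' : s2 ^+ 2 <= 640 * n%:R.
  have eR : l%:R * k.+1%:R <= 4 * n%:R :> R.
    rewrite -!natrM ler_nat (leq_trans (leq_mul (ltnW le_) (leqnn _))) // mulnC.
    rewrite (leq_trans (ek k)) //; have := kl k; have := k1; rewrite expnS.
    by clear; lia.
  apply: (le_trans S2); have : l%:R * ln n%:R <= l%:R * k.+1%:R :> R by rewrite ler_wpM2l.
  lra.
(* The total is at most (2 * 768 + 2 * 640) n log log n, below the constant 4000, since log log n >=
   1. *)
have : (s1 + s2) ^+ 2 <= 2 * s1 ^+ 2 + 2 * s2 ^+ 2.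
  have -> : 2 * s1 ^+ 2 + 2 * s2 ^+ 2 = (s1 + s2) ^+ 2 + (s1 - s2) ^+ 2 by ring.
  by rewrite lerDl sqr_ge0.
have : n%:R <= n%:R * ln (ln n%:R) :> R by rewrite ler_peMr // ltW.
lra.
Unshelve. all: by end_near. Qed.

End side.

Section rows.
Variables (h1 h2 : nat -> nat + nat) (p : nat -> R).
Hypotheses (hI : injective h2) (h12 : forall i j, h1 i != h2 j) (pp : prob_vector p).
Hypothesis law : forall j n, P (Z (h2 j) @^-1` [set n]) = (p n)%:E.
Variable k : nat -> nat -> R.
Hypotheses (k2 : forall v i, `|k v i| <= 2) (mk : forall v, mean p (k v) = 0).

(** The row is selected by a random label. That label lies in the other sequence ([h12]), so after
    conditioning on it the row is an ordinary centred window sum. *)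
Lemma ae_row_sqr_le : {ae P, forall w, \forall n \near \oo,
  forall i m, (i < n)%N -> (m <= n)%N ->
    window_sum Z h2 (k (Z (h1 i) w)) 0 m w ^+ 2 <= 160 * n%:R * ln n%:R}.
Proof.
pose E n i m := [set w | 160 * n%:R * ln n%:R
  < window_sum Z h2 (k (Z (h1 i) w)) 0 m w ^+ 2].
pose D2 m := fun j => j \in map h2 (iota 0 m).
have dE n i m : determined Z (fun j => j \in h1 i :: map h2 (iota 0 m)) (E n i m).
  move=> w w' ww'; rewrite /E /= (ww' (h1 i)) ?mem_head //.
  rewrite (@window_sum_determined _ _ _ _ Z h2 _ 0 m w w') // => j jm.
  by apply: ww'; rewrite in_cons jm orbT.
have mE n i m : measurable (E n i m) by exact: (determined_measurable mZ (dE n i m) (fun _ jJ => jJ)).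
pose EE n := [set w | exists2 i, (i < n.+1)%N & exists2 m, (m < n.+1)%N & E n i m w].
have mF n i : measurable [set w | exists2 m, (m < n.+1)%N & E n i m w].
  by apply: measurable_exists_lt => m; exact: mE.
have : {ae P, forall w, \forall n \near \oo, ~ EE n w}.
  apply: (@ae_eventually_not _ _ _ _ EE 32) => [n|n].
    by apply: measurable_exists_lt => a; exact: mF.
  have [->|n1] := posnP n.
    rewrite expr1n divr1 (_ : EE 0%N = set0) ?measure0 ?lee_fin //.
    apply/seteqP; split => // w [i _ [[|//] _]].
    by rewrite /E /= /window_sum big_nil expr0n /= mulr0 mul0r ltxx.
  have L0 : 0 <= ln n%:R :> R by rewrite ln_ge0 // ler1n.
  have n0 : 0 < n%:R :> R by rewrite ltr0n.
  apply: (le_trans _ (_ : (n.+1%:R * (n.+1%:R * (2 * expR (- (5 * ln n%:R)))))%:E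
     <= _)%E); last by rewrite lee_fin union_ln_bound.
  apply: union_bound => [i|i _]; first exact: mF.
  apply: union_bound => [m|m mn]; first exact: mE.
  pose F v := [set w | 160 * n%:R * ln n%:R < window_sum Z h2 (k v) 0 m w ^+ 2].
  apply: (@conditional_bound _ _ _ P (Z (h1 i)) (E n i m) F _ (mZ _) (mE n i m)).
  - by rewrite mulr_ge0 ?expR_ge0.
  - by move=> v; apply/seteqP; split => w [] /= + wv; rewrite /E /F /= wv.
  - move=> v; apply: (@determined_indep _ _ _ P _ Z mZ indZ (D2 m)
      (fun j => j \in [:: h1 i]) _ _ (h1 i :: map h2 (iota 0 m))).
    + move=> w w' ww'; rewrite /F /=.
      by rewrite (@window_sum_determined _ _ _ _ Z h2 _ 0 m w w').
    + by move=> w w' ww' /= <-; rewrite ww' // mem_head.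
    + by move=> j jm; rewrite in_cons; apply/orP; right.
    + by move=> j; rewrite inE => /eqP ->; exact: mem_head.
    + move=> j /mapP[i' _ ->]; rewrite inE => /eqP e.
      by have := h12 i i'; rewrite e eqxx.
  - move=> v.
    apply: (le_trans (hoeffding mZ indZ hI pp law 0 (k2 v) (mk v) _ n0 _)).
    + by apply: mulr_ge0; [apply: mulr_ge0; exact: ler0n|].
    + by rewrite ler_nat.
    rewrite lee_fin (_ : 160 * n%:R * ln n%:R / (32 * n%:R) = 5 * ln n%:R) //.
    by field; rewrite gt_eqF.
apply: filterS => w; apply: filterS => n nE i m ni mn.
rewrite leNgt; apply/negP => lt; apply: nE; exists i; first exact: leqW.
by exists m.
Qed.

End rows.

Section regular.
Variables (r s : nat -> R).
Hypotheses (pr : prob_vector r) (ps : prob_vector s).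
Let mu := rsum (fun i => r i * s i).
Hypothesis lawR : forall j n, P (Z (inl j) @^-1` [set n]) = (r n)%:E.
Hypothesis lawS : forall j n, P (Z (inr j) @^-1` [set n]) = (s n)%:E.

Lemma prob_vector_bounds (p : nat -> R) : prob_vector p -> forall i, 0 <= p i <= 1.
Proof.
move=> [_ [p0 p1]] i; rewrite p0 /=.
have <- : limn (series p) = 1 by exact/cvg_lim.
have mono : nondecreasing_seq (series p).
  by apply: nondecreasing_series => n _ _; exact: p0.
apply: le_trans (nondecreasing_cvgn_le mono _ i.+1); last by apply/cvg_ex; exists 1.
by rewrite /series /= big_nat_recr //= lerDr sumr_ge0.
Qed.

Lemma mean_indicator (p : nat -> R) u : mean p (fun v => (u == v)%:R) = p u.
Proof.
rewrite /mean /rsum; apply: (@lim_near_cst _ _ _ _ _ (p u)) => //.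
near=> n; have un : (u < n)%N by near: n; exact: nbhs_infty_ge.
rewrite /series /= big_mkord (bigD1 (Ordinal un)) //= eqxx mulr1 big1 ?addr0 //.
move=> i iu; rewrite (_ : (u == i) = false) ?mulr0 //.
by apply/negbTE; apply: contraNneq iu => e; apply/eqP/val_inj.
Unshelve. all: by end_near. Qed.

Lemma unif_bounded_prob (p : nat -> R) : prob_vector p -> unif_bounded p.
Proof.
move=> pp; exists 1 => i; have /andP[p0 p1] := prob_vector_bounds pp i.
by rewrite ger0_norm.
Qed.

Lemma unif_bounded_indicator u : unif_bounded (fun v => (u == v)%:R : R).
Proof. by exists 1 => v; case: eqP => _; rewrite ?normr1 ?normr0. Qed.

Lemma mean_rs : mean r s = mu. Proof. by []. Qed.

Lemma mean_sr : mean s r = mu.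
Proof. by rewrite /mean /mu; congr rsum; apply/funext => i; rewrite mulrC. Qed.

Lemma mu_bounds : 0 <= mu <= 1.
Proof.
have bs := unif_bounded_prob ps; rewrite -mean_rs; apply/andP; split.
  by apply: mean_ge0 => // i; case/andP: (prob_vector_bounds ps i).
rewrite -[leRHS](mean_cst pr); apply: mean_le => //; first exact: unif_bounded_cst.
by move=> i; case/andP: (prob_vector_bounds ps i).
Qed.

Lemma mean_shift (p f : nat -> R) c : prob_vector p -> unif_bounded f ->
  mean p (fun i => f i + c) = mean p f + c.
Proof. by move=> pp bf; rewrite meanD ?mean_cst //; exact: unif_bounded_cst. Qed.

Lemma mean_centeredR : mean r (fun i => s i - mu) = 0.
Proof. by rewrite mean_shift ?mean_rs ?subrr //; exact: unif_bounded_prob. Qed.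

Lemma mean_centeredS : mean s (fun i => r i - mu) = 0.
Proof. by rewrite mean_shift ?mean_sr ?subrr //; exact: unif_bounded_prob. Qed.

Lemma centered_le2 (p : nat -> R) : prob_vector p -> forall i, `|p i - mu| <= 2.
Proof.
move=> pp i; have := prob_vector_bounds pp i; have := mu_bounds.
by rewrite ler_norml; lra.
Qed.

Lemma kernel_le2 u v : `|kernel r s mu u v| <= 2.
Proof.
have := prob_vector_bounds pr v; have := prob_vector_bounds ps u; have := mu_bounds.
by rewrite /kernel ler_norml; case: eqP => _ /=; lra.
Qed.

Lemma mean_kernelS u : mean s (kernel r s mu u) = 0.
Proof.
have br := unif_bounded_prob pr.
rewrite (_ : kernel r s mu u =
    fun v => ((u == v)%:R + -1 * r v) + (mu - s u)).
  rewrite mean_shift ?meanD ?meanZ ?mean_indicator ?mean_sr //; first lra.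
  - exact: unif_bounded_indicator.
  - exact: unif_boundedZ.
  - by apply: unif_boundedD; [exact: unif_bounded_indicator|exact: unif_boundedZ].
by apply/funext => v; rewrite /kernel; lra.
Qed.

Lemma mean_kernelR v : mean r (fun u => kernel r s mu u v) = 0.
Proof.
have bs := unif_bounded_prob ps.
rewrite (_ : (fun u => kernel r s mu u v) =
    fun u => ((v == u)%:R + -1 * s u) + (mu - r v)).
  rewrite mean_shift ?meanD ?meanZ ?mean_indicator ?mean_rs //; first lra.
  - exact: unif_bounded_indicator.
  - exact: unif_boundedZ.
  - by apply: unif_boundedD; [exact: unif_bounded_indicator|exact: unif_boundedZ].
by apply/funext => u; rewrite /kernel eq_sym; lra.
Qed.

Lemma window_sum_deviation (h : nat -> nat + nat) (f : nat -> R) c a l w :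
  window_sum Z h (fun i => f i - c) a l w =
  deviation f c (fun j => Z (h j) w) (a + l) - deviation f c (fun j => Z (h j) w) a.
Proof.
rewrite /window_sum /deviation -!(big_mkord xpredT (fun j => f (Z (h j) w) - c)).
rewrite [in RHS](@big_cat_nat _ _ _ a 0 (a + l)) //= ?leq_addr //.
rewrite [RHS]addrAC subrr add0r /index_iota; congr (\sum_(j <- iota a _) _); lia.
Qed.

Lemma ae_regular : exists2 C : R, 0 <= C & {ae P, forall w, \forall n \near \oo,
  regular C r s mu (fun j => Z (inl j) w) (fun j => Z (inr j) w) n}.
Proof.
exists 4000; first exact: ler0n.
have iL : injective (inl : nat -> nat + nat) by move=> ? ? [].
have iR : injective (inr : nat -> nat + nat) by move=> ? ? [].
have fR := centered_le2 ps; have fS := centered_le2 pr.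
have a1 := ae_window_sqr_le iL pr lawR fR mean_centeredR.
have a2 := ae_window_sqr_le iR ps lawS fS mean_centeredS.
have a3 := ae_window_sqr_le_loglog iL pr lawR fR mean_centeredR.
have a4 := ae_window_sqr_le_loglog iR ps lawS fS mean_centeredS.
have a5 := @ae_row_sqr_le inl inr s iR (fun _ _ => isT) ps lawS
  (kernel r s mu) kernel_le2 mean_kernelS.
have a6 := @ae_row_sqr_le inr inl r iL (fun _ _ => isT) pr lawR
  (fun v u => kernel r s mu u v) (fun v u => kernel_le2 u v) mean_kernelR.
apply: filter_app a1; apply: filter_app a2; apply: filter_app a3.
apply: filter_app a4; apply: filter_app a5; apply: filter_app a6.
near=> w => a6 a5 a4 a3 a2 a1.
apply: filter_app a1; apply: filter_app a2; apply: filter_app a3.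
apply: filter_app a4; apply: filter_app a5; apply: filter_app a6.
apply: filter_app (@near_log R); near=> n => -[LL1 LLL _] a6 a5 a4 a3 a2 a1.
have L0 : 0 <= ln n%:R :> R by exact: le_trans (le_trans ler01 LL1) LLL.
have sum0 (h : nat -> nat + nat) (f : nat -> R) m : \sum_(j < m) f (Z (h j) w) = window_sum Z h f 0 m w.
  by rewrite /window_sum -(big_mkord xpredT (fun j => f (Z (h j) w))) /index_iota subn0.
have c160 (u : R) : 0 <= u -> 160 * u * ln n%:R <= 4000 * u * ln n%:R.
  by move=> u0; apply: ler_wpM2r => //; apply: ler_wpM2r => //; rewrite ler_nat.
have inc (h : nat -> nat + nat) (f : nat -> R) c : (forall a l, (a <= n)%N -> (l <= n)%N ->
      window_sum Z h (fun i => f i - c) a l w ^+ 2 <= 160 * l%:R * ln n%:R) ->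
    forall a b, (a <= n)%N -> (b <= n)%N ->
    (deviation f c (fun j => Z (h j) w) a - deviation f c (fun j => Z (h j) w) b) ^+ 2
      <= 4000 * `|a%:R - b%:R| * ln n%:R.
  move=> H a b; wlog ba : a b / (b <= a)%N => [H'|an bn].
    have [ba|/ltnW ab] := leqP b a; first exact: H'.
    by move=> an bn; rewrite -sqrrN opprB distrC; exact: H'.
  have ab0 : (a - b <= n)%N by rewrite (leq_trans (leq_subr _ _)).
  have := H b (a - b)%N bn ab0; rewrite window_sum_deviation subnKC // => h1.
  rewrite -natrB // ger0_norm //; apply: (le_trans h1); exact: c160.
split.
- move=> a b an bn; split; exact: inc.
- move=> m mn; rewrite /deviation (sum0 inl (fun i => s i - mu)).
  rewrite (sum0 inr (fun i => r i - mu)); split; [exact: a3|exact: a4].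
- move=> i m ni mn; split.
    rewrite (sum0 inr (kernel r s mu (Z (inl i) w))) (le_trans _ (c160 _ _)) //.
    exact: a5.
  rewrite (sum0 inl (fun u => kernel r s mu u (Z (inr i) w))) (le_trans _ (c160 _ _)) //.
  exact: a6.
Unshelve. all: by end_near. Qed.

End regular.
End regularity.

(** * Events on disjoint blocks of indices *)

Section independent_blocks.
Context d (T : measurableType d) (R : realType) (P : probability T R).
Variable Z : nat + nat -> T -> nat.
Hypothesis mZ : forall i, discrete_rv (Z i).
Hypothesis indZ : mutually_independent P
  (fun i => [set A | exists B : set nat, A = Z i @^-1` B]).

(** Both sequences are cut at the same indices, so that events on disjoint intervals are independent
    jointly for R and S. *)
Definition interval_index (a b : nat) (i : nat + nat) : Prop :=
  match i with inl j => (a <= j < b)%N | inr j => (a <= j < b)%N end.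

Definition index_below b : seq (nat + nat) :=
  [seq inl j | j <- iota 0 b] ++ [seq inr j | j <- iota 0 b].

Lemma interval_index_below a b c : (b <= c)%N ->
  forall i, interval_index a b i -> i \in index_below c.
Proof.
move=> bc [j|j] /= /andP[_ jb]; rewrite mem_cat; apply/orP; [left|right];
  by apply: map_f; rewrite mem_iota /= add0n (leq_trans jb).
Qed.

Definition prob (E : set T) : R := fine (P E).

Lemma probE E : measurable E -> P E = (prob E)%:E.
Proof. by move=> mE; rewrite /prob fineK // fin_num_measure. Qed.

Lemma prob_ge0 E : 0 <= prob E. Proof. by rewrite fine_ge0. Qed.

Lemma probC E : measurable E -> prob (~` E) = 1 - prob E.
Proof. by move=> mE; rewrite /prob probability_setC // probE. Qed.

Lemma prob_le E F : measurable E -> measurable F -> E `<=` F -> prob E <= prob F.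
Proof.
by move=> mE mF EF; rewrite -lee_fin -!probE // le_measure // inE.
Qed.

Lemma interval_measurable a b E : determined Z (interval_index a b) E -> measurable E.
Proof.
by move=> dE; exact: (determined_measurable mZ dE (interval_index_below (leqnn b))).
Qed.

Lemma prob_indep D1 D2 E1 E2 b : determined Z D1 E1 -> determined Z D2 E2 ->
  (forall i, D1 i -> i \in index_below b) -> (forall i, D2 i -> i \in index_below b) ->
  (forall i, D1 i -> ~ D2 i) -> prob (E1 `&` E2) = prob E1 * prob E2.
Proof.
move=> d1 d2 b1 b2 d12.
have m1 := determined_measurable mZ d1 b1; have m2 := determined_measurable mZ d2 b2.
by rewrite /prob (determined_indep mZ indZ d1 d2 b1 b2 d12) !probE.
Qed.

Lemma interval_indep a b c E1 E2 : (a <= b)%N -> (b <= c)%N ->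
  determined Z (interval_index a b) E1 -> determined Z (interval_index b c) E2 ->
  prob (E1 `&` E2) = prob E1 * prob E2.
Proof.
move=> ab bc d1 d2; apply: (prob_indep d1 d2 (b := c)).
- exact: interval_index_below.
- exact: interval_index_below.
- by move=> [j|j] /= /andP[_ jb] /andP[]; rewrite leqNgt jb.
Qed.

Lemma interval_sub a b a' b' E : (a' <= a)%N -> (b <= b')%N ->
  determined Z (interval_index a b) E -> determined Z (interval_index a' b') E.
Proof.
move=> aa bb; apply: determined_sub => -[j|j] /= /andP[aj jb];
  by rewrite (leq_trans aa) //= (leq_trans jb).
Qed.

Definition all_below (E : nat -> set T) n := [set w | forall b, (b < n)%N -> E b w].

Lemma all_below_succ E n : all_below E n.+1 = all_below E n `&` E n.
Proof.
apply/seteqP; split => [w h|w [h hn] b].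
  by split => [b bn|]; apply: h => //; exact: leqW.
by rewrite ltnS leq_eqVlt => /predU1P[->//|]; exact: h.
Qed.

Lemma all_below_determined E t n : (forall b, (t b <= t b.+1)%N) ->
  (forall b, determined Z (interval_index (t b) (t b.+1)) (E b)) ->
  determined Z (interval_index (t 0%N) (t n)) (all_below E n).
Proof.
move=> tS dE; have t0 b : (t 0%N <= t b)%N.
  by elim: b => // b IH; rewrite (leq_trans IH).
elim: n => [|n IH]; first by move=> w w' _ _ b.
rewrite all_below_succ; apply: determinedI; first exact: interval_sub IH.
exact: interval_sub (dE n).
Qed.

Lemma prob_all_below E t n : (forall b, (t b <= t b.+1)%N) ->
  (forall b, determined Z (interval_index (t b) (t b.+1)) (E b)) ->
  prob (all_below E n) = \prod_(b < n) prob (E b).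
Proof.
move=> tS dE; have t0 b : (t 0%N <= t b)%N.
  by elim: b => // b IH; rewrite (leq_trans IH).
elim: n => [|n IH].
  rewrite big_ord0 /prob (_ : all_below E 0 = setT) ?probability_setT //.
  by apply/seteqP; split.
rewrite big_ord_recr /= -IH all_below_succ.
exact: (interval_indep (t0 n) (tS n) (all_below_determined tS dE)).
Qed.

(** A rational form of (1 - x)^n <= exp(- n x): it tends to 0 in n, and gives 1/2 as soon as n x >=
    1. *)
Lemma exp_one_sub_le (x : R) n : 0 <= x <= 1 -> (1 - x) ^+ n * (1 + n%:R * x) <= 1.
Proof.
move=> /andP[x0 x1]; elim: n => [|n IH]; first by rewrite mul0r addr0 mulr1.
apply: le_trans IH; rewrite exprSr -mulrA ler_wpM2l ?exprn_ge0 //; first by lra.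
have : 0 <= n%:R :> R by []; rewrite -natr1; nra.
Qed.

Lemma prob_none_le E t n (x : R) : (forall b, (t b <= t b.+1)%N) ->
  (forall b, determined Z (interval_index (t b) (t b.+1)) (E b)) ->
  0 <= x <= 1 -> (forall b, x <= prob (E b)) ->
  prob (all_below (fun b => ~` E b) n) * (1 + n%:R * x) <= 1.
Proof.
move=> tS dE x01 xE; apply: le_trans (exp_one_sub_le n x01).
have /andP[x0 x1] := x01.
rewrite ler_wpM2r ?addr_ge0 ?mulr_ge0 //.
rewrite (prob_all_below n tS) => [|b]; last exact: determinedC.
rewrite -[leRHS](_ : \prod_(b < n) (1 - x) = _); last by rewrite prodr_const card_ord.
apply: ler_prod => b _; have mE := interval_measurable (dE b).
by rewrite prob_ge0 probC // lerD2l lerN2 xE.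
Qed.

(** From any scale on, n consecutive failures have probability at most 1 / (1 + n x) by
    independence, so permanent failure is a null event. *)
Lemma ae_infinitely_often E t (x : R) k1 : (forall b, (t b <= t b.+1)%N) ->
  (forall b, determined Z (interval_index (t b) (t b.+1)) (E b)) ->
  0 < x <= 1 -> (forall b, (k1 <= b)%N -> x <= prob (E b)) ->
  {ae P, forall w, forall k0, exists2 k, (k0 <= k)%N & E k w}.
Proof.
move=> tS dE /andP[x0 x1] xE; apply: ae_foralln => k0.
pose k := maxn k0 k1; pose F n := all_below (fun b => ~` E (k + b)%N) n.
have tS' b : (t (k + b) <= t (k + b.+1))%N by rewrite addnS.
have dE' b : determined Z (interval_index (t (k + b)%N) (t (k + b.+1)%N)) (E (k + b)%N).
  by rewrite addnS.
have mF n : measurable (F n).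
  have dF := @all_below_determined (fun b => ~` E (k + b)%N) (fun b => t (k + b)%N) n tS'.
  by apply: interval_measurable (dF _) => b; exact: determinedC.
have mN : measurable (\bigcap_n F n) by exact: bigcapT_measurable.
exists (\bigcap_n F n); split => //.
- suff h0 : prob (\bigcap_n F n) = 0 by exact: etrans (probE mN) (congr1 EFin h0).
  apply/eqP; rewrite eq_le prob_ge0 andbT leNgt; apply/negP => pos; set y := prob _ in pos.
  have bound n : y * (1 + n%:R * x) <= 1.
    have := @prob_none_le (fun b => E (k + b)%N) (fun b => t (k + b)%N) n x tS' dE'.
    rewrite (ltW x0) x1 => /(_ isT) h; apply: le_trans (h _).
      rewrite ler_wpM2r ?addr_ge0 ?mulr_ge0 ?(ltW x0) //.
      by apply: prob_le => // w; exact.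
    by move=> b; apply: xE; rewrite (leq_trans (leq_maxr k0 k1)) ?leq_addr.
  have [n _ hn] := nbhs_infty_ger ((y * x)^-1).
  have := hn n (leqnn n); rewrite /= -[_^-1]mul1r ler_pdivrMr ?mulr_gt0 //.
  by have := bound n; nra.
- move=> w /= nE n _ b bn Ekb; apply: nE; exists (k + b)%N => //.
  by rewrite (leq_trans (leq_maxl k0 k1)) // leq_addr.
Qed.

End independent_blocks.

(** * Favorable scales occur infinitely often *)

Section side_lower.
Context d (T : measurableType d) (R : realType) (P : probability T R).
Variable Z : nat + nat -> T -> nat.
Hypothesis mZ : forall i, discrete_rv (Z i).
Hypothesis indZ : mutually_independent P
  (fun i => [set A | exists B : set nat, A = Z i @^-1` B]).
Variables (h : nat -> nat + nat) (p : nat -> R).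
Hypotheses (hI : injective h) (pp : prob_vector p).
Hypothesis law : forall j n, P (Z (h j) @^-1` [set n]) = (p n)%:E.
Variable f : nat -> R.
Hypotheses (f2 : forall i, `|f i| <= 2) (mf : mean p f = 0).

Lemma measurable_window_ge (c e : R) a l :
  measurable [set w | c <= e * window_sum Z h f a l w].
Proof. exact: measurable_superlevel (measurable_window_fun mZ h (fun u => e * u) f a l) c. Qed.

(** Only one of the two variances is assumed positive. On a side with variance zero, f vanishes at
    every label of positive probability and the window sum is almost surely 0, so threshold 0 is met
    with probability 1. *)
Lemma null_window (a l : nat) (e : R) : mean p (fun i => f i ^+ 2) = 0 ->
  1 <= prob P [set w | 0 <= e * window_sum Z h f a l w].
Proof.
move=> v0; have bf : unif_bounded f by exists 2.
have pf n : p n * f n ^+ 2 = 0.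
  have p0 i : 0 <= p i by case: pp => _ [].
  have pos i : 0 <= p i * f i ^+ 2 by rewrite mulr_ge0 ?sqr_ge0.
  apply/eqP; rewrite eq_le pos andbT -v0.
  have mono : nondecreasing_seq (series (fun i => p i * f i ^+ 2)).
    by apply: nondecreasing_series => i _ _; exact: pos.
  apply: le_trans (nondecreasing_cvgn_le mono (mean_cvg pp (unif_bounded_sqr bf)) n.+1).
  by rewrite /series /= big_nat_recr //= lerDr sumr_ge0.
pose A j := [set w | f (Z (h (a + j)%N) w) != 0].
have mA j : measurable (A j) by exact: (mZ (h (a + j)%N) [set n | f n != 0]).
have PA j : P (A j) = 0%E.
  rewrite (total_probability P (mZ (h (a + j)%N)) (mA j)) eseries0 // => n _ _.
  have [fn|fn] := eqVneq (f n) 0.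
    rewrite [X in P X](_ : _ = set0) ?measure0 //.
    by apply/seteqP; split => // w [] /= + wn; rewrite /A /= wn fn eqxx.
  have pn : p n = 0.
    by apply/eqP; have /eqP := pf n; rewrite mulf_eq0 sqrf_eq0 (negbTE fn) orbF.
  apply/eqP; rewrite eq_le measure_ge0 andbT -[leRHS]/(0%:E) -pn -(law (a + j)%N n).
  apply: le_measure; rewrite ?inE; [|exact: mZ|by move=> w []].
  by apply: measurableI; [exact: mA|exact: mZ].
pose E := [set w | exists2 j, (j < l)%N & A j w].
have mE : measurable E by exact: measurable_exists_lt.
have PE : prob P E = 0.
  have ub : (P E <= (l%:R * 0)%:E)%E by apply: union_bound => // j _; rewrite PA.
  apply/le_anti; rewrite prob_ge0 andbT.
  by move: ub; rewrite probE // lee_fin mulr0.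
have -> : 1 = prob P (~` E) by rewrite probC // PE subr0.
apply: prob_le.
- exact: measurableC.
- exact: measurable_window_ge.
move=> w nE /=; rewrite /window_sum big_seq big1 ?mulr0 // => j.
rewrite mem_iota => /andP[aj jl]; apply/eqP/negP => /negP fj; apply: nE.
exists (j - a)%N; first lia.
by rewrite /A /= subnKC.
Qed.

Lemma window_two_sided_lower : exists th q : R, exists l0 : nat,
  [/\ 0 <= th, 0 < q <= 1, (0 < mean p (fun i => f i ^+ 2) -> 0 < th) &
   forall e, e ^+ 2 = 1 -> forall a l, (l0 <= l)%N ->
     q <= prob P [set w | th * Num.sqrt l%:R <= e * window_sum Z h f a l w]].
Proof.
have bf : unif_bounded f by exists 2.
have v0 : 0 <= mean p (fun i => f i ^+ 2).
  by apply: (mean_ge0 pp) => [|i]; [exact: unif_bounded_sqr|exact: sqr_ge0].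
have [v|] := ltP 0 (mean p (fun i => f i ^+ 2)); last first.
  move=> v; have {v0} v : mean p (fun i => f i ^+ 2) = 0 by apply/le_anti/andP.
  exists 0, 1, 0%N; split => [||v1|e _ a l _]; first exact: lexx.
  - by rewrite ltr01 lexx.
  - by [].
  - by rewrite mul0r; exact: null_window.
have f2' i : `|- f i| <= 2 by rewrite normrN.
have mf' : mean p (fun i => - f i) = 0.
  have := meanZ pp (-1) bf; rewrite mf mulr0 => <-.
  by congr mean; apply/funext => i; rewrite mulN1r.
have v' : 0 < mean p (fun i => (- f i) ^+ 2).
  by rewrite (_ : (fun i => _) = (fun i => f i ^+ 2)) //; apply/funext => i; rewrite sqrrN.
have [t1 [q1 [t10 q10 [l1 h1]]]] := window_lower mZ indZ hI pp law f2 mf v.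
have [t2 [q2 [t20 q20 [l2 h2]]]] := window_lower mZ indZ hI pp law f2' mf' v'.
exists (Num.min t1 t2), (Num.min (Num.min q1 q2) 1), (maxn l1 l2).
split=> [||_|]; rewrite ?lt_min ?t10 ?t20 ?q10 ?q20 ?ltr01 ?ge_min ?lexx ?orbT //.
  by rewrite le_min !ltW.
have eE (e : R) : e ^+ 2 = 1 -> e = 1 \/ e = -1.
  by move=> /eqP; rewrite sqrf_eq1 => /orP[] /eqP ->; [left|right].
move=> e /eE e1 a l; rewrite geq_max => /andP[ll1 ll2].
rewrite -lee_fin -probE; last exact: measurable_window_ge.
case: e1 => ->.
- apply: (@le_trans _ _ q1%:E); first by rewrite lee_fin !ge_min lexx.
  apply: (le_trans (h1 a l ll1)); apply: le_measure; rewrite ?inE.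
  + exact: measurable_superlevel (measurable_window_fun mZ h id f a l) _.
  + exact: measurable_window_ge.
  move=> w /=; rewrite mul1r; apply: le_trans.
  by rewrite ler_wpM2r ?sqrtr_ge0 // ge_min lexx.
- apply: (@le_trans _ _ q2%:E); first by rewrite lee_fin !ge_min lexx orbT.
  apply: (le_trans (h2 a l ll2)); apply: le_measure; rewrite ?inE.
  + exact: measurable_superlevel (measurable_window_fun mZ h id (fun i => - f i) a l) _.
  + exact: measurable_window_ge.
  move=> w /=; rewrite window_sumN mulN1r; apply: le_trans.
  by rewrite ler_wpM2r ?sqrtr_ge0 // ge_min lexx orbT.
Qed.

End side_lower.

(** The exponents of 2 add up: (32^k - k - 1) + (4 k + 1) + (2 * 32^k - 3 k) = 3 * 32^k. The first
    factor is the number of runs that fit between N and N + N^(3/4). *)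
Lemma run_total k : (2 ^ (32 ^ k - k.+1) * (2 * 16 ^ k * block_length k) = scale k ^ 3)%N.
Proof.
have k2 : (k.+1 <= 32 ^ k)%N by rewrite ltn_expl.
have k3 := three_mul_le k.
rewrite /block_length /scale -expnM (_ : 16 = 2 ^ 4)%N // -expnM -expnS -!expnD.
congr expn; move: k2 k3; set K := (32 ^ k)%N; clearbody K; clear; lia.
Qed.

Lemma block_length_ge k : (k <= block_length k)%N.
Proof.
rewrite /block_length (leq_trans (ltnW (ltn_expl k (isT : 1 < 2)%N))) // leq_pexp2l //.
by elim: k => // k; rewrite expnS; lia.
Qed.

Lemma scale_ge k : (k + 16 <= scale k ^ 4)%N.
Proof.
have sk : (k.+2 <= scale k)%N.
  rewrite /scale; have h1 : (k < 32 ^ k)%N by rewrite ltn_expl.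
  have h2 : (32 ^ k < 2 ^ (32 ^ k))%N by rewrite ltn_expl.
  by rewrite (leq_trans _ h2) // ltnS.
have s2 : (2 <= scale k)%N by rewrite (leq_trans _ sk).
have -> : (scale k ^ 4 = scale k ^ 3 * scale k)%N by rewrite -expnSr.
have : (2 ^ 3 <= scale k ^ 3)%N by rewrite leq_exp2r.
by move: sk s2; set a := scale k; set b := (a ^ 3)%N; clearbody b; clear; nia.
Qed.

Lemma scale_gap k : (2 * (2 * scale k ^ 4) <= scale k.+1 ^ 4)%N.
Proof.
have -> : (scale k.+1 ^ 4 = (scale k ^ 4) * (scale k ^ 4) ^ 31)%N.
  by rewrite -expnS /scale -!expnM; congr expn; rewrite [(32 ^ _)%N]expnS; ring.
have h := scale_ge k; rewrite mulnA mulnC leq_mul2l; apply/orP; right.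
rewrite (leq_trans _ (_ : 16 ^ 1 <= _)%N) // (leq_trans _ (_ : (scale k ^ 4) ^ 1 <= _)%N) //.
  by rewrite leq_exp2r // (leq_trans _ h) // leq_addl.
by rewrite leq_pexp2l // (leq_trans _ h) // addnC.
Qed.

(** If a block succeeds with probability at least 2^(-c), a run does so with probability at least 2
    to the minus left side; the right side is the logarithm of the number of runs. The factor 2^k in
    32^k = 16^k * 2^k beats any fixed c. *)
Lemma run_length_le c k : (2 * c <= k)%N -> (c * (2 * 16 ^ k) <= 32 ^ k - k.+1)%N.
Proof.
move=> ck; have h1 : (k < 2 ^ k)%N by rewrite ltn_expl.
have h2 : (k < 16 ^ k)%N by rewrite ltn_expl.
have -> : (32 ^ k = 16 ^ k * 2 ^ k)%N by rewrite -expnMn.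
have : (16 ^ k * (2 * c + 1) <= 16 ^ k * 2 ^ k)%N by rewrite leq_mul2l; apply/orP; right; lia.
by move: h2; set a := (16 ^ k)%N; set b := (a * 2 ^ k)%N; clearbody a b; clear; nia.
Qed.

Section favorable.
Context d (T : measurableType d) (R : realType) (P : probability T R).
Variable Z : nat + nat -> T -> nat.
Hypothesis mZ : forall i, discrete_rv (Z i).
Hypothesis indZ : mutually_independent P
  (fun i => [set A | exists B : set nat, A = Z i @^-1` B]).
Variables (r s : nat -> R).
Hypotheses (pr : prob_vector r) (ps : prob_vector s).
Let mu := rsum (fun i => r i * s i).
Hypothesis lawR : forall j n, P (Z (inl j) @^-1` [set n]) = (r n)%:E.
Hypothesis lawS : forall j n, P (Z (inr j) @^-1` [set n]) = (s n)%:E.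

Let SR a l w : R := window_sum Z inl (fun i => s i - mu) a l w.
Let SS a l w : R := window_sum Z inr (fun i => r i - mu) a l w.

(** The two signs are free because the event is used with (-1, 1) for the drift before N and with
    (eps, - eps) for the blocks. *)
Definition pair_event (thR thS eR eS : R) a l : set T :=
  [set w | thR * Num.sqrt l%:R <= eR * SR a l w] `&`
  [set w | thS * Num.sqrt l%:R <= eS * SS a l w].

Lemma pair_event_determined thR thS eR eS a l :
  determined Z (interval_index a (a + l)) (pair_event thR thS eR eS a l).
Proof.
have idx (h : nat -> nat + nat) f w w' : (forall j, interval_index a (a + l) (h j) =
    (a <= j < a + l)%N) -> (forall i, interval_index a (a + l) i -> Z i w = Z i w') ->
    window_sum Z h f a l w = window_sum Z h f a l w' :> R.
  move=> hE ww'; apply: window_sum_determined => i /mapP[j].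
  by rewrite mem_iota => jj ->; apply: ww'; rewrite hE.
by move=> w w' ww' [/= h1 h2]; split => /=; rewrite /SR /SS -(idx _ _ w w').
Qed.

Lemma pair_event_prob thR thS qR qS eR eS a l : 0 <= qR -> 0 <= qS ->
  qR <= prob P [set w | thR * Num.sqrt l%:R <= eR * SR a l w] ->
  qS <= prob P [set w | thS * Num.sqrt l%:R <= eS * SS a l w] ->
  qR * qS <= prob P (pair_event thR thS eR eS a l).
Proof.
move=> qR0 qS0 hR hS; rewrite (prob_indep mZ indZ (b := (a + l)%N)
  (D1 := fun i => i \in map inl (iota a l)) (D2 := fun i => i \in map inr (iota a l))).
- exact: ler_pM.
- by move=> w w' ww' /=; rewrite /SR (window_sum_determined _ ww').
- by move=> w w' ww' /=; rewrite /SS (window_sum_determined _ ww').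
- move=> _ /mapP[j + ->]; rewrite mem_iota => /andP[aj jl].
  by apply: (@interval_index_below 0 (a + l)); rewrite //=.
- move=> _ /mapP[j + ->]; rewrite mem_iota => /andP[aj jl].
  by apply: (@interval_index_below 0 (a + l)); rewrite //=.
- by move=> _ /mapP[j _ ->] /mapP[].
Qed.

Definition run_event (thR thS eps : R) t l q : set T :=
  all_below (fun b => pair_event thR thS eps (- eps) (t + b * l) l) q.

Definition favorable_event (thR thS eps : R) k : set T :=
  let M := (2 * scale k ^ 4)%N in let N := (scale k.+1 ^ 4)%N in
  let l := block_length k.+1 in let q := (2 * 16 ^ k.+1)%N in
  pair_event thR thS (-1) 1 M (N - M) `&`
  ~` all_below (fun i => ~` run_event thR thS eps (N + i * (q * l)) l q)
       (2 ^ (32 ^ k.+1 - k.+2)).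

Lemma run_event_determined thR thS eps t l q :
  determined Z (interval_index t (t + q * l)) (run_event thR thS eps t l q).
Proof.
have := @all_below_determined _ _ Z (fun b => pair_event thR thS eps (- eps) (t + b * l) l)
  (fun b => t + b * l)%N q; rewrite /= mul0n addn0; apply => b.
  by rewrite leq_add2l leq_mul2r leqnSn orbT.
by rewrite mulSn [(l + _)%N]addnC addnA; exact: pair_event_determined.
Qed.

Lemma run_event_prob thR thS eps t l q (x : R) : 0 <= x ->
  (forall a, x <= prob P (pair_event thR thS eps (- eps) a l)) ->
  x ^+ q <= prob P (run_event thR thS eps t l q).
Proof.
move=> x0 hx; rewrite (@prob_all_below _ _ _ P Z mZ indZ _ (fun b => t + b * l)%N).
- rewrite -[leLHS](_ : \prod_(b < q) x = _); last by rewrite prodr_const card_ord.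
  by apply: ler_prod => b _; rewrite x0 hx.
- by move=> b; rewrite leq_add2l leq_mul2r leqnSn orbT.
- by move=> b; rewrite mulSn [(l + _)%N]addnC addnA; exact: pair_event_determined.
Qed.

Let no_run_determined thR thS eps k n :
  let N := (scale k.+1 ^ 4)%N in
  let l := block_length k.+1 in let q := (2 * 16 ^ k.+1)%N in
  determined Z (interval_index N (N + n * (q * l)))
    (all_below (fun i => ~` run_event thR thS eps (N + i * (q * l)) l q) n).
Proof.
move=> N l q.
have := @all_below_determined _ _ Z
  (fun i => ~` run_event thR thS eps (N + i * (q * l)) l q)
  (fun i => N + i * (q * l))%N n; rewrite /= mul0n addn0; apply => b.
  by rewrite leq_add2l leq_mul2r leqnSn orbT.
apply: determinedC; rewrite mulSn [(q * l + _)%N]addnC addnA.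
exact: run_event_determined.
Qed.

(** The runs end by N + N^(3/4) <= 2 N, where the next scale begins to look; hence different scales
    use disjoint labels. *)
Lemma favorable_event_determined thR thS eps k :
  determined Z (interval_index (2 * scale k ^ 4) (2 * scale k.+1 ^ 4))
    (favorable_event thR thS eps k).
Proof.
have gap := scale_gap k; have MN : (2 * scale k ^ 4 <= scale k.+1 ^ 4)%N.
  by rewrite (leq_trans _ gap) // leq_pmull.
apply: determinedI.
  apply: (interval_sub _ _ (@pair_event_determined _ _ _ _ _ _)) => //.
  by rewrite subnKC // leq_pmull.
apply: determinedC; apply: (interval_sub _ _ (@no_run_determined _ _ _ _ _)) => //.
rewrite run_total mul2n -addnn leq_add2l leq_exp2l //.
by rewrite -(expn0 2) ltn_exp2l // expn_gt0.
Qed.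

(** The drift before N contributes x. Independently of it, at least one of the A runs succeeds with
    probability at least 1/2, because A x^q >= 1 once k is large. *)
Lemma favorable_event_prob thR thS eps (x : R) l0 : 0 < x <= 1 ->
  (forall eR eS, eR ^+ 2 = 1 -> eS ^+ 2 = 1 -> forall a l, (l0 <= l)%N ->
     x <= prob P (pair_event thR thS eR eS a l)) -> eps ^+ 2 = 1 ->
  exists k1, forall k, (k1 <= k)%N -> x / 2 <= prob P (favorable_event thR thS eps k).
Proof.
move=> /andP[x0 x1] hx eps2.
have [c _ hc] := nbhs_infty_ger x^-1; have {hc} cx : 1 <= 2 ^+ c * x.
  rewrite -ler_pdivrMr // div1r (le_trans (hc c (leqnn c))) // -natrX ler_nat.
  by rewrite ltnW // ltn_expl.
exists (2 * c + l0)%N => k kk.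
have gap := scale_gap k; have MN : (2 * scale k ^ 4 <= scale k.+1 ^ 4)%N.
  by rewrite (leq_trans _ gap) // leq_pmull.
have lk : (l0 <= block_length k.+1)%N.
  by rewrite (leq_trans _ (block_length_ge _)) // leqW // (leq_trans _ kk) // leq_addl.
have NM : (l0 <= scale k.+1 ^ 4 - 2 * scale k ^ 4)%N.
  have := scale_ge k; move: gap kk; set a := (scale k ^ 4)%N; set b := (scale _ ^ 4)%N.
  by clearbody a b; lia.
set M := (2 * scale k ^ 4)%N in MN NM *; set N := (scale k.+1 ^ 4)%N in MN NM *.
set l := block_length k.+1 in lk *; set q := (2 * 16 ^ k.+1)%N.
set A := (2 ^ (32 ^ k.+1 - k.+2))%N.
have epsN : (- eps) ^+ 2 = 1 by rewrite sqrrN.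
have run i : x ^+ q <= prob P (run_event thR thS eps (N + i * (q * l)) l q).
  by apply: run_event_prob => [|a]; [exact: ltW|exact: hx].
rewrite /favorable_event -/M -/N -/l -/q -/A.
have dno := @no_run_determined thR thS eps k A.
rewrite (@interval_indep _ _ _ P Z mZ indZ M N (N + A * (q * l)) _ _ MN (leq_addr _ _)).
- apply: ler_pM; rewrite ?invr_ge0 ?(ltW x0) //; first by apply: hx; rewrite ?expr1n ?sqrrN ?expr1n.
  rewrite probC; last exact: (interval_measurable mZ dno).
  have none := @prob_none_le _ _ _ P Z mZ indZ
    (fun i => run_event thR thS eps (N + i * (q * l)) l q)
    (fun i => N + i * (q * l))%N A (x ^+ q).
  have xq : 0 <= x ^+ q <= 1 by rewrite exprn_ge0 ?exprn_ile1 // ltW.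
  have {none} none := none _ _ xq run.
  have A1 : 1 <= A%:R * x ^+ q.
    apply: (@le_trans _ _ (2 ^+ (c * q) * x ^+ q)).
      by rewrite exprM -exprMn exprn_ege1.
    rewrite ler_wpM2r ?exprn_ge0 ?(ltW x0) // /A natrX ler_weXn2l ?ler1n //.
    by apply: run_length_le; rewrite leqW // (leq_trans _ kk) // leq_addr.
  have : prob P (all_below (fun i => ~` run_event thR thS eps (N + i * (q * l)) l q) A)
      * (1 + A%:R * x ^+ q) <= 1.
    apply: none => i; first by rewrite leq_add2l leq_mul2r leqnSn orbT.
    rewrite mulSn [(q * l + _)%N]addnC addnA; exact: run_event_determined.
  set y := prob P _; have y0 : 0 <= y by exact: prob_ge0.
  by clearbody y; nra.
- by have := @pair_event_determined thR thS (-1) 1 M (N - M); rewrite subnKC.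
- by apply: determinedC; exact: dno.
Qed.

Lemma favorable_eventP thR thS eps k w : favorable_event thR thS eps k w ->
  favorable r s mu (fun j => Z (inl j) w) (fun j => Z (inr j) w) eps thR thS k.
Proof.
have gap := scale_gap k; have MN : (2 * scale k ^ 4 <= scale k.+1 ^ 4)%N.
  by rewrite (leq_trans _ gap) // leq_pmull.
move=> [[/= hR hS] hrun].
have [i iA hi] : exists2 i, (i < 2 ^ (32 ^ k.+1 - k.+2))%N &
    run_event thR thS eps (scale k.+1 ^ 4 + i * (2 * 16 ^ k.+1 * block_length k.+1))
      (block_length k.+1) (2 * 16 ^ k.+1) w.
  apply: contrapT => no; apply: hrun => i iA hi; apply: no; by exists i.
split.
- move: hR; rewrite /SR window_sum_deviation subnKC // natrB // mulN1r.
  by [].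
- by move: hS; rewrite /SS window_sum_deviation subnKC // natrB // mul1r.
exists i.
  rewrite -run_total (_ : 2 * i * _ + _ = i.+1 * (2 * 16 ^ k.+1))%N; last by ring.
  by rewrite -mulnA leq_mul2r iA orbT.
move=> b bq t.
have [] := hi b bq; rewrite /= /SR /SS !window_sum_deviation.
have -> : (scale k.+1 ^ 4 + i * (2 * 16 ^ k.+1 * block_length k.+1)
    + b * block_length k.+1 = t)%N by rewrite /t /block_start; ring.
by split.
Qed.

Lemma ae_favorable :
  0 < rsum (fun i => r i * (s i - mu) ^+ 2) \/ 0 < rsum (fun i => s i * (r i - mu) ^+ 2) ->
  exists thR thS : R, [/\ 0 <= thR, 0 <= thS, 0 < thR + thS &
    forall eps, eps ^+ 2 = 1 -> {ae P, forall w, forall k0, exists2 k, (k0 <= k)%N &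
      favorable r s mu (fun j => Z (inl j) w) (fun j => Z (inr j) w) eps thR thS k}].
Proof.
move=> var.
have iL : injective (inl : nat -> nat + nat) by move=> ? ? [].
have iR : injective (inr : nat -> nat + nat) by move=> ? ? [].
have fR := centered_le2 pr ps ps; have fS := centered_le2 pr ps pr.
have [thR [qR [lR [tR0 /andP[qR0 qR1] vR hR]]]] :=
  window_two_sided_lower mZ indZ iL pr lawR fR (mean_centeredR pr ps).
have [thS [qS [lS [tS0 /andP[qS0 qS1] vS hS]]]] :=
  window_two_sided_lower mZ indZ iR ps lawS fS (mean_centeredS pr ps).
exists thR, thS; split => //.
  by case: var => [/vR|/vS] ?; [rewrite ltr_pwDl|rewrite ltr_wpDl].
move=> eps eps2.
have q01 : 0 < qR * qS <= 1 by rewrite mulr_gt0 //= mulr_ile1 // ltW.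
have pairs eR eS : eR ^+ 2 = 1 -> eS ^+ 2 = 1 -> forall a l, (maxn lR lS <= l)%N ->
    qR * qS <= prob P (pair_event thR thS eR eS a l).
  move=> eR2 eS2 a l; rewrite geq_max => /andP[ll1 ll2].
  by apply: pair_event_prob; [exact: ltW|exact: ltW|exact: hR|exact: hS].
have [k1 hk1] := favorable_event_prob q01 pairs eps2.
have tS k : (2 * scale k ^ 4 <= 2 * scale k.+1 ^ 4)%N.
  by rewrite leq_mul2l /= (leq_trans _ (scale_gap k)) // mulnA leq_pmull.
have x01 : 0 < qR * qS / 2 <= 1.
  by case/andP: q01 => q0 q1; rewrite divr_gt0 //=; lra.
have := ae_infinitely_often mZ indZ tS (fun k => @favorable_event_determined thR thS eps k)
  x01 hk1.
apply: filterS => w h k0; have [k kk0 hk] := h k0.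
by exists k => //; exact: favorable_eventP.
Qed.

End favorable.

(** * The theorem *)

(** Passes from the family including the randomization (index [None]) to the labels, on which all
    the almost sure events are built. *)
Lemma mutually_independent_Some d (T : measurableType d) (R : realType)
    (P : probability T R) (I : eqType) (F : option I -> set (set T)) :
  mutually_independent P F -> mutually_independent P (fun i => F (Some i)).
Proof.
move=> ind J A uJ AF.
have := ind [seq Some i | i <- J] (fun o => if o is Some i then A i else setT).
have sI : injective (@Some I) by move=> i j [].
rewrite (map_inj_uniq sI).
rewrite !big_map => h; apply: (h uJ) => _ /mapP[i iJ ->]; exact: AF.
Qed.

Lemma limn_einf_ninfty (R : realType) (u : nat -> R) :
  (forall B n0, exists2 n, (n0 <= n)%N & B <= - u n) ->
  limn_einf (fun n => (u n)%:E) = -oo%E.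
Proof.
move=> h; transitivity (- limn_esup (fun n => (- u n)%:E))%E; first by [].
by rewrite (limn_esup_pinfty h).
Qed.

Unset Implicit Arguments. Set Strict Implicit. Set Printing Implicit Defensive.

Theorem theorem4p3
  (R : realType) (d : measure_display) (T : measurableType d)
  (P : probability T R)
  (r s : nat -> R)
  (LR LS : nat -> T -> nat)
  (dV : measure_display) (V : measurableType dV) (U : T -> V)
  (g : nat -> V -> seq nat -> seq nat -> bool)
  (a : nat -> V -> bool) :
  (* probability vectors on the positive integers, mu > 0 *)
  prob_vector r -> prob_vector s ->
  let mu := rsum (fun i => r i * s i) in
  0 < mu ->
  (* standing assumption sigma_R + sigma_S > 0 *)
  (0 < rsum (fun i => r i * (s i - mu) ^+ 2) \/
   0 < rsum (fun i => s i * (r i - mu) ^+ 2)) ->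
  (* labels are random variables with the prescribed marginals *)
  (forall j (B : set nat), measurable (LR j @^-1` B)) ->
  (forall j (B : set nat), measurable (LS j @^-1` B)) ->
  (forall j i, P (LR j @^-1` [set i]) = (r i)%:E) ->
  (forall j i, P (LS j @^-1` [set i]) = (s i)%:E) ->
  (* randomization U (generating F_0) *)
  measurable_fun setT U ->
  (* U, (LR j)_j, (LS k)_k are mutually independent *)
  mutually_independent P
    (fun o : option (nat + nat) => match o with
      | None => [set A | exists2 B : set V, measurable B & A = U @^-1` B]
      | Some (inl j) => [set A | exists B : set nat, A = LR j @^-1` B]
      | Some (inr k) => [set A | exists B : set nat, A = LS k @^-1` B]
      end) ->
  (* greedy policy: C_G(n+1) = g n U (observed R-labels) (observed S-labels),
     hence F_n-measurable *)
  (forall n hR hS, measurable [set v | g n v hR hS]) ->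
  (forall w n, (1 <= n)%N ->
     let c := counts (fun k => g k (U w)) (LR^~ w) (LS^~ w) n in
     (Gamma s (LR^~ w) c.1 < Gamma r (LS^~ w) c.2 ->
        g n (U w) (hist (LR^~ w) c.1) (hist (LS^~ w) c.2) = true) /\
     (Gamma r (LS^~ w) c.2 < Gamma s (LR^~ w) c.1 ->
        g n (U w) (hist (LR^~ w) c.1) (hist (LS^~ w) c.2) = false)) ->
  (* alternating policy: C_A(n+1) = a n U (F_0-measurable), R(2n) = n *)
  (forall n, measurable [set v | a n v]) ->
  (forall w n, (\sum_(k < 2 * n) a k (U w))%N = n) ->
  let MG w n := matches (LR^~ w) (LS^~ w)
                  (counts (fun k => g k (U w)) (LR^~ w) (LS^~ w) n) in
  let MA w n := matches (LR^~ w) (LS^~ w)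
                  (counts (fun k _ _ => a k (U w)) (LR^~ w) (LS^~ w) n) in
  let ratio w n := ((MG w n)%:R - (MA w n)%:R) /
      (n%:R `^ (5%:R / 4%:R) * (ln (ln n%:R)) `^ (1 / 4%:R)) : R in
  {ae P, forall w, limn_einf (fun n => (ratio w n)%:E) = -oo%E} /\
  {ae P, forall w, limn_esup (fun n => (ratio w n)%:E) = +oo%E} /\
  {ae P, forall w, exists C : R,
      \forall n \near \oo, `|ratio w n| <= C * (ln n%:R) `^ (1 / 2%:R)}.
Proof.
move=> pr ps mu mu0 var mLR mLS lawR lawS _ ind _ greedy _ alt MG MA ratio.
pose Z (i : nat + nat) : T -> nat := match i with inl j => LR j | inr j => LS j end.
have mZ i : discrete_rv (Z i) by case: i.
have indZ : mutually_independent P (fun i => [set A | exists B : set nat, A = Z i @^-1` B]).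
  move=> J A uJ hA; apply: (mutually_independent_Some ind) => // -[j|j] /hA; exact.
have r01 := prob_vector_bounds pr; have s01 := prob_vector_bounds ps.
have mu1 : mu <= 1 by case/andP: (mu_bounds pr ps).
pose cG w n := counts (fun k => g k (U w)) (LR^~ w) (LS^~ w) n.
pose cA w n := counts (fun k _ _ => a k (U w)) (LR^~ w) (LS^~ w) n.
have sumG w n : ((cG w n).1 + (cG w n).2 = n)%N by exact: counts_sum.
have sumA w n : ((cA w n).1 + (cA w n).2 = n)%N by exact: counts_sum.
have balG w n : `|Gamma s (LR^~ w) (cG w n).1 - Gamma r (LS^~ w) (cG w n).2| <= 1.
  exact: (greedy_balanced r01 s01 (greedy w) n).
have balA w n := @alternating_balanced (fun k => a k (U w)) (LR^~ w) (LS^~ w) n (alt w).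
have [C C0 reg] := ae_regular mZ indZ pr ps lawR lawS.
have [thR [thS [tR0 tS0 t0 fav]]] := ae_favorable mZ indZ pr ps lawR lawS var.
(* The sign eps = -1 yields the lower limit and eps = 1 the upper one; D is positive in both cases
   and only the direction of the runs changes. *)
have unbounded (eps : R) : eps ^+ 2 = 1 ->
    {ae P, forall w, forall B n0, exists2 n, (n0 <= n)%N & B <= eps * ratio w n}.
  move=> eps2; apply: filterS2 reg (fav eps eps2) => w regw favw B n0.
  exact: (match_ratio_unbounded r01 s01 C0 mu0 mu1 (sumG w) (sumA w) (balG w) (balA w)
    regw eps2 tR0 tS0 t0 favw).
split; [|split].
- have := unbounded (-1) ltac:(by rewrite sqrrN expr1n); apply: filterS => w h.
  by apply: limn_einf_ninfty => B n0; have [n nn Bn] := h B n0; exists n => //; rewrite -mulN1r.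
- have := unbounded 1 ltac:(by rewrite expr1n); apply: filterS => w h.
  by apply: limn_esup_pinfty => B n0; have [n nn Bn] := h B n0; exists n => //; rewrite -[ratio _ _]mul1r.
- apply: filterS reg => w regw.
  exact: (match_ratio_bigO C0 mu0 mu1 (sumG w) (sumA w) (balG w) (balA w) regw).
Qed.
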